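(* Let $\Gamma$ be a finite connected metric graph with vertices $v_1,\dots,v_V$ and let $q:\Gamma\to\mathbb{R}$ be measurable and bounded with $q(x)\ge0$ for almost all $x\in\Gamma$. Let $\lambda\mapsto\gamma(\lambda)$ and $\lambda\mapsto M(\lambda)$ be the $\gamma$-field and Weyl function of the boundary triple $\{\mathbb{C}^V,\Gamma_0,\Gamma_1\}$ given by the maps $\Gamma_0f=(f(v_1),\dots,f(v_V))^\top$, $\Gamma_1f=(-\partial_\nu f(v_1),\dots,-\partial_\nu f(v_V))^\top$, and let $\Lambda_q$ be the Dirichlet-to-Neumann matrix. (i) For $\lambda\in\rho(-\Delta_{{\rm K},\Gamma,q})\cap\rho(-\Delta_{{\rm D},\Gamma,q})$, $$(-\Delta_{{\rm K},\Gamma,q}-\lambda)^{-1}-(-\Delta_{{\rm D},\Gamma,q}-\lambda)^{-1}=-\gamma(\lambda)\big(\Lambda_q+M(\lambda)\big)^{-1}\gamma(\overline\lambda)^*.$$ In particular, $$\dim\operatorname{ran}\Big[(-\Delta_{{\rm K},\Gamma,q}-\lambda)^{-1}-(-\Delta_{{\rm D},\Gamma,q}-\lambda)^{-1}\Big]=V.$$ (ii) For $\lambda\in\rho(-\Delta_{{\rm K},\Gamma,q})\cap\rho(-\Delta_{{\rm st},\Gamma,q})\cap\rho(-\Delta_{{\rm D},\Gamma,q})$, $$(-\Delta_{{\rm K},\Gamma,q}-\lambda)^{-1}-(-\Delta_{{\rm st},\Gamma,q}-\lambda)^{-1}=\gamma(\lambda)\big(\Lambda_q+M(\lambda)\big)^{-1}\Lambda_qM(\lambda)^{-1}\gamma(\overline\lambda)^*.$$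 In particular, $$\dim\operatorname{ran}\Big[(-\Delta_{{\rm K},\Gamma,q}-\lambda)^{-1}-(-\Delta_{{\rm st},\Gamma,q}-\lambda)^{-1}\Big]=\dim\operatorname{ran}\Lambda_q=\begin{cases}V-1&\text{if }q=0\text{ identically},\\ V&\text{else.}\end{cases}$$
   Context: A finite metric graph $\Gamma$ consists of a finite vertex set $\mathcal{V}$, a finite nonempty edge set $\mathcal{E}$ (loops and multiple edges allowed) and a length function $\ell:\mathcal{E}\to(0,\infty)$; $V=|\mathcal{V}|$. Each edge $e$ is identified with $[0,\ell(e)]$, its two endpoints corresponding to the (possibly equal) vertices incident with $e$. A function $f$ on $\Gamma$ is a collection $(f_e)_{e\in\mathcal{E}}$ of functions $f_e:(0,\ell(e))\to\mathbb{C}$; $f\in L^2(\Gamma)$ means $f_e\in L^2(0,\ell(e))$ for all $e$. $\widetilde H^k(\Gamma)$ is the set of $f\in L^2(\Gamma)$ with $f_e\in H^k(0,\ell(e))$ for all $e$; $H^1(\Gamma)$ is the set of $f\in\widetilde H^1(\Gamma)$ that are continuous at each vertex (all traces at endpoints corresponding to the same vertex $v$ coincide; the common value is $f(v)$). For $f\in\widetilde H^2(\Gamma)$ and $v\in\mathcal{V}$, $\partial_\nu f(v)$ is the sum, over all edge endpoints located at $v$ (both endpoints of a loop at $v$ are counted), of the derivative of $f_e$ at that endpoint taken in the direction pointing towards $v$ (i.e. $f_e'(\ell(e))$ for the endpoint $\ell(e)$ and $-f_e'(0)$ for the endpoint $0$). All operators below act in $L^2(\Gamma)$ as $f\mapsto(-f_e''+q_ef_e)_{e\in\mathcal{E}}$.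 $S$ has domain $\{f\in\widetilde H^2(\Gamma)\cap H^1(\Gamma): f(v)=\partial_\nu f(v)=0\ \forall v\in\mathcal{V}\}$; it is closed, symmetric, densely defined with a positive lower bound. $S^*$ has domain $\widetilde H^2(\Gamma)\cap H^1(\Gamma)$. The perturbed Dirichlet Laplacian $-\Delta_{{\rm D},\Gamma,q}$ (self-adjoint) has domain $\{f\in\widetilde H^2(\Gamma)\cap H^1(\Gamma): f(v)=0\ \forall v\}$; the perturbed standard Laplacian $-\Delta_{{\rm st},\Gamma,q}$ (self-adjoint) has domain $\{f\in\widetilde H^2(\Gamma)\cap H^1(\Gamma):\partial_\nu f(v)=0\ \forall v\}$; the perturbed Krein Laplacian $-\Delta_{{\rm K},\Gamma,q}$ is the Krein–von Neumann extension of $S$, i.e. the self-adjoint restriction of $S^*$ to $\operatorname{dom}S\dotplus\ker S^*$. $\rho(\cdot)$ denotes the resolvent set. $\Gamma_0,\Gamma_1$ are defined on $\operatorname{dom}S^*$. For $\lambda\in\rho(-\Delta_{{\rm D},\Gamma,q})$ and $\varphi\in\mathbb{C}^V$ there is a unique $f\in\ker(S^*-\lambda)$ with $\Gamma_0f=\varphi$; the $\gamma$-field $\gamma(\lambda):\mathbb{C}^V\to L^2(\Gamma)$ and the Weyl function $M(\lambda):\mathbb{C}^V\to\mathbb{C}^V$ are the linear maps $\gamma(\lambda)\varphi=f$ and $M(\lambda)\varphi=\Gamma_1f$. The Dirichlet-to-Neumann matrix $\Lambda_q\in\mathbb{C}^{V\times V}$ is determined by $(\partial_\nu f_*(v_1),\dots,\partial_\nu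 f_*(v_V))^\top=\Lambda_q(f_*(v_1),\dots,f_*(v_V))^\top$ for all $f_*\in\ker S^*$; thus $M(0)=-\Lambda_q$. The phrase ''$q=0$ identically'' is understood in the almost-everywhere sense. *)

(* Defs.v *)
From HB Require Import structures.
From mathcomp Require Import all_boot all_order all_algebra.
From mathcomp Require Import generic_quotient ring_quotient.
From mathcomp Require Import all_classical all_reals all_analysis.
From mathcomp Require Import measurable_realfun.
From mathcomp.real_closed Require Import complex.
From mathcomp Require Import lra.

Set Implicit Arguments.
Unset Strict Implicit.
Unset Printing Implicit Defensive.

Import Order.TTheory GRing.Theory Num.Theory.
Import numFieldNormedType.Exports.

Local Open Scope classical_set_scope.
Local Open Scope ring_scope.
Local Open Scope complex_scope.
Local Open Scope quotient_scope.

(* The vertices v_1, ..., v_V are the elements of 'I_nvert.  Edge [e] is the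
   interval [0, len e]; its endpoint 0 (resp. len e) lies at the vertex
   [vtx e false] (resp. [vtx e true]).  A loop is an edge [e] with
   [vtx e false = vtx e true]. *)
Record metric_graph (R : realType) := MetricGraph {
  nvert : nat;
  edge : finType;
  edge_gt0 : (0 < #|edge|)%N;
  len : edge -> R;
  len_gt0 : forall e, 0 < len e;
  vtx : edge -> bool -> 'I_nvert
}.
Arguments len {R m}.
Arguments len_gt0 {R m}.
Arguments vtx {R m}.

Definition adjacent (R : realType) (G : metric_graph R) : rel 'I_(nvert G) :=
  [rel u v | [exists e : edge G, [exists b : bool,
    (vtx e b == u) && (vtx e (~~ b) == v)]]].

Definition graph_connected (R : realType) (G : metric_graph R) : Prop :=
  forall u v : 'I_(nvert G), connect (@adjacent R G) u v.

Section SquareIntegrable.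
Context {R : realType}.
Implicit Types (l : R) (f g : R -> R[i]) (z w : R[i]).
Local Notation mu := (@lebesgue_measure R).

Definition normsq z : R := complex.Re z ^+ 2 + complex.Im z ^+ 2.

(* Functions on ]0, l[ are represented by functions on R whose values outside
   ]0, l[ are irrelevant. *)
Definition square_integrable l f : Prop :=
  [/\ measurable_fun `]0, l[ (fun x => complex.Re (f x)),
      measurable_fun `]0, l[ (fun x => complex.Im (f x)) &
      mu.-integrable `]0, l[ (fun x => (normsq (f x))%:E)].

Lemma normsq_ge0 z : 0 <= normsq z.
Proof. by rewrite addr_ge0 ?sqr_ge0. Qed.

Lemma normsqD z w : normsq (z + w) <= 2 * normsq z + 2 * normsq w.
Proof.
case: z w => [a b] [c d]; rewrite /normsq /=.
by have := sqr_ge0 (a - c); have := sqr_ge0 (b - d); lra.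
Qed.

Lemma normsqM z w : normsq (z * w) = normsq z * normsq w.
Proof. by case: z w => [a b] [c d]; rewrite /normsq /=; lra. Qed.

Lemma measurable_normsq l f :
  measurable_fun `]0, l[ (fun x => complex.Re (f x)) ->
  measurable_fun `]0, l[ (fun x => complex.Im (f x)) ->
  measurable_fun `]0, l[ (fun x => normsq (f x)).
Proof. by move=> mRe mIm; apply: measurable_funD; exact: measurable_funX. Qed.

Lemma square_integrable0 l : square_integrable l 0.
Proof.
split; [exact: measurable_cst|exact: measurable_cst|].
rewrite (_ : (fun _ => _) = cst 0%E); first exact: integrable0.
by apply/funext => x; rewrite /normsq /= expr0n /= addr0.
Qed.

Lemma square_integrableD l f g :
  square_integrable l f -> square_integrable l g -> square_integrable l (f + g).
Proof.
move=> [f1 f2 fi] [g1 g2 gi].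
have ReD x : complex.Re ((f + g) x) = complex.Re (f x) + complex.Re (g x).
  by rewrite [(f + g) x]/(f x + g x); case: (f x) (g x) => [? ?] [? ?].
have ImD x : complex.Im ((f + g) x) = complex.Im (f x) + complex.Im (g x).
  by rewrite [(f + g) x]/(f x + g x); case: (f x) (g x) => [? ?] [? ?].
have h1 : measurable_fun `]0, l[ (fun x => complex.Re ((f + g) x)).
  by under [X in measurable_fun _ X]eq_fun do rewrite ReD; exact: measurable_funD.
have h2 : measurable_fun `]0, l[ (fun x => complex.Im ((f + g) x)).
  by under [X in measurable_fun _ X]eq_fun do rewrite ImD; exact: measurable_funD.
split => //.
apply: (@le_integrable _ _ _ mu _ _ _ (fun x =>
   (2%:E * (normsq (f x))%:E + 2%:E * (normsq (g x))%:E)%E)) => //.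
- by apply/measurable_EFinP; exact: measurable_normsq.
- move=> x _; rewrite -!EFinM -EFinD !abse_EFin lee_fin !ger0_norm ?normsq_ge0//.
    exact: normsqD.
  by rewrite addr_ge0 // mulr_ge0 ?normsq_ge0.
- by apply: integrableD => //; exact: integrableZl.
Qed.

Lemma square_integrableZ l (c : R[i]) f :
  square_integrable l f -> square_integrable l (c *: f).
Proof.
move=> [f1 f2 fi].
have ReM x : complex.Re ((c *: f) x) =
    complex.Re c * complex.Re (f x) - complex.Im c * complex.Im (f x).
  by rewrite [(c *: f) x]/(c * f x); case: (c) (f x) => [? ?] [? ?].
have ImM x : complex.Im ((c *: f) x) =
    complex.Re c * complex.Im (f x) + complex.Im c * complex.Re (f x).
  by rewrite [(c *: f) x]/(c * f x); case: (c) (f x) => [? ?] [? ?].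
split.
- under [X in measurable_fun _ X]eq_fun do rewrite ReM.
  by apply: measurable_funB; apply: measurable_funM => //; exact: measurable_cst.
- under [X in measurable_fun _ X]eq_fun do rewrite ImM.
  by apply: measurable_funD; apply: measurable_funM => //; exact: measurable_cst.
- under [X in integrable _ _ X]eq_fun do rewrite [(_ *: _) _]/(c * f _) normsqM EFinM.
  exact: integrableZl.
Qed.

End SquareIntegrable.

Section L2.
Context {R : realType} (G : metric_graph R).
Local Notation mu := (@lebesgue_measure R).

(* Only functions that are Borel on the edges are used as representatives; this
   loses no class modulo a.e. equality. *)
Definition L2pred : {pred edge G -> R -> R[i]} :=
  [pred f | `[< forall e, square_integrable (len e) (f e) >]].

Lemma L2pred_submod_closed : submod_closed L2pred.
Proof.
split; first by apply/asboolP => e; exact: square_integrable0.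
move=> c f g /asboolP fP /asboolP gP; apply/asboolP => e.
apply: square_integrableD => //; exact: (@square_integrableZ _ _ c (f e)).
Qed.

HB.instance Definition _ :=
  GRing.isSubmodClosed.Build R[i] (edge G -> R -> R[i]) L2pred
    L2pred_submod_closed.

Record L2fun := MkL2fun { L2val : edge G -> R -> R[i]; _ : L2val \in L2pred }.

HB.instance Definition _ := [isSub for L2val].
HB.instance Definition _ := [Choice of L2fun by <:].
HB.instance Definition _ := [SubChoice_isSubLmodule of L2fun by <:].

Definition null_fun : {pred L2fun} :=
  [pred f | `[< forall e, ae_eq mu `]0, len e[%classic (L2val f e) (cst 0) >]].

Lemma null_fun_submod_closed : submod_closed null_fun.
Proof.
split; first by apply/asboolP => e; exact: aeW.
move=> c f g /asboolP fP /asboolP gP; apply/asboolP => e.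
move: (fP e) (gP e); apply: filterS2 => x fx0 gx0 xe.
have -> : L2val (c *: f + g) e x = c * L2val f e x + L2val g e x by [].
by rewrite fx0 // gx0 // mulr0 addr0.
Qed.

HB.instance Definition _ :=
  GRing.isSubmodClosed.Build R[i] L2fun null_fun null_fun_submod_closed.

Definition L2 : Type := Quotient.quot null_fun.
HB.instance Definition _ := GRing.Zmodule.on L2.
HB.instance Definition _ := EqQuotient.on L2.

Definition L2scale (c : R[i]) (f : L2) : L2 := \pi_L2 (c *: repr f).

Lemma L2scale_pi (c : R[i]) (f : L2fun) :
  L2scale c (\pi_L2 f) = (\pi_L2 (c *: f)).
Proof.
apply/eqP; rewrite -Quotient.idealrBE -scalerBr rpredZ //.
by rewrite Quotient.idealrBE reprK.
Qed.

Lemma L2scalerA (a b : R[i]) (f : L2) :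
  L2scale a (L2scale b f) = L2scale (a * b) f.
Proof. by elim/quotW: f => f; rewrite (L2scale_pi b) !L2scale_pi scalerA. Qed.

Lemma L2scale1r : left_id 1 L2scale.
Proof. by elim/quotW => f; rewrite L2scale_pi scale1r. Qed.

Lemma pi_L2D : {morph (\pi_L2 : L2fun -> L2) : f g / f + g}.
Proof. exact: raddfD. Qed.

Lemma L2scalerDr : right_distributive L2scale +%R.
Proof.
move=> a; elim/quotW => f; elim/quotW => g.
by rewrite -pi_L2D !L2scale_pi -pi_L2D scalerDr.
Qed.

Lemma L2scalerDl (f : L2) : {morph L2scale^~ f : a b / a + b}.
Proof. by elim/quotW: f => f a b; rewrite !L2scale_pi scalerDl pi_L2D. Qed.

HB.instance Definition _ := GRing.Zmodule_isLmodule.Build R[i] L2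
  L2scalerA L2scale1r L2scalerDr L2scalerDl.
End L2.

Definition has_dim (K : fieldType) (H : lmodType K) (W : set H) (n : nat) :
    Prop :=
  exists b : 'I_n -> H,
    (forall c : 'I_n -> K, \sum_i c i *: b i = 0 -> forall i, c i = 0) /\
    W = [set \sum_i c i *: b i | c in [set: 'I_n -> K]].

Section Operators.
Context {R : realType} {G : metric_graph R}.
Local Notation mu := (@lebesgue_measure R).
Local Notation C := R[i].
Local Notation V := (nvert G).

Definition L2rep (f : L2 G) : edge G -> R -> C := L2val (repr f).

Definition Cintegral (l : R) (u : R -> C) : C :=
  (\int[mu]_(x in `]0%R, l[) complex.Re (u x)) +i*
  (\int[mu]_(x in `]0%R, l[) complex.Im (u x)).

Definition L2inner (f g : L2 G) : C :=
  \sum_(e : edge G) Cintegral (len e) (fun x => L2rep f e x * conjc (L2rep g e x)).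

Definition L2norm (f : L2 G) : R := Num.sqrt (complex.Re (L2inner f f)).

Definition cinner (phi psi : 'cV[C]_V) : C :=
  \sum_i phi i 0 * conjc (psi i 0).

(* Here and below [xget 0 P] stands for the unique element of P; its value is
   meaningless when P is not a singleton. *)
Definition adjoint (T : 'cV[C]_V -> L2 G) (h : L2 G) : 'cV[C]_V :=
  xget 0 [set psi | forall phi, L2inner (T phi) h = cinner phi psi].

(* An unbounded operator; [act] is only meaningful on [dom]. *)
Record operator := Operator { dom : set (L2 G); act : L2 G -> L2 G }.

Definition resolvent_set (A : operator) : set C :=
  [set lam | (forall h, exists! f, dom A f /\ act A f - lam *: f = h) /\
    exists B : R, forall f, dom A f ->
      L2norm f <= B * L2norm (act A f - lam *: f)].

Definition resolvent (A : operator) (lam : C) (h : L2 G) : L2 G :=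
  xget 0 [set f | dom A f /\ act A f - lam *: f = h].

Definition eigenker (A : operator) (lam : C) : set (L2 G) :=
  [set f | dom A f /\ act A f - lam *: f = 0].

(* C_c^1(]0, l[); testing against C_c^oo gives the same weak derivatives. *)
Definition test_fun (l : R) (phi : R -> R) : Prop :=
  [/\ forall x, derivable phi x 1,
      continuous (derive1 phi) &
      exists a b, [/\ 0 < a, b < l & forall x, ~~ (a <= x <= b) -> phi x = 0]].

Definition is_weak_derivative (f g : L2 G) : Prop :=
  forall e phi, test_fun (len e) phi ->
    Cintegral (len e) (fun x => L2rep f e x * (derive1 phi x)%:C) =
    - Cintegral (len e) (fun x => L2rep g e x * (phi x)%:C).

Definition weak_derivative (f : L2 G) : L2 G :=
  xget 0 [set g | is_weak_derivative f g].

(* Edgewise Sobolev space of order k, without vertex conditions. *)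
Fixpoint sobolev (k : nat) : set (L2 G) :=
  if k is j.+1 then [set f | exists2 g, is_weak_derivative f g & sobolev j g]
  else setT.

Definition endpoint (e : edge G) (b : bool) : R := if b then len e else 0.

(* Value of f_e at an endpoint: the value there of the representative of f_e
   that is continuous on [0, len e]. *)
Definition trace (f : L2 G) (e : edge G) (b : bool) : C :=
  xget 0 [set z | exists u : R -> C,
    [/\ {within `[0, len e], continuous (fun x => complex.Re (u x))},
        {within `[0, len e], continuous (fun x => complex.Im (u x))},
        ae_eq mu `]0, len e[%classic (L2rep f e) u &
        z = u (endpoint e b)]].

Definition H1 : set (L2 G) := [set f | sobolev 1 f /\
  forall e b e' b', vtx e b = vtx e' b' -> trace f e b = trace f e' b'].

Definition vertex_value (f : L2 G) (v : 'I_V) : C :=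
  xget 0 [set z | exists e b, vtx e b = v /\ z = trace f e b].

(* Derivatives are taken towards the vertex; a loop contributes both ends. *)
Definition normal_derivative (f : L2 G) (v : 'I_V) : C :=
  \sum_(p : edge G * bool | vtx p.1 p.2 == v)
    (if p.2 then trace (weak_derivative f) p.1 p.2
     else - trace (weak_derivative f) p.1 p.2).

Implicit Types (q : edge G -> R -> R) (lam : C).

Definition potential_mul q (f : L2 G) : L2 G :=
  xget 0 [set g | forall e,
    ae_eq mu `]0, len e[%classic (L2rep g e) (fun x => (q e x)%:C * L2rep f e x)].

Definition schroedinger q (f : L2 G) : L2 G :=
  - weak_derivative (weak_derivative f) + potential_mul q f.

Definition op_S q : operator := Operator
  [set f | [/\ sobolev 2 f, H1 f &
               forall v, vertex_value f v = 0 /\ normal_derivative f v = 0]]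
  (schroedinger q).

(* The adjoint of S is given by its explicit domain. *)
Definition op_Sstar q : operator := Operator
  [set f | sobolev 2 f /\ H1 f] (schroedinger q).

Definition dirichlet_laplacian q : operator := Operator
  [set f | [/\ sobolev 2 f, H1 f & forall v, vertex_value f v = 0]]
  (schroedinger q).

Definition standard_laplacian q : operator := Operator
  [set f | [/\ sobolev 2 f, H1 f & forall v, normal_derivative f v = 0]]
  (schroedinger q).

(* The Krein-von Neumann extension of S, i.e. the restriction of S^* to
   dom S + ker S^*. *)
Definition krein_laplacian q : operator := Operator
  [set f + g | f in dom (op_S q) & g in eigenker (op_Sstar q) 0]
  (schroedinger q).

Definition Gamma0 (f : L2 G) : 'cV[C]_V := \col_v vertex_value f v.
Definition Gamma1 (f : L2 G) : 'cV[C]_V := \col_v (- normal_derivative f v).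

Definition gamma_field q lam (phi : 'cV[C]_V) : L2 G :=
  xget 0 [set f | eigenker (op_Sstar q) lam f /\ Gamma0 f = phi].

Definition weyl q lam : 'M[C]_V :=
  xget 0 [set M | forall phi, M *m phi = Gamma1 (gamma_field q lam phi)].

Definition dirichlet_to_neumann q : 'M[C]_V :=
  xget 0 [set L | forall f, eigenker (op_Sstar q) 0 f ->
    (\col_v normal_derivative f v) = L *m (\col_v vertex_value f v)].

(* The measurable sets of the type R are the Borel sets; the completion gives
   the Lebesgue measurable sets. *)
Definition lebesgue_measurable_fun (D : set R) (u : R -> R) : Prop :=
  @measurable_fun _ _ (g_sigma_algebraType (completed_algebra_gen mu)) R D u.

Definition potential_measurable q : Prop :=
  forall e, lebesgue_measurable_fun `]0, len e[ (q e).

Definition potential_bounded q : Prop :=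
  exists B : R, forall e x, x \in `]0, len e[ -> `|q e x| <= B.

Definition potential_ge0 q : Prop :=
  forall e, {ae mu, forall x : R, 0 < x < len e -> 0 <= q e x}.

Definition potential_eq0 q : Prop :=
  forall e, {ae mu, forall x : R, 0 < x < len e -> q e x = 0}.

End Operators.

(* Main.v *)
Require Import Defs.
From mathcomp Require Import all_boot all_order all_algebra.
From mathcomp Require Import generic_quotient ring_quotient.
From mathcomp Require Import all_classical all_reals all_analysis.
From mathcomp Require Import measurable_realfun.
From mathcomp.real_closed Require Import complex.
From mathcomp Require Import ring lra zify.

(** Let T be the maximal operator S^*, with domain the edgewise H^2 functions
that are continuous at the vertices, and let Gamma0, Gamma1 be the two trace maps.
Everything rests on Green's identity [green]:

  <T f, g> - <f, T g> = <Gamma1 f, Gamma0 g> - <Gamma0 f, Gamma1 g>.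

Applied to a Dirichlet function (D - lam)^-1 h and to gamma (conj lam) phi, it gives
gamma (conj lam)^* h = Gamma1 ((D - lam)^-1 h) ([adjoint_Gamma1]).  The difference of two
resolvents of extensions of S lies in ker (T - lam), so it is gamma lam applied to the
difference of the vertex values ([resolvent_diff_gam]).  A function belongs to the
domain of the Krein extension exactly when Gamma1 f = - Lambda (Gamma0 f)
([dom_kreinP]), and to that of the standard extension exactly when Gamma1 f = 0.
Applying Gamma1 to the difference of resolvents therefore yields a linear system for
the vertex values, whose solution is the claimed formula ([krein_trace],
[standard_trace]).  The matrices Lambda + M(lam) and M(lam) are invertible because
a vector in their kernel would produce an eigenfunction of an extension at a point
of its resolvent set.  Finally gamma (conj lam) is injective, so its adjoint is onto
C^V ([adj_surj]), and the range of the difference has the rank of the matrix as its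
dimension.

The rank of Lambda comes from the first Green identity [green_first].  If u is in
the kernel of Lambda, the solution f of T f = 0 with vertex values u has zero
normal derivatives, so its energy, the integral of |f'|^2 + q |f|^2, vanishes; f is
then constant on the connected graph, and zero unless q vanishes almost everywhere
([kernel_neumann]).

Three facts feed this argument.  First, on an edge g is the weak derivative of f
exactly when f is almost everywhere a constant plus the primitive of g
([weak_derivative_primitive], [primitive_weak_derivative]); this makes traces
meaningful and reduces Green's identity to an integration by parts for primitives
([prim_by_parts]), which is Fubini's theorem.  Secondly, T f = 0 must be
solvable with arbitrary vertex values, although 0 is not assumed to be in the
resolvent set of the Dirichlet operator: the equation -u'' + q u = 0 is solved on
each edge by a Picard iteration, which is monotone because q >= 0
([picard_solution], [kernel_solution]).  Solvability at a point lam of the Dirichlet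
resolvent set follows by adding a correction from the Dirichlet resolvent, and at
conj lam by complex conjugation, as q is real.  Thirdly, q is only Lebesgue
measurable while L2 functions are represented by Borel functions, so q is first
replaced by a Borel function with values in [0, B] ([borel_potential]). *)

Set Implicit Arguments.
Unset Strict Implicit.
Unset Printing Implicit Defensive.

Import Order.TTheory GRing.Theory Num.Theory.
Import numFieldNormedType.Exports.

Local Open Scope classical_set_scope.
Local Open Scope ring_scope.

(** * Primitives of integrable functions *)

Section RealPrimitives.
Context {R : realType}.
Local Notation mu := (@lebesgue_measure R).
Implicit Types (l x : R) (u w : R -> R).

Definition itg l u := mu.-integrable `]0, l[ (EFin \o u).

Definition prim u x : R := \int[mu]_(t in `]0, x[) u t.

Lemma itgS l x u : x <= l -> itg l u -> itg x u.
Proof.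
move=> xl; apply: integrableS => //; exact: subset_itvl.
Qed.

Lemma itg_cc l u : itg l u -> mu.-integrable `[0, l] (EFin \o u).
Proof.
move=> iu.
have [l0|l0] := ltP l 0; first by rewrite set_itv_ge;
  [exact: integrable_set0|rewrite bnd_simp -ltNge].
have /integrableP[mu_ fu] := iu.
have mcc : measurable_fun `[0, l] (EFin \o u).
  move/measurable_EFinP : mu_ => mu_; apply/measurable_EFinP; exact: measurable_fun_itv_cc mu_.
apply/integrableP; split => //.
rewrite integral_itv_bndoo //.
by apply: measurableT_comp.
Qed.

Lemma prim_cc l u x : itg l u -> x <= l -> prim u x = \int[mu]_(t in `[0, x]) u t.
Proof.
move=> iu xl; rewrite /prim /Rintegral [in RHS]integral_itv_bndoo //.
exact: (measurable_int _ (itgS xl iu)).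
Qed.

Lemma prim0 u x : x <= 0 -> prim u x = 0.
Proof. by move=> x0; rewrite /prim set_itv_ge ?Rintegral_set0 // bnd_simp -leNgt. Qed.

Lemma prim_continuous l u : 0 <= l -> itg l u ->
  {within `[0, l], continuous (prim u)}.
Proof.
move=> l0 iu; have := parameterized_integral_continuous l0 (itg_cc iu).
apply: subspace_eq_continuous => x; rewrite inE /= in_itv /= => /andP[_ xl].
exact/esym/(prim_cc iu xl).
Qed.

Lemma prim_measurable l u : 0 <= l -> itg l u -> measurable_fun `]0, l[ (prim u).
Proof.
move=> l0 iu; apply: (@measurable_funS _ _ _ _ `[0, l]) => //.
  exact: subset_itv_oo_cc.
by apply: subspace_continuous_measurable_fun => //; exact: prim_continuous.
Qed.

Lemma prim_bound l u x : x <= l -> itg l u -> `|prim u x| <= prim (Num.norm \o u) l.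
Proof.
move=> xl iu; apply: (@le_trans _ _ (\int[mu]_(t in `]0, x[) `|u t|)).
  by apply: le_normr_Rintegral => //; exact: itgS xl iu.
rewrite /prim /Rintegral fine_le //.
- apply: integrable_fin_num => //; exact/integrable_norm/(itgS xl iu).
- apply: integrable_fin_num => //; exact/integrable_norm.
- apply: ge0_subset_integral => //.
  + apply: measurableT_comp => //; apply: measurableT_comp => //.
    by have /integrableP[/measurable_EFinP] := iu.
  + exact: subset_itvl.
Qed.

Lemma itg_mul_bounded l u w (M : R) : itg l u -> measurable_fun `]0, l[ w ->
  (forall x, 0 < x < l -> `|w x| <= M) -> itg l (fun x => u x * w x).
Proof.
move=> iu mw bw; have /integrableP[/measurable_EFinP mu_ _] := iu.
apply: (@le_integrable _ _ _ mu _ _ _ (fun x => (M%:E * (`|u x|%R)%:E)%E)) => //.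
- by apply/measurable_EFinP/measurable_funM.
- move=> x; rewrite /= in_itv /= => x0l; rewrite lee_fin !normrM normr_id mulrC ler_wpM2r //.
  exact: le_trans (bw _ x0l) (ler_norm _).
- by apply: integrableZl => //; exact/integrable_norm.
Qed.

Lemma itg_mul_prim l u w : 0 <= l -> itg l u -> itg l w ->
  itg l (fun x => u x * prim w x).
Proof.
move=> l0 iu iw; apply: (itg_mul_bounded (M := prim (Num.norm \o w) l)) => //.
- exact: prim_measurable.
- by move=> x /andP[_ /ltW xl]; exact: prim_bound.
Qed.

Lemma prim_subr l u x : itg l u -> 0 <= x <= l ->
  \int[mu]_(t in `]x, l[) u t = prim u l - prim u x.
Proof.
move=> iu /andP[x0 xl].
have iul : mu.-integrable (`]x, l[%classic) (EFin \o u).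
  by apply: integrableS iu => //; apply: subset_itvr; rewrite bnd_simp.
rewrite (prim_cc iu) // (prim_cc iu xl) Rintegral_itvB ?bnd_simp ?Rintegral_itv_bndo_bndc //.
exact: itg_cc.
Qed.

Lemma itgD l u w : itg l u -> itg l w -> itg l (fun x => u x + w x).
Proof. by move=> iu iw; exact: (@integrableD _ _ _ mu _ (measurable_itv `]0, l[) _ _ iu iw). Qed.

Lemma itgB l u w : itg l u -> itg l w -> itg l (fun x => u x - w x).
Proof. by move=> iu iw; exact: (@integrableB _ _ _ mu _ (measurable_itv `]0, l[) _ _ iu iw). Qed.

Lemma itgZl l u c : itg l u -> itg l (fun x => c * u x).
Proof. by move=> iu; exact: (@integrableZl _ _ _ mu _ (measurable_itv `]0, l[) c _ iu). Qed.

Lemma itgN l u : itg l u -> itg l (fun x => - u x).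
Proof. by move=> /(itgZl (-1)); under eq_fun do rewrite mulN1r. Qed.

Lemma itgZr l u c : itg l u -> itg l (fun x => u x * c).
Proof. by move=> iu; exact: (@integrableZr _ _ _ mu _ (measurable_itv `]0, l[) c _ iu). Qed.

Lemma intD l u w : itg l u -> itg l w ->
  \int[mu]_(x in `]0, l[) (u x + w x) = \int[mu]_(x in `]0, l[) u x + \int[mu]_(x in `]0, l[) w x.
Proof. by move=> iu iw; rewrite RintegralD. Qed.

Lemma intB l u w : itg l u -> itg l w ->
  \int[mu]_(x in `]0, l[) (u x - w x) = \int[mu]_(x in `]0, l[) u x - \int[mu]_(x in `]0, l[) w x.
Proof. by move=> iu iw; rewrite RintegralB. Qed.

Lemma intZl l u c : itg l u ->
  \int[mu]_(x in `]0, l[) (c * u x) = c * \int[mu]_(x in `]0, l[) u x.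
Proof. by move=> iu; rewrite RintegralZl. Qed.

Lemma intZr l u c : itg l u ->
  \int[mu]_(x in `]0, l[) (u x * c) = (\int[mu]_(x in `]0, l[) u x) * c.
Proof. by move=> iu; rewrite RintegralZr. Qed.

Lemma intN l u : itg l u ->
  \int[mu]_(x in `]0, l[) (- u x) = - \int[mu]_(x in `]0, l[) u x.
Proof. by move=> iu; rewrite -mulN1r -intZl //; apply: eq_Rintegral => x _; rewrite mulN1r. Qed.

Lemma itg_bounded l u (M : R) : measurable_fun `]0, l[ u ->
  (forall x, 0 < x < l -> `|u x| <= M) -> itg l u.
Proof.
move=> mu_ bu; apply: measurable_bounded_integrable => //.
  by rewrite /= lebesgue_measure_itv /=; case: ifP => _; rewrite -?EFinD ltry.
exists M; split => [|x Mx y /=]; first exact: num_real.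
by rewrite in_itv /= => /bu /le_trans; apply; exact: ltW.
Qed.

Lemma itg_cst l c : itg l (cst c).
Proof. by apply: (@itg_bounded _ _ `|c|) => //; exact: measurable_cst. Qed.

Lemma Rintegral_ae l u w : measurable_fun `]0, l[ u -> measurable_fun `]0, l[ w ->
  ae_eq mu `]0, l[%classic u w ->
  \int[mu]_(x in `]0, l[) u x = \int[mu]_(x in `]0, l[) w x.
Proof.
move=> mu_ mw uw; congr fine; apply: ae_eq_integral => //.
- exact/measurable_EFinP.
- exact/measurable_EFinP.
- by apply: filterS uw => x /= uw xl; rewrite uw.
Qed.

(** Fubini's theorem for u x * w t on the triangle 0 < t < x < l: the inner integral
in t is [prim w x], the one in x is [prim u l - prim u t]. *)
Lemma prim_by_parts l u w : 0 <= l -> itg l u -> itg l w ->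
  \int[mu]_(x in `]0, l[) (u x * prim w x) =
  prim u l * prim w l - \int[mu]_(x in `]0, l[) (w x * prim u x).
Proof.
move=> l0 iu iw.
pose uD := u \_ `]0, l[; pose wD := w \_ `]0, l[.
have iuD : mu.-integrable setT (EFin \o uD).
  by have := iu; rewrite /itg integrable_mkcond //= restrict_EFin.
have iwD : mu.-integrable setT (EFin \o wD).
  by have := iw; rewrite /itg integrable_mkcond //= restrict_EFin.
have muD : measurable_fun setT uD by have /integrableP[/measurable_EFinP] := iuD.
have mwD : measurable_fun setT wD by have /integrableP[/measurable_EFinP] := iwD.
(* z.1 is the outer variable x and z.2 the inner variable t. *)
pose f (z : R * R) := if z.2 < z.1 then uD z.1 * wD z.2 else 0.
have mf : measurable_fun setT f.
  apply: measurable_fun_ifT.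
  - by apply: measurable_fun_ltr; [exact: measurable_snd|exact: measurable_fst].
  - by apply: measurable_funM; apply: measurableT_comp.
  - exact: measurable_cst.
have imf : (mu \x mu)%E.-integrable setT (EFin \o f).
  apply/integrable12ltyP; first exact/measurable_EFinP.
  apply: (@le_lt_trans _ _ (\int[mu]_x (`|uD x|%:E * \int[mu]_y `|wD y|%:E)%E)%E).
    apply: ge0_le_integral => //.
    - by move=> x _; apply: integral_ge0.
    - apply: (@measurable_fun_fubini_tonelli_F _ _ _ _ _ mu (fun z => `|(f z)%:E|%E)) => //.
      by apply/measurableT_comp => //; exact/measurable_EFinP.
    - apply: emeasurable_funM; last exact: measurable_cst.
      by apply/measurable_EFinP/measurableT_comp.
    move=> x _; rewrite -ge0_integralZl_EFin //; last first.
      by apply/measurable_EFinP/measurableT_comp.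
    apply: ge0_le_integral => //.
    - apply/measurable_EFinP/measurableT_comp => //.
      exact: (measurableT_comp mf (measurable_pair1 _)).
    - apply: emeasurable_funM; first exact: measurable_cst.
      by apply/measurable_EFinP/measurableT_comp.
    - move=> y _; rewrite -EFinM lee_fin /f /=.
      by case: ifP => _; rewrite ?normr0 ?mulr_ge0// normrM.
  rewrite ge0_integralZr //; last 2 first.
  - by apply/measurable_EFinP/measurableT_comp.
  - exact: integral_ge0.
  have /integrableP[_ h1] := iuD; have /integrableP[_ h2] := iwD.
  rewrite lte_mul_pinfty ?integral_ge0 // ge0_fin_numE ?integral_ge0 //.
have iint (a b : R) (v : R -> R) : mu.-integrable `]a, b[ (EFin \o v) ->
    (\int[mu]_y ((v \_ `]a, b[) y)%:E)%E = (\int[mu]_(y in `]a, b[) v y)%:E.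
  move=> iv; rewrite /Rintegral fineK; last exact: integrable_fin_num.
  by rewrite [RHS]integral_mkcond; apply: eq_integral => y _; rewrite restrict_EFin.
have irestr (a b : R) (v : R -> R) : mu.-integrable `]a, b[ (EFin \o v) ->
    mu.-integrable setT (EFin \o (v \_ `]a, b[)).
  by rewrite integrable_mkcond //= restrict_EFin.
have Fx x : (\int[mu]_y (f (x, y))%:E = (((fun x => u x * prim w x) \_ `]0%R, l[) x)%:E)%E.
  rewrite [in RHS]patchE; case: ifPn => [|xD]; last first.
    rewrite integral0_eq // => y _; rewrite /f /= /uD patchE (negbTE xD) mul0r.
    by case: ifP.
  rewrite inE /= in_itv /= => /andP[x0 xl].
  have iwx : mu.-integrable `]0, x[ (EFin \o w) by apply: itgS iw; exact: ltW.
  rewrite /prim EFinM -(iint _ _ _ iwx) -integralZl //; last exact: irestr.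
  apply: eq_integral => y _; rewrite -EFinM /f /= /uD /wD !patchE mem_set /=; last first.
    by rewrite in_itv /= x0.
  case: ltP => yx; congr EFin.
    congr (_ * _); congr (if _ then _ else _); apply/idP/idP; rewrite !inE /= !in_itv /=.
      by rewrite yx => /andP[->].
    by move=> /andP[-> _]; rewrite (lt_trans yx xl).
  rewrite memNset ?mulr0 //= in_itv /= => /andP[_].
  by rewrite ltNge yx.
have Gy y : (\int[mu]_x (f (x, y))%:E =
    (((fun y => w y * prim u l - w y * prim u y) \_ `]0%R, l[) y)%:E)%E.
  rewrite [in RHS]patchE; case: ifPn => [|yD]; last first.
    rewrite integral0_eq // => x _; rewrite /f /= /wD patchE (negbTE yD) mulr0.
    by case: ifP.
  rewrite inE /= in_itv /= => /andP[y0 yl].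
  have iuy : mu.-integrable `]y, l[ (EFin \o u).
    by apply: integrableS iu => //; apply: subset_itvr; rewrite bnd_simp ltW.
  have yD : y \in `]0%R, l[%classic by rewrite inE /= in_itv /= y0.
  rewrite -mulrBr -(prim_subr iu); last by rewrite !ltW.
  rewrite EFinM -(iint _ _ _ iuy) -integralZl //; last exact: irestr.
  apply: eq_integral => x _; rewrite -EFinM /f /= /uD /wD !patchE yD.
  case: ltP => yx; congr EFin.
    rewrite mulrC; congr (_ * _).
    congr (if _ then _ else _); apply/idP/idP; rewrite !inE /= !in_itv /=.
      by rewrite yx => /andP[_ ->].
    by move=> /andP[_ ->]; rewrite (lt_trans y0 yx).
  rewrite memNset ?mulr0 //= in_itv /= => /andP[+ _].
  by rewrite ltNge yx.
have i1 := itg_mul_prim l0 iu iw; have i2 := itg_mul_prim l0 iw iu.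
have i3 : itg l (fun y => w y * prim u l) by exact: itgZr.
have := Fubini imf; under eq_integral do rewrite /= Fx.
under [RHS]eq_integral do rewrite /= Gy.
rewrite iint // iint; last exact: itgB.
move=> h; have /= -> := congr1 fine h.
by rewrite RintegralB // RintegralZr // mulrC.
Qed.

(** By Lebesgue's differentiation theorem [prim w] has derivative [w] at almost
every point. *)
Lemma prim_affine_ae l w c k : itg l w ->
  (forall x, 0 < x < l -> prim w x = c + k * x) -> ae_eq mu `]0, l[%classic w (cst k).
Proof.
move=> iw pw.
have iwD : mu.-integrable setT (EFin \o (w \_ `]0, l[)).
  by move: iw; rewrite /itg integrable_mkcond //= restrict_EFin.
have ifi y : mu.-integrable `]0, y] (EFin \o (w \_ `]0, l[)) by exact: integrableS iwD.
have lw : locally_integrable setT (w \_ `]0, l[) by exact: integrable_locally.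
have := @FTC1 _ _ (BRight 0) ifi lw.
apply: filterS; first exact: (ae_filter_ringOfSetsType mu).
move=> x /= + xl; have /andP[x0 xl'] : 0 < x < l by move: xl; rewrite in_itv.
rewrite lte_fin => /(_ x0)[_].
rewrite patchE mem_set // => <-; rewrite derive1E.
rewrite (@near_eq_derive _ _ _ _ (fun x => c + k * x)); last first.
  near=> y; have /andP[y0 yl] : 0 < y < l.
    have : y \in `]0, l[ by near: y; exact: near_in_itvoo.
    by rewrite in_itv.
  rewrite -pw ?y0 // /prim -Rintegral_itv_bndo_bndc; last exact: integrableS iwD.
  apply: eq_Rintegral => t; rewrite inE /= in_itv /= => /andP[t0 ty].
  by rewrite patchE mem_set //= in_itv /= t0 (lt_trans ty).
by rewrite derive_val add0r mul1r /GRing.scale /= mulr1.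
Unshelve. all: by end_near. Qed.

(** Since chi has mean zero, its primitive vanishes again to the right of the
support of chi. *)
Lemma test_fun_primitive l a b (chi : R -> R) : 0 < a -> b < l -> continuous chi ->
  (forall x, ~~ (a <= x <= b) -> chi x = 0) -> \int[mu]_(x in `]0, l[) chi x = 0 ->
  exists phi, test_fun l phi /\ derive1 phi = chi.
Proof.
move=> a0 bl cchi chi0 ichi.
have ic : mu.-integrable setT (EFin \o chi).
  have : mu.-integrable `[a, b] (EFin \o chi).
    apply: continuous_compact_integrable; first exact: segment_compact.
    exact: continuous_subspaceT.
  rewrite integrable_mkcond //= restrict_EFin; congr (mu.-integrable _ (EFin \o _)).
  apply/funext => x; rewrite patchE; case: ifPn => //.
  by rewrite notin_setE /= in_itv /= => /negP/chi0 ->.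
pose phi x := \int[mu]_(t in `]-oo, x]) chi t.
have dphi x : derivable phi x 1 /\ derive1 phi x = chi x.
  apply: (@continuous_FTC1 _ chi -oo%O x (x + 1)) => //.
  - by rewrite ltrDl.
  - exact: integrableS ic.
  - exact: ltNyr.
  - exact: cchi.
have dE : derive1 phi = chi by apply/funext => x; have [] := dphi x.
exists phi; split => //; split.
- by move=> x; have [] := dphi x.
- by rewrite dE.
exists a, b; split => // x; rewrite negb_and -!ltNge => /orP[xa|bx].
- rewrite /phi (_ : 0 = \int[mu]_(t in `]-oo, x]) 0); last by rewrite Rintegral_cst // mul0r.
  apply: eq_Rintegral => t.
  rewrite inE /= in_itv /= => tx; rewrite chi0 // negb_and -ltNge.
  by rewrite (le_lt_trans tx xa).
- rewrite -ichi /phi Rintegral_mkcond [RHS]Rintegral_mkcond.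
  apply: eq_Rintegral => t _; rewrite !patchE.
  have [tab|tab] := boolP (a <= t <= b); last by rewrite chi0 // !if_same.
  have /andP[at_ tb] := tab.
  rewrite !mem_set //= in_itv /=; first by rewrite (lt_le_trans a0 at_) (le_lt_trans tb bl).
  by rewrite (le_trans tb) // ltW.
Qed.

Lemma prim_derive1 (F f : R -> R) x : 0 <= x -> (forall y : R, is_derive y 1 F (f y)) ->
  continuous f -> prim f x = F x - F 0.
Proof.
rewrite le_eqVlt => /predU1P[<- _ _|x0 dF cf]; first by rewrite prim0 // subrr.
have cF : continuous F.
  by move=> y; apply/differentiable_continuous/derivable1_diffP; case: (dF y).
have dLR : derivable_oo_LRcontinuous F 0 x.
  by split => [y _||]; [case: (dF y)|exact/cvg_at_right_filter/cF|exact/cvg_at_left_filter/cF].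
have F'f : {in `]0, x[, derive1 F =1 f}.
  by move=> y _; rewrite derive1E; case: (dF y).
have FTC := continuous_FTC2 x0 (continuous_subspaceT cf) dLR F'f.
rewrite /prim /Rintegral -(integral_itv_bndoo true false); first by rewrite FTC.
apply/measurable_EFinP; apply: (@measurable_funS _ _ _ _ setT) => //.
exact: continuous_measurable_fun.
Qed.

Lemma test_fun_prim l phi x : test_fun l phi -> 0 <= x -> prim (derive1 phi) x = phi x.
Proof.
move=> [dphi cphi [a [b [a0 bl phi0]]]] x0.
have d (y : R) : is_derive y (1 : R) phi (derive1 phi y) by rewrite derive1E; exact: derivableP.
by rewrite (prim_derive1 x0 d cphi) (phi0 0) ?subr0 // negb_and -ltNge a0.
Qed.

Lemma continuous_itg l u : continuous u -> itg l u.
Proof.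
move=> cu; have : mu.-integrable `[0, l] (EFin \o u).
  apply: continuous_compact_integrable; first exact: segment_compact.
  exact: continuous_subspaceT.
by apply: integrableS => //; exact: subset_itv_oo_cc.
Qed.

Lemma test_fun_itg l phi : test_fun l phi -> itg l phi /\ itg l (derive1 phi).
Proof.
move=> [dphi cphi _]; split; apply: continuous_itg => //.
by move=> y; apply/differentiable_continuous/derivable1_diffP.
Qed.

Lemma test_fun_end l phi : test_fun l phi -> phi l = 0.
Proof. by move=> [_ _ [a [b [a0 bl ->]]]] //; rewrite negb_and -!ltNge bl orbT. Qed.

(** The boundary term of [prim_by_parts] vanishes because phi l = 0, and phi is the
primitive of its derivative. *)
Lemma prim_weak_derivative l u phi : 0 < l -> itg l u -> test_fun l phi ->
  \int[mu]_(x in `]0, l[) (prim u x * derive1 phi x) =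
  - \int[mu]_(x in `]0, l[) (u x * phi x).
Proof.
move=> l0 iu tphi; have [ip idp] := test_fun_itg tphi.
under eq_Rintegral do rewrite mulrC.
rewrite prim_by_parts // ?ltW // (test_fun_prim tphi) ?ltW //.
rewrite (test_fun_end tphi) mul0r sub0r; congr (- _).
apply: eq_Rintegral => x; rewrite inE /= in_itv /= => /andP[x0 xl].
by rewrite (test_fun_prim tphi) // ltW.
Qed.

(** * Weak derivatives on an interval *)

(** Continuous functions supported in [a, b], with values in [0, 1], which converge to
the indicator of the open interval as n grows. *)
Definition bump a b (n : nat) x : R := Num.max 0 (Num.min 1 (n%:R * ((x - a) * (b - x)))).

Lemma bump_continuous a b n : continuous (bump a b n).
Proof.
move=> x.
have cp : {for x, continuous (fun y : R => n%:R * ((y - a) * (b - y)) : R^o)}.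
  apply: cvgM; first exact: cvg_cst.
  by apply: cvgM; apply: cvgB => //; exact: cvg_cst.
have c0 c : {for x, continuous (cst c : R -> R^o)} by exact: cvg_cst.
exact: (continuous_max (c0 0) (continuous_min (c0 1) cp)).
Qed.

Lemma bump_out a b n x : a < b -> ~~ (a <= x <= b) -> bump a b n x = 0.
Proof.
move=> ab; rewrite negb_and -!ltNge => xab; apply/max_idPl.
rewrite ge_min; apply/orP; right; apply: mulr_ge0_le0 => //.
case/orP: xab => h.
  by rewrite mulr_le0_ge0 // ?subr_ge0 ?subr_le0 ltW // (lt_trans h).
by rewrite mulr_ge0_le0 // ?subr_ge0 ?subr_le0 ltW // (lt_trans _ h).
Qed.

Lemma bump_bound a b n x : `|bump a b n x| <= 1.
Proof.
rewrite ger0_norm; first by rewrite ge_max ler01 ge_min lexx.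
by rewrite le_max lexx.
Qed.

Lemma bump_cvg a b x : a < b -> bump a b n x @[n --> \oo] --> (\1_(`]a, b[%classic) x : R).
Proof.
move=> ab; rewrite indicE; have [|] := boolP (x \in `]a, b[%classic).
  rewrite inE /= in_itv /= => /andP[ax xb].
  have h : 0 < (x - a) * (b - x) by rewrite mulr_gt0 // subr_gt0.
  apply: (@cvg_near_cst _ _ _ _ _ eventually_filter).
  near=> n; rewrite /bump; have n1 : 1 <= n%:R * ((x - a) * (b - x)).
    rewrite -ler_pdivrMr // mul1r.
    near: n; exact: nbhs_infty_ger.
  by rewrite (min_idPl n1) (max_idPr _).
rewrite notin_setE /= in_itv /= => xab.
rewrite (_ : (fun n => _) = cst 0); first exact: cvg_cst.
apply/funext => n; have [/andP[ax xb]|] := boolP (a <= x <= b); last exact: bump_out.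
rewrite /bump; suff -> : (x - a) * (b - x) = 0.
  by rewrite mulr0 (min_idPr ler01) maxxx.
move: xab => /negP; rewrite negb_and -!leNgt => /orP[xa|bx].
  by rewrite (@le_anti _ _ x a) ?subrr ?mul0r // xa.
by rewrite (@le_anti _ _ x b) ?subrr ?mulr0 // xb.
Unshelve. all: by end_near. Qed.

Lemma measurable_int_itg l u : itg l u -> measurable_fun `]0, l[ u.
Proof. by move=> /integrableP[/measurable_EFinP]. Qed.

Lemma itg_norm l u : itg l u -> itg l (fun x => `|u x|).
Proof. by move=> iu; exact: integrable_norm. Qed.

(** Dominated convergence, in the form of convergence of primitives at a point. *)
Lemma dominated_prim_cvg l (u_ : nat -> R -> R) u w :
  (forall n, itg l (u_ n)) -> measurable_fun `]0, l[ u ->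
  (forall x, 0 < x < l -> u_ n x @[n --> \oo] --> u x) -> itg l w ->
  (forall n x, 0 < x < l -> `|u_ n x| <= w x) ->
  prim (u_ n) l @[n --> \oo] --> prim u l.
Proof.
move=> iu_ mu_ uu iw uw.
have [||iu _ H] := @dominated_convergence _ _ _ mu `]0, l[%classic (measurable_itv _)
  (fun n x => (u_ n x)%:E) (fun x => (u x)%:E) (EFin \o w)
  (fun n => measurable_int _ (iu_ n)) ((measurable_EFinP _ _).2 mu_) _ iw.
- by apply: aeW => x /=; rewrite in_itv /= => x0l; apply: cvg_EFin; [exact: nearW|exact: uu].
- by apply: aeW => x n /=; rewrite in_itv /= => x0l; rewrite lee_fin; exact: uw.
apply: (fine_cvg (f := fun n => (\int[mu]_(x in `]0%R, l[) (u_ n x)%:E)%E)).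
by rewrite fineK //; exact: integrable_fin_num.
Qed.

Lemma bump_integral_cvg l a b u : 0 < a -> a < b -> b < l -> itg l u ->
  \int[mu]_(x in `]0, l[) (u x * bump a b n x) @[n --> \oo] -->
  prim u b - prim u a.
Proof.
move=> a0 ab bl iu; have /integrableP[/measurable_EFinP mu_ _] := iu.
have mb n : measurable_fun `]0, l[ (bump a b n).
  apply: (@measurable_funS _ _ _ _ setT) => //.
  by apply: continuous_measurable_fun; exact: bump_continuous.
have iub n : itg l (fun x => u x * bump a b n x).
  by apply: (@itg_mul_bounded _ _ _ 1) => // x _; exact: bump_bound.
have m1 : measurable_fun `]0, l[ (\1_(`]a, b[%classic) : R -> R) by [].
have i1 : itg l (fun x => u x * \1_(`]a, b[%classic) x).
  apply: (@itg_mul_bounded _ _ _ 1) => // x _.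
  by rewrite indicE; case: (x \in _); rewrite ?normr1 ?normr0.
have -> : prim u b - prim u a = \int[mu]_(x in `]0, l[) (u x * \1_(`]a, b[%classic) x).
  rewrite -(@prim_subr b) ?(ltW a0) ?(ltW ab) //; last exact: itgS (ltW bl) iu.
  rewrite Rintegral_mkcond [RHS]Rintegral_mkcond; apply: eq_Rintegral => x _.
  rewrite !patchE indicE; have [xab|xab] := boolP (x \in `]a, b[%classic); last first.
    by rewrite mulr0 if_same.
  rewrite mulr1 mem_set //; move: xab; rewrite inE /= !in_itv /= => /andP[ax xb].
  by rewrite (lt_trans a0 ax) (lt_trans xb bl).
apply: (dominated_prim_cvg iub (measurable_int_itg i1) _ (itg_norm iu)) => [x _|n x _].
  by apply: cvgM; [exact: cvg_cst|exact: bump_cvg].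
by rewrite normrM -[leRHS]mulr1 ler_wpM2l //; exact: bump_bound.
Qed.

(** For two intervals, the combination of their bumps with total integral zero is the
derivative of a test function.  When the bumps tend to the indicators, this shows
that [prim u] has the same slope on both intervals.  Hence [prim u] is affine. *)
Lemma du_bois_reymond l u : 0 < l -> itg l u ->
  (forall phi, test_fun l phi -> \int[mu]_(x in `]0, l[) (u x * derive1 phi x) = 0) ->
  exists k, ae_eq mu `]0, l[%classic u (cst k).
Proof.
move=> l0 iu u0.
have key a b c d : 0 < a -> a < b -> b < l -> 0 < c -> c < d -> d < l ->
    (prim u b - prim u a) * (d - c) = (prim u d - prim u c) * (b - a).
  move=> a0 ab bl c0 cd dl.
  have prim1 x : 0 <= x -> prim (cst 1) x = x.
    move=> x0; rewrite /prim Rintegral_cst //= lebesgue_measure_itv /= lte_fin.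
    by case: ltP => [_|x0']; rewrite mul1r /= ?subr0 //; apply: le_anti; rewrite x0 x0'.
  have J p r : 0 < p -> p < r -> r < l ->
      \int[mu]_(x in `]0, l[) bump p r n x @[n --> \oo] --> r - p.
    move=> p0 pr rl; have := @bump_integral_cvg l p r (cst 1) p0 pr rl (itg_cst _ _).
    rewrite !prim1; [|exact: ltW|by apply: ltW; exact: lt_trans pr].
    by under eq_fun do under eq_Rintegral do rewrite mul1r.
  pose I v p r n := \int[mu]_(x in `]0, l[) (v x * bump p r n x).
  pose I1 p r n := \int[mu]_(x in `]0, l[) bump p r n x.
  have hA : I u a b n * I1 c d n @[n --> \oo] --> (prim u b - prim u a) * (d - c).
    by apply: cvgM; [exact: bump_integral_cvg|exact: J].
  have hB : I u c d n * I1 a b n @[n --> \oo] --> (prim u d - prim u c) * (b - a).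
    by apply: cvgM; [exact: bump_integral_cvg|exact: J].
  suff AB : (fun n => I u a b n * I1 c d n) = (fun n => I u c d n * I1 a b n).
    rewrite AB in hA; exact: (cvg_unique (@norm_hausdorff _ R^o) hA hB).
  apply/funext => n; rewrite /I /I1.
  set Iab := \int[mu]_(x in `]0, l[) bump a b n x.
  set Icd := \int[mu]_(x in `]0, l[) bump c d n x.
  (* the weights are exchanged so that chi has mean zero *)
  pose chi x := bump a b n x * Icd - bump c d n x * Iab.
  have ib p r : itg l (bump p r n) by apply: continuous_itg; exact: bump_continuous.
  have iub p r : itg l (fun x => u x * bump p r n x).
    apply: (@itg_mul_bounded _ _ _ 1) => // [|x _]; last exact: bump_bound.
    apply: (@measurable_funS _ _ _ _ setT) => //.
    by apply: continuous_measurable_fun; exact: bump_continuous.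
  have [phi [tphi dphi]] : exists phi, test_fun l phi /\ derive1 phi = chi.
    apply: (@test_fun_primitive l (Num.min a c) (Num.max b d)).
    - by rewrite lt_min a0.
    - by rewrite gt_max bl.
    - move=> x; apply: cvgB; (apply: cvgM; last exact: cvg_cst); exact: bump_continuous.
    - move=> x xo; rewrite /chi !bump_out ?mul0r ?subrr //; apply: contra xo => /andP[h1 h2].
        by rewrite ge_min le_max h1 h2 !orbT.
      by rewrite ge_min le_max h1 h2.
    - rewrite /chi intB; [|exact: itgZr|exact: itgZr].
      by rewrite !intZr // -/Iab -/Icd mulrC subrr.
  have := u0 _ tphi; rewrite dphi /chi.
  under eq_Rintegral do rewrite mulrBr !mulrA.
  rewrite intB; [|exact: itgZr|exact: itgZr].
  by rewrite !intZr // => /eqP; rewrite subr_eq0 => /eqP.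
(* Any reference interval inside the edge defines the common slope k. *)
pose c := l / 4; pose d := l / 2.
have c0 : 0 < c by rewrite divr_gt0.
have cd : c < d by rewrite /c /d; lra.
have dl : d < l by rewrite /d; lra.
pose k := (prim u d - prim u c) / (d - c).
have dc0 : d - c != 0 by rewrite subr_eq0 gt_eqF.
have {}key a b : 0 < a -> a < b -> b < l -> prim u b - prim u a = k * (b - a).
  move=> a0 ab bl; rewrite /k mulrAC -(key a b c d) // mulfK //.
exists k; apply: (@prim_affine_ae _ _ (prim u d - k * d)) => // x /andP[x0 xl].
case: (ltgtP x d) => [xd|dx|->]; last by rewrite subrK.
  by have := key _ _ x0 xd dl; rewrite mulrBr; lra.
by have := key _ _ (lt_trans c0 cd) dx xl; rewrite mulrBr; lra.
Qed.

Lemma itg_prim l u : 0 <= l -> itg l u -> itg l (prim u).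
Proof.
move=> l0 iu; apply: (@itg_bounded _ _ (prim (Num.norm \o u) l)).
  exact: prim_measurable.
by move=> x /andP[_ /ltW xl]; exact: prim_bound.
Qed.

(** The difference [u - prim w] has zero weak derivative, so [du_bois_reymond]
applies. *)
Lemma weak_derivative_prim l u w : 0 < l -> itg l u -> itg l w ->
  (forall phi, test_fun l phi -> \int[mu]_(x in `]0, l[) (u x * derive1 phi x) =
     - \int[mu]_(x in `]0, l[) (w x * phi x)) ->
  exists c, ae_eq mu `]0, l[%classic u (fun x => c + prim w x).
Proof.
move=> l0 iu iw uw.
have ipw : itg l (prim w) by apply: itg_prim => //; exact: ltW.
have [] := @du_bois_reymond l (fun x => u x - prim w x) l0; first exact: itgB.
  move=> phi tphi; have [ip idp] := test_fun_itg tphi.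
  have bdp : exists M, forall x, 0 < x < l -> `|derive1 phi x| <= M.
    have [_ cdp _] := tphi.
    have /compact_bounded[M [_ HM]] : compact (derive1 phi @` `[0, l]).
      apply: continuous_compact; last exact: segment_compact.
      exact: continuous_subspaceT.
    exists (M + 1) => x x0l; apply: HM; first by rewrite ltrDl.
    by exists x => //=; rewrite in_itv /= !ltW //; case/andP: x0l.
  have [M bM] := bdp.
  have mdp := measurable_int_itg idp.
  under eq_Rintegral do rewrite mulrBl.
  rewrite intB; [|exact: itg_mul_bounded bM|exact: itg_mul_bounded bM].
  by rewrite uw // prim_weak_derivative // subrr.
move=> c uc; exists c; apply: filterS uc => x /= + xl => /(_ xl) /eqP.
by rewrite subr_eq => /eqP.
Qed.

(** If u and w differ at x, by continuity they differ on a nonempty open interval,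
which is not a null set. *)
Lemma continuous_ae_eq l u w : 0 < l -> {within `[0, l], continuous u} ->
  {within `[0, l], continuous w} -> ae_eq mu `]0, l[%classic u w ->
  forall x, 0 <= x <= l -> u x = w x.
Proof.
move=> l0 cu cw uw x /andP[x0 xl]; apply: contrapT => /eqP; rewrite -subr_eq0 => h0.
have ch : {within `[0, l], continuous (fun y => u y - w y : R^o)}.
  by move=> y; apply: (@cvgB _ R^o); [exact: cu|exact: cw].
have xD : `[0, l]%classic x by rewrite /= in_itv /= x0.
have /(_ x xD) := (subspace_continuousP _ _).1 ch.
move=> /cvgrPdist_lt /(_ `|u x - w x|); rewrite normr_gt0 => /(_ h0).
rewrite /= near_withinE => -[d /= d0 hd].
(* u and w differ at every point of the open interval from p to r. *)
pose p := Num.max 0 (x - d); pose r := Num.min l (x + d).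
have pr : p < r by rewrite /p /r lt_min !gt_max l0 /=; apply/andP; split; lra.
have [N [mN N0 subN]] := uw.
have : (mu `]p, r[ <= mu N)%E.
  apply: le_measure; rewrite ?inE //=.
  move=> y /=; rewrite in_itv /= => /andP[py yr]; apply: subN => /=.
  move: py yr; rewrite /p /r gt_max lt_min => /andP[y0 xdy] /andP[yl yxd].
  move=> /(_ _)/= H; have {}H : u y = w y by apply: H; rewrite in_itv /= y0.
  have : `|u x - w x - (u y - w y)| < `|u x - w x|.
    apply: hd; first by rewrite /= ltr_norml; apply/andP; split; lra.
    by rewrite in_itv /= !ltW.
  by rewrite H subrr subr0 ltxx.
by rewrite N0 lebesgue_measure_itv /= lte_fin pr -EFinB lee_fin subr_le0 leNgt pr.
Qed.
End RealPrimitives.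

(** * Picard iteration for -u'' + q u = 0 *)

Section LinearODE.
Context {R : realType}.
Local Notation mu := (@lebesgue_measure R).
Implicit Types (l x : R) (u w v q : R -> R).

Lemma le_prim l u w x : itg l u -> itg l w -> x <= l ->
  (forall t, 0 < t < x -> u t <= w t) -> prim u x <= prim w x.
Proof.
move=> iu iw xl uw; have iux := itgS xl iu; have iwx := itgS xl iw.
by apply: le_Rintegral => // t; rewrite /= in_itv /=; exact: uw.
Qed.

Lemma primZ l u x c : itg l u -> x <= l -> prim (fun t => c * u t) x = c * prim u x.
Proof. by move=> iu xl; rewrite /prim intZl //; exact: itgS iu. Qed.

Lemma expR_scale_derive (c y : R) : is_derive y 1 (fun t : R => expR (c * t)) (c * expR (c * y)).
Proof.
have dc : is_derive y 1 (fun t : R => c * t) c.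
  by apply: is_derive_eq; rewrite /GRing.scale /= mulr1 ?addr0 ?mulr0 ?add0r.
by rewrite mulrC; exact: (@is_derive1_comp _ (@expR R) _ _ _ _ (is_derive_expR (c * y)) dc).
Qed.

(** Each integration of the weight expR (c * x) gains a factor 1 / c; a large c makes the
Picard iteration bounded. *)
Lemma prim_expR (c x : R) : 0 < c -> 0 <= x ->
  prim (fun t => expR (c * t)) x <= c^-1 * expR (c * x).
Proof.
move=> c0 x0.
have ce : continuous (fun t : R => expR (c * t)).
  move=> y; apply/differentiable_continuous/derivable1_diffP.
  by case: (expR_scale_derive c y).
have cce : continuous (fun t : R => c * expR (c * t)).
  by move=> y; apply: cvgM; [exact: cvg_cst|exact: ce].
have := prim_derive1 x0 (expR_scale_derive c) cce.
have ie : itg x (fun t : R => expR (c * t)) by exact: continuous_itg.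
rewrite (primZ c ie) // mulr0 expR0 => h.
by rewrite -ler_pdivrMl ?invr_gt0 // invrK h lerBlDr lerDl.
Qed.

Section Picard.
Variables (l : R) (q u0 : R -> R) (B C : R).
Hypotheses (l0 : 0 <= l) (mq : measurable_fun setT q) (qB : forall x, 0 <= q x <= B).
Hypotheses (mu0 : measurable_fun `]0, l[ u0) (u0C : forall x, 0 <= x <= l -> 0 <= u0 x <= C).

Let omega : R := 2 * B + 1.
Let bnd x : R := 2 * C * expR (omega * x).

Let B0 : 0 <= B. Proof. by have /andP[h1 h2] := qB 0; exact: le_trans h2. Qed.
Let C0 : 0 <= C.
Proof.
by have /andP[h1 h2] := @u0C 0 (introT andP (conj (lexx 0) l0));
  exact: le_trans h2.
Qed.
Let omega0 : 0 < omega. Proof. by rewrite /omega ltr_wpDl // mulr_ge0. Qed.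

Let K v x := prim (prim (fun t => q t * v t)) x.

Fixpoint picard n : R -> R := if n is n.+1 then fun x => u0 x + K (picard n) x else u0.

Let good v := measurable_fun `]0, l[ v /\ forall x, 0 <= x <= l -> 0 <= v x <= bnd x.

Let bndl x : 0 <= x <= l -> bnd x <= bnd l.
Proof.
move=> /andP[x0 xl]; rewrite /bnd ler_wpM2l ?mulr_ge0 // ler_expR.
by rewrite ler_wpM2l // ltW.
Qed.

Lemma itg_potential_mul v (M : R) : measurable_fun `]0, l[ v ->
  (forall x, 0 < x < l -> `|v x| <= M) ->
  itg l (fun t => q t * v t).
Proof.
move=> mv vM.
have iv : itg l v by exact: itg_bounded vM.
have -> : (fun t => q t * v t) = (fun t => v t * q t) by apply/funext => t; rewrite mulrC.
apply: (itg_mul_bounded (M := B)) => //; first exact: measurable_funS mq.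
by move=> x _; have /andP[h1 h2] := qB x; rewrite ger0_norm.
Qed.

Let good_itg v : good v -> itg l (fun t => q t * v t).
Proof.
move=> [mv vb]; apply: (@itg_potential_mul _ (bnd l)) => // x /andP[x0 xl].
have x0l : 0 <= x <= l by rewrite !ltW.
have /andP[h1 h2] := vb _ x0l.
by rewrite ger0_norm // (le_trans h2) // bndl.
Qed.

(** The bound [bnd] doubles C expR (omega x), and the double primitive of q v gains
B / omega ^ 2 <= 1 / 2 because omega = 2 B + 1; so K sends the bound to half of itself,
which leaves room for u0. *)
Let K_ge0_bnd v x : good v -> 0 <= x <= l -> 0 <= K v x <= C * expR (omega * x).
Proof.
move=> gv /andP[x0 xl]; have iv := good_itg gv; have [mv vb] := gv.
have ie c : itg l (fun t : R => c * expR (omega * t)).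
  apply/itgZl/continuous_itg => y; apply/differentiable_continuous/derivable1_diffP.
  by case: (expR_scale_derive omega y).
have qv0 t : 0 < t < l -> 0 <= q t * v t.
  move=> /andP[t0 tl]; have /andP[h1 h2] := qB t.
  by rewrite mulr_ge0 //; have /andP[] := vb t (introT andP (conj (ltW t0) (ltW tl))).
have p0 t : t <= l -> 0 <= prim (fun t => q t * v t) t.
  move=> tl; apply: Rintegral_ge0 => s /=; rewrite in_itv /= => /andP[s0 st].
  by apply: qv0; rewrite s0 (lt_le_trans st).
have p1 t : 0 <= t <= l -> prim (fun t => q t * v t) t <= (2 * C * B / omega) * expR (omega * t).
  move=> /andP[t0 tl].
  apply: (@le_trans _ _ (prim (fun s => (2 * C * B) * expR (omega * s)) t)).
    apply: (le_prim iv (ie _) tl) => s /andP[s0 st].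
    have /andP[h1 h2] := qB s.
    have /andP[h3 h4] := vb s (introT andP (conj (ltW s0) (ltW (lt_le_trans st tl)))).
    apply: (@le_trans _ _ (B * bnd s)); first exact: ler_pM.
    by rewrite /bnd [leRHS](_ : _ = B * (2 * C * expR (omega * s))) //; ring.
  have ie1 : itg l (fun t : R => expR (omega * t)).
    by have := ie 1; under eq_fun do rewrite mul1r.
  rewrite (primZ _ ie1) // -[leRHS]mulrA ler_wpM2l ?mulr_ge0 //.
  exact: prim_expR.
apply/andP; split.
  by apply: Rintegral_ge0 => s /=; rewrite in_itv /= => /andP[s0 sx]; apply/p0/ltW/(lt_le_trans sx).
apply: (@le_trans _ _ (prim (fun s => (2 * C * B / omega) * expR (omega * s)) x)).
  apply: (le_prim _ (ie _) xl); first exact: itg_prim.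
  by move=> t /andP[t0 tx]; apply: p1; rewrite !ltW //; exact: lt_le_trans tx xl.
have ie1 : itg l (fun t : R => expR (omega * t)).
  by have := ie 1; under eq_fun do rewrite mul1r.
rewrite (primZ _ ie1) //.
apply: (@le_trans _ _ ((2 * C * B / omega) * (omega^-1 * expR (omega * x)))).
  by rewrite ler_wpM2l ?prim_expR // !mulr_ge0 // invr_ge0 ltW.
rewrite mulrA ler_wpM2r ?expR_ge0 //.
rewrite -mulrA -invfM ler_pdivrMr ?mulr_gt0 //.
rewrite -subr_ge0 (_ : _ - _ = C * (omega * omega - 2 * B)); last by ring.
by rewrite mulr_ge0 // /omega; move: B0; nra.
Qed.

Let good_step v : good v -> good (fun x => u0 x + K v x).
Proof.
move=> gv; have iv := good_itg gv; split.
  apply: measurable_funD => //; apply: prim_measurable => //; exact: itg_prim.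
move=> x x0l; have /andP[h1 h2] := K_ge0_bnd gv x0l; have /andP[h3 h4] := u0C x0l.
rewrite addr_ge0 //= /bnd mulrAC.
have e1 : 1 <= expR (omega * x).
  by rewrite -expR0 ler_expR mulr_ge0 //; [exact: ltW|case/andP: x0l].
have : C <= C * expR (omega * x) by rewrite ler_peMr.
lra.
Qed.

Let picard_good n : good (picard n).
Proof.
elim: n => [|n ih]; last exact: good_step.
split => // x x0l; have /andP[h3 h4] := u0C x0l; rewrite h3 /= /bnd.
have e1 : 1 <= expR (omega * x).
  by rewrite -expR0 ler_expR mulr_ge0 //; [exact: ltW|case/andP: x0l].
have : C <= C * expR (omega * x) by rewrite ler_peMr.
by rewrite mulrAC; move: C0; lra.
Qed.

Let picard_step n x : 0 <= x <= l -> picard n x <= picard n.+1 x.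
Proof.
elim: n x => [|n ih] x x0l.
  by rewrite /= lerDl; have /andP[] := K_ge0_bnd (picard_good 0) x0l.
rewrite [leLHS]/= [leRHS]/= lerD2l.
have i1 := good_itg (picard_good n); have i2 := good_itg (picard_good n.+1).
have /andP[x0 xl] := x0l.
apply: (le_prim (itg_prim l0 i1) (itg_prim l0 i2) xl) => t /andP[t0 tx].
have tl := lt_le_trans tx xl.
apply: (le_prim i1 i2 (ltW tl)) => s /andP[s0 st].
rewrite ler_wpM2l //; first by case/andP: (qB s).
by apply: ih; rewrite !ltW // (lt_trans st).
Qed.

Let picard_nd x : 0 <= x <= l -> nondecreasing_seq (picard ^~ x).
Proof. by move=> x0l; apply/nondecreasing_seqP => n; exact: picard_step. Qed.

Let picard_cvg x : 0 <= x <= l -> cvgn (picard ^~ x).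
Proof.
move=> x0l; apply: nondecreasing_is_cvgn; first exact: picard_nd.
exists (bnd x) => _ [n _ <-]; by have [_ /(_ _ x0l)/andP[]] := picard_good n.
Qed.

(** The iterates increase with n, as q and u0 are nonnegative, and stay below [bnd]; their
pointwise limit is a fixed point by dominated convergence. *)
Lemma picard_solution : exists u, [/\ measurable_fun `]0, l[ u,
  exists M, forall x, 0 <= x <= l -> `|u x| <= M,
  forall x, 0 <= x <= l -> u0 x <= u x &
  forall x, 0 <= x <= l -> u x = u0 x + prim (prim (fun t => q t * u t)) x].
Proof.
pose u x := limn (picard ^~ x).
have pu x : 0 <= x <= l -> picard n x @[n --> \oo] --> u x by exact: picard_cvg.
have oc x : 0 < x < l -> 0 <= x <= l by move=> /andP[h1 h2]; rewrite !ltW.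
have mu_ : measurable_fun `]0, l[ u.
  apply: (measurable_fun_cvg (h := picard)); first by move=> n; have [] := picard_good n.
  by move=> x /=; rewrite in_itv /= => /oc/pu.
have ub x : 0 <= x <= l -> `|u x| <= bnd l.
  move=> x0l; rewrite ger0_norm.
    apply: limr_le; first exact: picard_cvg.
    apply: nearW => n; have [_ /(_ _ x0l)/andP[_ h]] := picard_good n.
    exact: le_trans h (bndl x0l).
  apply: limr_ge; first exact: picard_cvg.
  by apply: nearW => n; have [_ /(_ _ x0l)/andP[]] := picard_good n.
have iqu : itg l (fun t => q t * u t) by apply: (itg_potential_mul mu_) => x /oc; exact: ub.
have pb n x : 0 <= x <= l -> `|q x * picard n x| <= B * bnd l.
  move=> x0l; have /andP[h1 h2] := qB x.
  have [_ /(_ _ x0l)/andP[h3 h4]] := picard_good n.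
  rewrite ger0_norm ?mulr_ge0 // ler_pM // (le_trans h4) //; exact: bndl.
have cv1 x : 0 <= x <= l -> prim (fun t => q t * picard n t) x @[n --> \oo] -->
    prim (fun t => q t * u t) x.
  move=> /andP[x0 xl].
  have xx t : 0 < t < x -> 0 <= t <= l.
    by move=> /andP[t0 tx]; rewrite !ltW // (lt_le_trans tx).
  apply: (@dominated_prim_cvg _ x _ _ (cst (B * bnd l))).
  - by move=> n; apply: itgS xl _; exact/good_itg/picard_good.
  - exact: measurable_int_itg (itgS xl iqu).
  - by move=> t /xx/pu h; apply: cvgM => //; exact: cvg_cst.
  - exact: itg_cst.
  - by move=> n t /xx; exact: pb.
exists u; split => //; first by exists (bnd l).
  move=> x x0l; apply: limr_ge; first exact: picard_cvg.
  by apply: nearW => n; exact: (picard_nd x0l (leq0n n)).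
move=> x x0l; have /andP[x0 xl] := x0l.
have xx t : 0 < t < x -> 0 <= t <= l.
  by move=> /andP[t0 tx]; rewrite !ltW // (lt_le_trans tx).
have cv2 : prim (prim (fun t => q t * picard n t)) x @[n --> \oo] -->
    prim (prim (fun t => q t * u t)) x.
  apply: (@dominated_prim_cvg _ x _ _ (cst (prim (cst (B * bnd l)) l))).
  - by move=> n; apply: itgS xl _; apply: itg_prim => //; exact/good_itg/picard_good.
  - exact: measurable_int_itg (itgS xl (itg_prim l0 iqu)).
  - by move=> t /xx; exact: cv1.
  - exact: itg_cst.
  - move=> n t /xx /andP[t0 tl].
    have ig := good_itg (picard_good n).
    apply: (le_trans (prim_bound tl ig)); apply: le_prim (itg_norm ig) (itg_cst _ _) (lexx _) _.
    by move=> s /oc /pb.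
have cv3 : picard n.+1 x @[n --> \oo] --> u0 x + prim (prim (fun t => q t * u t)) x.
  by apply: cvgD cv2; exact: cvg_cst.
have cv4 : picard n.+1 x @[n --> \oo] --> u x.
  by have := pu _ x0l; rewrite -(cvg_shiftS (picard ^~ x)).
exact: (cvg_unique (@norm_hausdorff _ R^o) cv4 cv3).
Qed.
End Picard.

(** * Borel versions of Lebesgue measurable functions *)

(** For each rational r the set where q < r is Borel up to a null set; M is the union of
these countably many null sets. *)
Lemma borel_representative l q : lebesgue_measurable_fun `]0, l[ q ->
  exists M, [/\ measurable M, mu M = 0%E & measurable_fun (`]0, l[ `\` M) q].
Proof.
move=> mq; pose D : set R := `]0, l[%classic.
have BN (r : rat) : exists BM : set R * set R, [/\ measurable BM.1, measurable BM.2,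
    mu BM.2 = 0%E, BM.1 `<=` D `&` [set x | q x < ratr r] &
    D `&` [set x | q x < ratr r] `<=` BM.1 `|` BM.2].
  have : (completed_algebra_gen mu) (D `&` q @^-1` `]-oo, (ratr r : R)[).
    rewrite -g_sigma_completed_algebra_genE; apply: mq => //.
    apply: sub_sigma_algebra.
    exists D; first exact: measurable_itv.
    by exists set0; [exact: negligible_set0|rewrite setU0].
  move=> [B mB [N [M [mM M0 NM]] BNE]]; exists (B, M); split => //=.
    move=> x Bx; have : (B `|` N) x by left.
    by rewrite BNE => -[Dx]; rewrite /= in_itv.
  move=> x [Dx qx]; have : (D `&` q @^-1` `]-oo, (ratr r : R)[) x.
    by split => //; rewrite /= in_itv.
  by rewrite -BNE => -[|/NM]; [left|right].
pose B r := (projT1 (cid (BN r))).1; pose M r := (projT1 (cid (BN r))).2.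
have mB r : measurable (B r) by rewrite /B; case: cid => ? [].
have mM r : measurable (M r) by rewrite /M; case: cid => ? [].
have M0 r : mu (M r) = 0%E by rewrite /M; case: cid => ? [].
have BD r : B r `<=` D `&` [set x | q x < ratr r] by rewrite /B; case: cid => ? [].
have DB r : D `&` [set x | q x < ratr r] `<=` B r `|` M r.
  by rewrite /B /M; case: cid => ? [].
have mbM : measurable (\bigcup_r M r) by exact: bigcupT_measurable_rat.
exists (\bigcup_r M r); split => //.
  (* Null sets are closed under unions indexed by nat, so the rationals are enumerated. *)
  pose F n := if unpickle n is Some r then M r else set0.
  have : mu.-negligible (\bigcup_n F n).
    apply: negligible_bigcup => n; rewrite /F; case: unpickle => [r|].
      exists (M r); split; [exact: mM|exact: M0|by []].
    exact: negligible_set0.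
  move=> [N [mN N0 FN]]; apply/eqP; rewrite eq_le measure_ge0 andbT -N0.
  apply: le_measure; rewrite ?inE //.
  move=> x [r _ Mx]; apply: FN.
  have FE : F (pickle r) = M r by rewrite /F pickleK.
  by exists (pickle r); [exact: I|rewrite FE].
apply: (measurability _ (RGenInftyO.measurableE R)) => _ [_ [x ->] <-].
rewrite (_ : _ `&` _ = \bigcup_(r : rat) if (ratr r : R) < x then B r `\` \bigcup_r M r else set0).
  by apply: bigcupT_measurable_rat => r; case: ifP => // _; exact: measurableD.
apply/seteqP; split => [y [[Dy nMy]]|y [r _]].
  rewrite /= in_itv /= => qx.
  have /rat_in_itvoo[r] := qx; rewrite in_itv /= => /andP[qr rx].
  exists r => //; rewrite rx; split => //.
  by have [//|My] := DB r _ (conj Dy qr); exfalso; apply: nMy; exists r.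
case: ifP => // rx [By nMy]; have [Dy qy] := BD _ _ By.
by split => //; rewrite /= in_itv /= (lt_trans qy).
Qed.

(** Truncating at 0 turns the almost everywhere bound from below into a bound
everywhere, and off the interval and on the exceptional null set the function is set to 0. *)
Lemma borel_potential l q B : 0 < l -> lebesgue_measurable_fun `]0, l[ q ->
  (forall x, x \in `]0, l[ -> `|q x| <= B) ->
  {ae mu, forall x : R, 0 < x < l -> 0 <= q x} ->
  exists p : R -> R, [/\ measurable_fun setT p, forall x, 0 <= p x <= B &
    ae_eq mu `]0, l[%classic q p].
Proof.
move=> l0 mq qB q0; have [M [mM M0 mqM]] := borel_representative mq.
have mD : measurable (`]0, l[%classic `\` M) by exact: measurableD.
pose p := (fun x => Num.max 0 ((q \_ (`]0, l[ `\` M)) x)).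
have B0 : 0 <= B.
  by apply: le_trans (qB (l / 2) _); rewrite // in_itv /=; apply/andP; split; lra.
exists p; split.
- apply: measurable_maxr; first exact: measurable_cst.
  exact/(measurable_restrictT _ _).1.
- move=> x; rewrite /p le_max lexx /= ge_max B0 /= patchE; case: ifPn => //.
  by rewrite inE => -[xl _]; apply: le_trans (ler_norm _) (qB _ _).
- have nM : {ae mu, forall x, ~ M x}.
    by exists M; split => // x /= /contrapT.
  move: q0 nM; apply: filterS2; first exact: (ae_filter_ringOfSetsType mu).
  move=> x /= q0 nMx xl.
  rewrite /p patchE mem_set //; rewrite max_r //; apply: q0.
  by move: xl; rewrite /= in_itv.
Qed.
End LinearODE.

(** * Integrals of complex-valued functions *)

Section ComplexIntegrals.
Local Open Scope complex_scope.
Context {R : realType}.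
Local Notation mu := (@lebesgue_measure R).
Local Notation C := R[i].
Local Notation Re := complex.Re.
Local Notation Im := complex.Im.
Implicit Types (l x : R) (u w v : R -> C) (z : C).

Lemma cReM z1 z2 : Re (z1 * z2) = Re z1 * Re z2 - Im z1 * Im z2.
Proof. by case: z1 z2 => [? ?] [? ?]. Qed.

Lemma cImM z1 z2 : Im (z1 * z2) = Re z1 * Im z2 + Im z1 * Re z2.
Proof. by case: z1 z2 => [? ?] [? ?]. Qed.

Lemma cReD z1 z2 : Re (z1 + z2) = Re z1 + Re z2.
Proof. by case: z1 z2 => [? ?] [? ?]. Qed.

Lemma cImD z1 z2 : Im (z1 + z2) = Im z1 + Im z2.
Proof. by case: z1 z2 => [? ?] [? ?]. Qed.

Lemma cReJ z : Re (conjc z) = Re z. Proof. by case: z. Qed.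

Lemma cImJ z : Im (conjc z) = - Im z. Proof. by case: z. Qed.

Lemma cReN z : Re (- z) = - Re z. Proof. by case: z. Qed.

Lemma cImN z : Im (- z) = - Im z. Proof. by case: z. Qed.

Lemma complexP z1 z2 : Re z1 = Re z2 -> Im z1 = Im z2 -> z1 = z2.
Proof. by case: z1 z2 => [? ?] [? ?] /= -> ->. Qed.

Lemma cJM z1 z2 : conjc (z1 * z2) = conjc z1 * conjc z2.
Proof. exact: rmorphM. Qed.

Lemma cJD z1 z2 : conjc (z1 + z2) = conjc z1 + conjc z2.
Proof. exact: rmorphD. Qed.

Lemma cJ_sum (I : finType) (P : pred I) (F : I -> C) :
  conjc (\sum_(i | P i) F i) = \sum_(i | P i) conjc (F i).
Proof. exact: rmorph_sum. Qed.

Definition citg l u := itg l (fun x => Re (u x)) /\ itg l (fun x => Im (u x)).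

Definition cmeas l u := measurable_fun `]0, l[ (fun x => Re (u x)) /\
  measurable_fun `]0, l[ (fun x => Im (u x)).

Lemma citg_cmeas l u : citg l u -> cmeas l u.
Proof. by move=> [i1 i2]; split; exact: measurable_int_itg. Qed.

Lemma citgS l x u : x <= l -> citg l u -> citg x u.
Proof. by move=> xl [i1 i2]; split; exact: itgS xl _. Qed.

Lemma citgD l u w : citg l u -> citg l w -> citg l (fun x => u x + w x).
Proof.
move=> [u1 u2] [w1 w2]; split.
  by under eq_fun do rewrite cReD; exact: itgD.
by under eq_fun do rewrite cImD; exact: itgD.
Qed.

Lemma citgZ l u z : citg l u -> citg l (fun x => z * u x).
Proof.
move=> [u1 u2]; split.
  by under eq_fun do rewrite cReM; apply: itgB; exact: itgZl.
by under eq_fun do rewrite cImM; apply: itgD; exact: itgZl.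
Qed.

Lemma citg_cst l z : citg l (fun=> z).
Proof. by split; exact: itg_cst. Qed.

Lemma citg_conj l u : citg l u -> citg l (fun x => conjc (u x)).
Proof.
move=> [u1 u2]; split.
  by under eq_fun do rewrite cReJ.
by under eq_fun do rewrite cImJ; exact: itgN.
Qed.

Lemma CintD l u w : citg l u -> citg l w ->
  Cintegral l (fun x => u x + w x) = Cintegral l u + Cintegral l w.
Proof.
move=> [u1 u2] [w1 w2]; apply: complexP; rewrite /Cintegral /=.
  by under eq_Rintegral do rewrite cReD; exact: intD.
by under eq_Rintegral do rewrite cImD; exact: intD.
Qed.

Lemma CintZ l u z : citg l u -> Cintegral l (fun x => z * u x) = z * Cintegral l u.
Proof.
move=> [u1 u2]; apply: complexP; rewrite ?cReM ?cImM /Cintegral /=.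
  by under eq_Rintegral do rewrite cReM; rewrite intB ?intZl //; exact: itgZl.
by under eq_Rintegral do rewrite cImM; rewrite intD ?intZl //; exact: itgZl.
Qed.

Lemma Cint_conj l u : citg l u -> Cintegral l (fun x => conjc (u x)) = conjc (Cintegral l u).
Proof.
move=> [u1 u2]; apply: complexP; rewrite /Cintegral /=.
  by under eq_Rintegral do rewrite cReJ.
by under eq_Rintegral do rewrite cImJ; exact: intN.
Qed.

Lemma eq_Cint l u w : (forall x, 0 < x < l -> u x = w x) -> Cintegral l u = Cintegral l w.
Proof.
by move=> uw; congr (_ +i* _); apply: eq_Rintegral => x; rewrite inE /= in_itv /= => /uw ->.
Qed.

Lemma Cint0 l u : l <= 0 -> Cintegral l u = 0.
Proof. by move=> l0; apply: complexP; rewrite /Cintegral /=; exact: prim0. Qed.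

Lemma Cint_cst l z : 0 <= l -> Cintegral l (fun=> z) = l%:C * z.
Proof.
move=> l0; have E (c : R) : \int[mu]_(x in `]0, l[) c = l * c.
  rewrite Rintegral_cst //= lebesgue_measure_itv /= lte_fin mulrC.
  by case: ltP => [_|l0']; rewrite /= ?subr0 //; congr (_ * _); apply: le_anti; rewrite l0 l0'.
by apply: complexP; rewrite ?cReM ?cImM /Cintegral /= E mul0r ?subr0 ?addr0.
Qed.

Lemma ae_sub l (P Q : R -> Prop) : (forall x, 0 < x < l -> P x -> Q x) ->
  {ae mu, forall x, `]0, l[%classic x -> P x} -> {ae mu, forall x, `]0, l[%classic x -> Q x}.
Proof.
move=> PQ; apply: filterS; first exact: (ae_filter_ringOfSetsType mu).
by move=> x h xl; apply: PQ; [move: xl; rewrite /= in_itv|exact: h].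
Qed.

Lemma ae_sub2 l (P P' Q : R -> Prop) : (forall x, 0 < x < l -> P x -> P' x -> Q x) ->
  {ae mu, forall x, `]0, l[%classic x -> P x} ->
  {ae mu, forall x, `]0, l[%classic x -> P' x} -> {ae mu, forall x, `]0, l[%classic x -> Q x}.
Proof.
move=> PQ; apply: filterS2; first exact: (ae_filter_ringOfSetsType mu).
by move=> x h h' xl; apply: PQ; [move: xl; rewrite /= in_itv|exact: h|exact: h'].
Qed.

Lemma ae_sub3 l (P P' P'' Q : R -> Prop) :
  (forall x, 0 < x < l -> P x -> P' x -> P'' x -> Q x) ->
  {ae mu, forall x, `]0, l[%classic x -> P x} ->
  {ae mu, forall x, `]0, l[%classic x -> P' x} ->
  {ae mu, forall x, `]0, l[%classic x -> P'' x} -> {ae mu, forall x, `]0, l[%classic x -> Q x}.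
Proof.
move=> PQ; apply: filterS3; first exact: (ae_filter_ringOfSetsType mu).
by move=> x h h' h'' xl; apply: PQ; [move: xl; rewrite /= in_itv|exact: h|exact: h'|exact: h''].
Qed.

Lemma Cint_ae l u w : cmeas l u -> cmeas l w -> ae_eq mu `]0, l[%classic u w ->
  Cintegral l u = Cintegral l w.
Proof.
move=> [u1 u2] [w1 w2] uw; congr (_ +i* _); apply: Rintegral_ae => //.
  by apply: ae_sub uw => x _ ->.
by apply: ae_sub uw => x _ ->.
Qed.

Lemma citg_mul_prim l u w : 0 <= l -> citg l u -> citg l w ->
  citg l (fun x => u x * Cintegral x w).
Proof.
move=> l0 [u1 u2] [w1 w2]; split.
  by under eq_fun do rewrite cReM; apply: itgB; exact: itg_mul_prim.
by under eq_fun do rewrite cImM; apply: itgD; exact: itg_mul_prim.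
Qed.

Lemma citg_prim l w : 0 <= l -> citg l w -> citg l (Cintegral ^~ w).
Proof. by move=> l0 [w1 w2]; split; exact: itg_prim. Qed.

(** Bilinear expansion of [prim_by_parts] into real and imaginary parts. *)
Lemma Cint_by_parts l u w : 0 <= l -> citg l u -> citg l w ->
  Cintegral l (fun x => u x * Cintegral x w) =
  Cintegral l u * Cintegral l w - Cintegral l (fun x => w x * Cintegral x u).
Proof.
move=> l0 [u1 u2] [w1 w2].
have E (u' w' : R -> R) : itg l u' -> itg l w' ->
  \int[mu]_(x in `]0, l[) (u' x * prim w' x) =
  prim u' l * prim w' l - \int[mu]_(x in `]0, l[) (w' x * prim u' x) by exact: prim_by_parts.
have RE (a b : R -> C) : citg l a -> citg l b ->
    Re (Cintegral l (fun x => a x * Cintegral x b)) =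
    \int[mu]_(x in `]0, l[) (Re (a x) * prim (fun t => Re (b t)) x) -
    \int[mu]_(x in `]0, l[) (Im (a x) * prim (fun t => Im (b t)) x).
  move=> [a1 a2] [b1 b2]; rewrite -intB; [|exact: itg_mul_prim|exact: itg_mul_prim].
  by apply: eq_Rintegral => x _; exact: cReM.
have IE (a b : R -> C) : citg l a -> citg l b ->
    Im (Cintegral l (fun x => a x * Cintegral x b)) =
    \int[mu]_(x in `]0, l[) (Re (a x) * prim (fun t => Im (b t)) x) +
    \int[mu]_(x in `]0, l[) (Im (a x) * prim (fun t => Re (b t)) x).
  move=> [a1 a2] [b1 b2]; rewrite -intD; [|exact: itg_mul_prim|exact: itg_mul_prim].
  by apply: eq_Rintegral => x _; exact: cImM.
have S4 (a b x y : R) : a - x - (b - y) = a - b - (x - y) by ring.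
have S4' (a b x y : R) : a - x + (b - y) = a + b - (y + x) by ring.
apply: complexP.
- rewrite cReD cReN cReM RE // RE // (E _ _ u1 w1) (E _ _ u2 w2) /Cintegral /= /prim.
  exact: S4.
- rewrite cImD cImN cImM IE // IE // (E _ _ u1 w2) (E _ _ u2 w1) /Cintegral /= /prim.
  exact: S4'.
Qed.

Lemma le_itg l (u w : R -> R) : measurable_fun `]0, l[ u ->
  (forall x, 0 < x < l -> `|u x| <= w x) -> itg l w -> itg l u.
Proof.
move=> mu_ uw; apply: le_integrable => //; first exact/measurable_EFinP.
move=> x; rewrite /= in_itv /= => xl; rewrite lee_fin.
exact: le_trans (uw x xl) (ler_norm _).
Qed.

(** On a bounded interval L2 is contained in L1, by |a| <= 1 + a ^ 2. *)
Lemma citg_square l u : square_integrable l u -> citg l u.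
Proof.
move=> [m1 m2 iu].
have iu1 : itg l (fun x => 1 + normsq (u x)) by apply: itgD => //; exact: itg_cst.
by split; apply: (le_itg _ _ iu1) => // x _; rewrite /normsq ler_norml; apply/andP; split; nra.
Qed.

Lemma cmeasM l u w : cmeas l u -> cmeas l w -> cmeas l (fun x => u x * w x).
Proof.
move=> [u1 u2] [w1 w2]; split.
  under [X in measurable_fun _ X]eq_fun do rewrite cReM.
  by apply: measurable_funB; exact: measurable_funM.
under [X in measurable_fun _ X]eq_fun do rewrite cImM.
by apply: measurable_funD; exact: measurable_funM.
Qed.

Lemma cmeas_conj l u : cmeas l u -> cmeas l (fun x => conjc (u x)).
Proof.
move=> [u1 u2]; split; first by under [X in measurable_fun _ X]eq_fun do rewrite cReJ.
under [X in measurable_fun _ X]eq_fun do rewrite cImJ.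
exact: measurableT_comp.
Qed.

Lemma square_cmeas l u : square_integrable l u -> cmeas l u.
Proof. by move=> [? ? _]. Qed.

Lemma citgM l u w : square_integrable l u -> square_integrable l w ->
  citg l (fun x => u x * w x).
Proof.
move=> su sw; have [m1 m2] := cmeasM (square_cmeas su) (square_cmeas sw).
have [_ _ iu] := su; have [_ _ iw] := sw.
have iuw : itg l (fun x => normsq (u x) + normsq (w x)) by exact: itgD.
have bound (a b c d : R) : `|a * c - b * d| <= a ^+ 2 + b ^+ 2 + (c ^+ 2 + d ^+ 2).
  have := sqr_ge0 (a - c); have := sqr_ge0 (a + c).
  have := sqr_ge0 (b - d); have := sqr_ge0 (b + d).
  by rewrite ler_norml; lra.
split; apply: (le_itg _ _ iuw) => // x _; first by rewrite cReM; exact: bound.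
have := bound (Re (u x)) (Im (u x)) (Im (w x)) (- Re (w x)).
by rewrite mulrN opprK sqrrN -cImM (addrC (Im (w x) ^+ 2)).
Qed.

Lemma square_integrable_conj l u : square_integrable l u ->
  square_integrable l (fun x => conjc (u x)).
Proof.
move=> [m1 m2 iu]; have [m1' m2'] := cmeas_conj (conj m1 m2).
split => //; apply: eq_integrable iu => // x _.
by rewrite /normsq cReJ cImJ sqrrN.
Qed.

Lemma square_integrable_bounded l u (M : R) : cmeas l u ->
  (forall x, 0 < x < l -> normsq (u x) <= M) -> square_integrable l u.
Proof.
move=> [m1 m2] uM; split => //.
apply: (itg_bounded (M := M)); first exact: measurable_normsq.
by move=> x /uM; rewrite ger0_norm // normsq_ge0.
Qed.

Lemma square_integrable_prim l w z : 0 <= l -> citg l w ->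
  square_integrable l (fun x => z + Cintegral x w).
Proof.
move=> l0 iw; have [i1 i2] := iw.
have [m1 m2] := citg_cmeas (citgD (citg_cst l z) (citg_prim l0 iw)).
pose A := prim (Num.norm \o (fun x => Re (w x))) l.
pose B := prim (Num.norm \o (fun x => Im (w x))) l.
have sq (a b M : R) : `|b| <= M -> (a + b) ^+ 2 <= (`|a| + M) ^+ 2.
  move=> bM; rewrite -[leLHS]real_normK ?num_real // lerXn2r ?nnegrE //.
    by rewrite addr_ge0 // (le_trans _ bM).
  exact: le_trans (ler_normD _ _) (lerD (lexx _) bM).
apply: (@square_integrable_bounded _ _ ((`|Re z| + A) ^+ 2 + (`|Im z| + B) ^+ 2)) => //.
move=> x /andP[x0 xl]; rewrite /normsq cReD cImD.
by apply: lerD; apply: sq; apply: prim_bound => //; exact: ltW.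
Qed.
End ComplexIntegrals.

(** * Representatives of L2 classes and weak derivatives *)

Section L2Representatives.
Local Open Scope quotient_scope.
Local Open Scope complex_scope.
Context {R : realType} {G : metric_graph R}.
Local Notation mu := (@lebesgue_measure R).
Local Notation C := R[i].
Local Notation Re := complex.Re.
Local Notation Im := complex.Im.
Implicit Types (e : edge G) (b : bool) (f g h : L2 G) (z : C).

Definition aeq e (u w : R -> C) := ae_eq mu `]0, len e[%classic u w.

Lemma aeq_sym e u w : aeq e u w -> aeq e w u.
Proof. by apply: ae_sub => x _ ->. Qed.

Lemma aeq_trans e u w v : aeq e u w -> aeq e w v -> aeq e u v.
Proof. by apply: ae_sub2 => x _ -> ->. Qed.

Lemma aeq_fun e u w : (forall x, 0 < x < len e -> u x = w x) -> aeq e u w.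
Proof. by move=> uw; apply: aeW => x; rewrite /= in_itv; exact: uw. Qed.

Lemma L2rep_square f e : square_integrable (len e) (L2rep f e).
Proof. by rewrite /L2rep; case: (repr f) => F /= /asboolP; exact. Qed.

Lemma citg_rep f e : citg (len e) (L2rep f e).
Proof. exact/citg_square/L2rep_square. Qed.

Lemma cmeas_rep f e : cmeas (len e) (L2rep f e).
Proof. exact/citg_cmeas/citg_rep. Qed.

Lemma L2rep_pi (F : L2fun G) e : aeq e (L2rep (\pi F) e) (L2val F e).
Proof.
have : repr (\pi_(L2 G) F) == F %[mod (L2 G)] by rewrite reprK.
rewrite -Quotient.idealrBE => /asboolP /(_ e); apply: ae_sub => x _.
have -> : L2val (repr (\pi_(L2 G) F) - F) e x = L2val (repr (\pi_(L2 G) F)) e x - L2val F e x by [].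
by move/eqP; rewrite subr_eq0 => /eqP.
Qed.

Lemma L2_ext f g : (forall e, aeq e (L2rep f e) (L2rep g e)) -> f = g.
Proof.
move=> fg; rewrite -[f]reprK -[g]reprK; apply/eqP.
rewrite -Quotient.idealrBE; apply/asboolP => e; apply: ae_sub (fg e) => x _ fgx.
have -> : L2val (repr f - repr g) e x = L2val (repr f) e x - L2val (repr g) e x by [].
by rewrite -/(L2rep f e x) fgx subrr.
Qed.

Lemma L2rep_lin z f g e :
  aeq e (L2rep (z *: f + g) e) (fun x => z * L2rep f e x + L2rep g e x).
Proof.
rewrite -[f]reprK -[g]reprK.
have -> : z *: \pi_(L2 G) (repr f) + \pi_(L2 G) (repr g) = \pi_(L2 G) (z *: repr f + repr g).
  by rewrite pi_L2D -L2scale_pi.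
apply: aeq_trans (L2rep_pi _ _) _; rewrite !reprK.
exact: aeq_fun.
Qed.

Lemma L2rep0 e : aeq e (L2rep (0 : L2 G) e) (fun=> 0).
Proof.
have -> : 0 = \pi_(L2 G) 0 by rewrite raddf0.
by apply: aeq_trans (L2rep_pi _ _) _; exact: aeq_fun.
Qed.

Lemma L2_build (u : edge G -> R -> C) : (forall e, square_integrable (len e) (u e)) ->
  exists f, forall e, aeq e (L2rep f e) (u e).
Proof.
move=> su; have uP : u \in @L2pred R G by apply/asboolP.
by exists (\pi_(L2 G) (MkL2fun uP)) => e; exact: L2rep_pi.
Qed.

Lemma Cint_aeq e u w : cmeas (len e) u -> cmeas (len e) w -> aeq e u w ->
  Cintegral (len e) u = Cintegral (len e) w.
Proof. exact: Cint_ae. Qed.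

Lemma aeq_subset l u w x : x <= l -> ae_eq mu `]0, l[%classic u w ->
  ae_eq mu `]0, x[%classic (u : R -> C) w.
Proof.
move=> xl; apply: ae_eq_subset => t; rewrite /= !in_itv /= => /andP[-> tx] /=.
exact: lt_le_trans xl.
Qed.

Lemma cmeasS l x (u : R -> C) : x <= l -> cmeas l u -> cmeas x u.
Proof.
move=> xl [u1 u2]; split; apply: (@measurable_funS _ _ _ _ `]0, l[%classic) => //.
  exact: subset_itvl.
exact: subset_itvl.
Qed.

Lemma Cint_aeqx e u w x : x <= len e -> cmeas (len e) u -> cmeas (len e) w -> aeq e u w ->
  Cintegral x u = Cintegral x w.
Proof.
move=> xl mu_ mw uw; apply: Cint_ae; [exact: cmeasS xl _|exact: cmeasS xl _|].
exact: aeq_subset xl uw.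
Qed.

(** Evaluates the definitions by [xget] once the object is known to be unique. *)
Lemma xget_eq (T : choiceType) (x0 : T) (P : set T) (z : T) :
  P z -> (forall w, P w -> w = z) -> xget x0 P = z.
Proof. by move=> Pz uniq; apply: uniq; exact: (xgetPex x0 (ex_intro _ z Pz)). Qed.

Definition primitive_of f g := forall e, exists z,
  aeq e (L2rep f e) (fun x => z + Cintegral x (L2rep g e)).

Lemma Cint_mul_real l (u : R -> C) (r : R -> R) :
  Cintegral l (fun x => u x * (r x)%:C) =
  (\int[mu]_(x in `]0, l[) (Re (u x) * r x)) +i* (\int[mu]_(x in `]0, l[) (Im (u x) * r x)).
Proof.
congr (_ +i* _); apply: eq_Rintegral => x _.
  by rewrite cReM /= mulr0 subr0.
by rewrite cImM /= mulr0 add0r.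
Qed.

Lemma weak_derivative_primitive f g : is_weak_derivative f g -> primitive_of f g.
Proof.
move=> fg e; have [f1 f2] := citg_rep f e; have [g1 g2] := citg_rep g e.
have E phi : test_fun (len e) phi ->
    (\int[mu]_(x in `]0, len e[) (Re (L2rep f e x) * derive1 phi x) =
    - (\int[mu]_(x in `]0, len e[) (Re (L2rep g e x) * phi x))) /\
    (\int[mu]_(x in `]0, len e[) (Im (L2rep f e x) * derive1 phi x) =
    - (\int[mu]_(x in `]0, len e[) (Im (L2rep g e x) * phi x))).
  by move=> tphi; have := fg e phi tphi; rewrite !Cint_mul_real => -[].
have [c1 h1] := weak_derivative_prim (len_gt0 e) f1 g1 (fun phi tphi => (E phi tphi).1).
have [c2 h2] := weak_derivative_prim (len_gt0 e) f2 g2 (fun phi tphi => (E phi tphi).2).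
exists (c1 +i* c2); apply: ae_sub2 h1 h2 => x _ h1 h2.
by apply: complexP; rewrite ?cReD ?cImD ?h1 ?h2.
Qed.

(** The constant z is harmless because the derivative of a test function has mean
zero. *)
Lemma primitive_weak_derivative f g : primitive_of f g -> is_weak_derivative f g.
Proof.
move=> fg e phi tphi; have [z fz] := fg e.
have [ip idp] := test_fun_itg tphi.
have [f1 f2] := citg_rep f e; have [g1 g2] := citg_rep g e.
have key (a b : R -> R) c : itg (len e) a -> itg (len e) b ->
    ae_eq mu `]0, len e[%classic a (fun x => c + prim b x) ->
    \int[mu]_(x in `]0, len e[) (a x * derive1 phi x) =
    - (\int[mu]_(x in `]0, len e[) (b x * phi x)).
  move=> ia ib ab; have le0 := ltW (len_gt0 e).
  have ipb := itg_mul_prim le0 idp ib.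
  have ipb' : itg (len e) (fun x => prim b x * derive1 phi x).
    by under eq_fun do rewrite mulrC.
  have h0 : \int[mu]_(x in `]0, len e[) (c * derive1 phi x) = 0.
    rewrite intZl // -/(prim (derive1 phi) (len e)) (test_fun_prim tphi) //.
    by rewrite (test_fun_end tphi) mulr0.
  have := intD (itgZl c idp) ipb'.
  rewrite h0 add0r (prim_weak_derivative (len_gt0 e) ib tphi) => <-.
  apply: Rintegral_ae.
  - apply: measurable_funM; exact: measurable_int_itg.
  - apply: measurable_int_itg; apply: itgD => //; exact: itgZl.
  - by apply: ae_sub ab => x _ ->; rewrite mulrDl.
rewrite !Cint_mul_real.
rewrite (key _ (fun x => Re (L2rep g e x)) (Re z)) //; last first.
  by apply: ae_sub fz => x _ ->; rewrite cReD.
rewrite (key _ (fun x => Im (L2rep g e x)) (Im z)) //.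
by apply: ae_sub fz => x _ ->; rewrite cImD.
Qed.
End L2Representatives.

(** * Traces of Sobolev functions *)

Section Traces.
Local Open Scope complex_scope.
Context {R : realType} {G : metric_graph R}.
Local Notation mu := (@lebesgue_measure R).
Local Notation C := R[i].
Local Notation Re := complex.Re.
Local Notation Im := complex.Im.
Implicit Types (e : edge G) (b : bool) (f g h : L2 G) (z : C).

Lemma len_ge0 e : 0 <= len e. Proof. exact/ltW/len_gt0. Qed.

Lemma prim_shift_continuous l c (u : R -> R) : 0 <= l -> itg l u ->
  {within `[0, l], continuous (fun x => c + prim u x)}.
Proof.
move=> l0 iu x; apply: (@cvgD _ R^o); first exact: cvg_cst.
exact: prim_continuous.
Qed.

Lemma primitive_ae_inj l c d (u w : R -> R) : 0 < l -> itg l u -> itg l w ->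
  ae_eq mu `]0, l[%classic (fun x => c + prim u x) (fun x => d + prim w x) ->
  c = d /\ ae_eq mu `]0, l[%classic u w.
Proof.
move=> l0 iu iw uw.
have E x : 0 <= x <= l -> c + prim u x = d + prim w x.
  by apply: continuous_ae_eq uw x => //; apply: prim_shift_continuous => //; exact: ltW.
have cd : c = d by have := E 0; rewrite !prim0 // !addr0 lexx ltW //; exact.
split => //; have [] := @prim_affine_ae _ l (fun x => u x - w x) 0 0 (itgB iu iw).
  move=> x /andP[x0 xl]; rewrite /prim intB; [|exact: itgS (ltW xl) iu|exact: itgS (ltW xl) iw].
  have := E x; rewrite cd (ltW x0) (ltW xl) => /(_ isT)/addrI.
  by rewrite /prim => ->; rewrite subrr mul0r addr0.
move=> N [mN N0 uN]; exists N; split => // x /= nh; apply: uN => /= h; apply: nh => xl.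
by have /eqP := h xl; rewrite subr_eq0 => /eqP.
Qed.

(** Both sides are continuous, so they agree everywhere: comparing at 0 gives the
constants, and differentiating the primitives gives the integrands. *)
Lemma cprimitive_ae_inj e z z' (u w : R -> C) : citg (len e) u -> citg (len e) w ->
  aeq e (fun x => z + Cintegral x u) (fun x => z' + Cintegral x w) -> z = z' /\ aeq e u w.
Proof.
move=> [u1 u2] [w1 w2] uw.
have [h1 k1] : Re z = Re z' /\ ae_eq mu `]0, len e[%classic (fun x => Re (u x)) (fun x => Re (w x)).
  apply: primitive_ae_inj => //; first exact: len_gt0.
  by apply: ae_sub uw => x _ /(congr1 (@complex.Re R)); rewrite !cReD.
have [h2 k2] : Im z = Im z' /\ ae_eq mu `]0, len e[%classic (fun x => Im (u x)) (fun x => Im (w x)).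
  apply: primitive_ae_inj => //; first exact: len_gt0.
  by apply: ae_sub uw => x _ /(congr1 (@complex.Im R)); rewrite !cImD.
by split; [exact: complexP|apply: ae_sub2 k1 k2 => x _; exact: complexP].
Qed.

Lemma weak_derivative_uniq f g h : is_weak_derivative f g -> is_weak_derivative f h -> g = h.
Proof.
move=> fg fh; apply: L2_ext => e.
have [z1 h1] := weak_derivative_primitive fg e.
have [z2 h2] := weak_derivative_primitive fh e.
have [] // := @cprimitive_ae_inj e z1 z2 (L2rep g e) (L2rep h e) (citg_rep g e) (citg_rep h e).
exact: aeq_trans (aeq_sym h1) h2.
Qed.

Lemma weak_derivativeE f g : is_weak_derivative f g -> weak_derivative f = g.
Proof. by move=> fg; apply: xget_eq => // h fh; exact: weak_derivative_uniq fh fg. Qed.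

(** The continuous representative is unique, so any primitive of f computes its
trace. *)
Lemma traceE f e b z (w : R -> C) : citg (len e) w ->
  aeq e (L2rep f e) (fun x => z + Cintegral x w) -> trace f e b = z + Cintegral (endpoint e b) w.
Proof.
move=> [w1 w2] fw.
have c1 : {within `[0, len e], continuous (fun x => Re (z + Cintegral x w))}.
  by under [X in continuous X]eq_fun do rewrite cReD; exact: prim_shift_continuous (len_ge0 e) w1.
have c2 : {within `[0, len e], continuous (fun x => Im (z + Cintegral x w))}.
  by under [X in continuous X]eq_fun do rewrite cImD; exact: prim_shift_continuous (len_ge0 e) w2.
have eb : 0 <= endpoint e b <= len e by case: b; rewrite /endpoint lexx ?len_ge0.
apply: xget_eq; first by exists (fun x => z + Cintegral x w).
move=> y [u [u1 u2 fu ->]]; apply: complexP.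
  apply: (continuous_ae_eq (len_gt0 e) u1 c1) => //.
  by apply: ae_sub2 fu fw => x _ -> ->.
apply: (continuous_ae_eq (len_gt0 e) u2 c2) => //.
by apply: ae_sub2 fu fw => x _ -> ->.
Qed.

Lemma trace_primitive f g e : is_weak_derivative f g ->
  aeq e (L2rep f e) (fun x => trace f e false + Cintegral x (L2rep g e)).
Proof.
move=> /weak_derivative_primitive/(_ e)[z fz].
by rewrite (traceE false (citg_rep g e) fz) Cint0 // addr0.
Qed.

Lemma trace_endpoint f g e b : is_weak_derivative f g ->
  trace f e b = trace f e false + Cintegral (endpoint e b) (L2rep g e).
Proof. by move=> fg; apply: (traceE b (citg_rep g e)); exact: trace_primitive. Qed.

Lemma lin_primitive z f f' g g' e : is_weak_derivative f g -> is_weak_derivative f' g' ->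
  aeq e (L2rep (z *: f + f') e)
    (fun x => (z * trace f e false + trace f' e false) + Cintegral x (L2rep (z *: g + g') e)).
Proof.
move=> fg fg'; apply: aeq_trans (L2rep_lin _ _ _ _) _.
apply: ae_sub2 (trace_primitive e fg) (trace_primitive e fg') => x /andP[x0 xl] -> ->.
have ig := citg_rep g e; have ig' := citg_rep g' e.
have ix := citgS (ltW xl) ig; have ix' := citgS (ltW xl) ig'.
have ilin : citg (len e) (fun x => z * L2rep g e x + L2rep g' e x).
  by apply: citgD => //; exact: citgZ.
rewrite (Cint_aeqx (e := e) (ltW xl) _ (citg_cmeas ilin) (L2rep_lin z g g' e));
  last exact: cmeas_rep.
rewrite CintD ?CintZ //; last exact: citgZ.
by rewrite mulrDr addrACA.
Qed.

Lemma is_weak_derivative_lin z f f' g g' : is_weak_derivative f g -> is_weak_derivative f' g' ->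
  is_weak_derivative (z *: f + f') (z *: g + g').
Proof.
move=> fg fg'; apply: primitive_weak_derivative => e.
by exists (z * trace f e false + trace f' e false); exact: lin_primitive.
Qed.

Lemma trace_lin z f f' g g' e b : is_weak_derivative f g -> is_weak_derivative f' g' ->
  trace (z *: f + f') e b = z * trace f e b + trace f' e b.
Proof.
move=> fg fg'; rewrite (traceE b (citg_rep _ e) (lin_primitive z e fg fg')).
have := trace_endpoint e b (is_weak_derivative_lin z fg fg').
rewrite (trace_endpoint e b fg) (trace_endpoint e b fg').
have eb : endpoint e b <= len e by case: b; rewrite /endpoint ?lexx ?len_ge0.
have ilin : citg (len e) (fun x => z * L2rep g e x + L2rep g' e x).
  by apply: citgD (citg_rep _ _); exact/citgZ/citg_rep.
rewrite (Cint_aeqx (e := e) eb _ (citg_cmeas ilin) (L2rep_lin z g g' e));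
  last exact: cmeas_rep.
have ig := citgS eb (citg_rep g e); have ig' := citgS eb (citg_rep g' e).
rewrite CintD ?CintZ //; last exact: citgZ.
by move=> _; rewrite mulrDr addrACA.
Qed.

Lemma sobolev1P f : sobolev 1 f <-> exists g, is_weak_derivative f g.
Proof. by split => [[g fg _]|[g fg]]; exists g. Qed.

Lemma sobolev2P f : sobolev 2 f <->
  exists g h, is_weak_derivative f g /\ is_weak_derivative g h.
Proof.
split => [[g fg [h gh _]]|[g [h [fg gh]]]]; first by exists g, h.
by exists g => //; exists h.
Qed.

Lemma sobolev2_weak_derivative f : sobolev 2 f ->
  is_weak_derivative f (weak_derivative f) /\
  is_weak_derivative (weak_derivative f) (weak_derivative (weak_derivative f)).
Proof.
move=> /sobolev2P[g [h [fg gh]]].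
by rewrite (weak_derivativeE fg) (weak_derivativeE gh).
Qed.

(** An edgewise H^2 function is determined by its second derivative w and by its
value z0 and slope z1 at the initial endpoint of each edge; all such data occur. *)
Lemma sobolev2_build (z0 z1 : edge G -> C) (w : edge G -> R -> C) :
  (forall e, square_integrable (len e) (w e)) ->
  exists f g h, [/\ is_weak_derivative f g, is_weak_derivative g h,
    forall e, aeq e (L2rep h e) (w e),
    forall e, aeq e (L2rep f e)
      (fun x => z0 e + Cintegral x (fun t => z1 e + Cintegral t (w e))) &
    forall e b,
      trace f e b = z0 e + Cintegral (endpoint e b) (fun t => z1 e + Cintegral t (w e)) /\
      trace g e b = z1 e + Cintegral (endpoint e b) (w e)].
Proof.
move=> sw; have iw e : citg (len e) (w e) by exact/citg_square/sw.
have sg e : square_integrable (len e) (fun t => z1 e + Cintegral t (w e)).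
  exact: square_integrable_prim (len_ge0 e) (iw e).
have ig e := citg_square (sg e).
have sf e : square_integrable (len e)
    (fun x => z0 e + Cintegral x (fun t => z1 e + Cintegral t (w e))).
  exact: square_integrable_prim (len_ge0 e) (ig e).
have [f fE] := L2_build sf; have [g gE] := L2_build sg; have [h hE] := L2_build sw.
exists f, g, h; split => //.
- apply: primitive_weak_derivative => e; exists (z0 e).
  apply: aeq_trans (fE e) _; apply: aeq_fun => x /andP[x0 xl]; congr (_ + _); apply/esym.
  apply: Cint_aeqx (gE e); [exact: ltW|exact: cmeas_rep|exact: citg_cmeas].
- apply: primitive_weak_derivative => e; exists (z1 e).
  apply: aeq_trans (gE e) _; apply: aeq_fun => x /andP[x0 xl]; congr (_ + _); apply/esym.
  apply: Cint_aeqx (hE e); [exact: ltW|exact: cmeas_rep|exact: citg_cmeas].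
- by move=> e b; split; apply: traceE.
Qed.

(** * Complex conjugation on L2 *)

Lemma conjL2_subproof f : exists g, forall e, aeq e (L2rep g e) (fun x => conjc (L2rep f e x)).
Proof. by apply: L2_build => e; exact/square_integrable_conj/L2rep_square. Qed.

Definition conjL2 f : L2 G := projT1 (cid (conjL2_subproof f)).

Lemma conjL2P f e : aeq e (L2rep (conjL2 f) e) (fun x => conjc (L2rep f e x)).
Proof. by rewrite /conjL2; case: cid. Qed.

Lemma conjL2K : involutive conjL2.
Proof.
move=> f; apply: L2_ext => e; apply: aeq_trans (conjL2P _ _) _.
by apply: ae_sub (conjL2P f e) => x _ ->; rewrite conjcK.
Qed.

Lemma conjL2_lin z f g : conjL2 (z *: f + g) = conjc z *: conjL2 f + conjL2 g.
Proof.
apply: L2_ext => e; apply: aeq_trans (conjL2P _ _) _.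
apply: aeq_trans (aeq_sym (L2rep_lin _ _ _ _)).
apply: ae_sub3 (L2rep_lin z f g e) (conjL2P f e) (conjL2P g e) => x _ -> -> ->.
by rewrite cJD cJM.
Qed.

Lemma conjL2_primitive f g e : is_weak_derivative f g ->
  aeq e (L2rep (conjL2 f) e) (fun x => conjc (trace f e false) + Cintegral x (L2rep (conjL2 g) e)).
Proof.
move=> fg; apply: aeq_trans (conjL2P _ _) _.
apply: ae_sub (trace_primitive e fg) => x /andP[x0 xl] ->; rewrite rmorphD; congr (_ + _).
rewrite (Cint_aeqx (e := e) (ltW xl) _ _ (conjL2P g e));
  [|exact: cmeas_rep|exact/cmeas_conj/cmeas_rep].
by rewrite Cint_conj //; exact: citgS (ltW xl) (citg_rep _ _).
Qed.

Lemma conjL2_weak_derivative f g : is_weak_derivative f g ->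
  is_weak_derivative (conjL2 f) (conjL2 g).
Proof.
move=> fg; apply: primitive_weak_derivative => e; exists (conjc (trace f e false)).
exact: conjL2_primitive.
Qed.

Lemma conjL2_trace f g e b : is_weak_derivative f g ->
  trace (conjL2 f) e b = conjc (trace f e b).
Proof.
move=> fg; rewrite (traceE b (citg_rep _ _) (conjL2_primitive e fg)).
have eb : endpoint e b <= len e by case: b; rewrite /endpoint ?lexx ?len_ge0.
rewrite (trace_endpoint e b fg) rmorphD; congr (_ + _).
rewrite (Cint_aeqx (e := e) eb _ _ (conjL2P g e));
  [|exact: cmeas_rep|exact/cmeas_conj/cmeas_rep].
by rewrite Cint_conj //; exact: citgS eb (citg_rep _ _).
Qed.
End Traces.

(** * Vertex values and normal derivatives *)

Section Vertices.
Local Open Scope complex_scope.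
Context {R : realType} {G : metric_graph R}.
Local Notation C := R[i].
Implicit Types (e : edge G) (b : bool) (f g h : L2 G) (z : C).

(** A path from v to an endpoint of some edge is either empty, or starts with an
edge at v. *)
Lemma vertex_incident (v : 'I_(nvert G)) : graph_connected G -> exists e b, vtx e b = v.
Proof.
move=> Gc; have /card_gt0P[e0 _] : (0 < #|edge G|)%N := edge_gt0 G.
have /connectP[[|w s] /=] := Gc v (vtx e0 false).
  by move=> _ E; exists e0, false.
by case/andP => /existsP[e /existsP[b /andP[/eqP E _]]] _ _; exists e, b.
Qed.

Lemma sobolev2_lin z f g : sobolev 2 f -> sobolev 2 g -> sobolev 2 (z *: f + g).
Proof.
move=> /sobolev2P[f1 [f2 [d1 d2]]] /sobolev2P[g1 [g2 [d3 d4]]]; apply/sobolev2P.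
by exists (z *: f1 + g1), (z *: f2 + g2); split; exact: is_weak_derivative_lin.
Qed.

Lemma weak_derivative_lin z f g f1 g1 : is_weak_derivative f f1 -> is_weak_derivative g g1 ->
  weak_derivative (z *: f + g) = z *: weak_derivative f + weak_derivative g.
Proof.
move=> d1 d2; rewrite (weak_derivativeE d1) (weak_derivativeE d2).
exact/weak_derivativeE/is_weak_derivative_lin.
Qed.

Lemma H1_lin z f g : H1 f -> H1 g -> H1 (z *: f + g).
Proof.
move=> [/sobolev1P[f1 d1] cf] [/sobolev1P[g1 d2] cg]; split.
  by apply/sobolev1P; exists (z *: f1 + g1); exact: is_weak_derivative_lin.
by move=> e b e' b' E; rewrite !(trace_lin _ _ _ d1 d2) (cf _ _ _ _ E) (cg _ _ _ _ E).
Qed.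

Lemma vertex_valueE f e b : H1 f -> vertex_value f (vtx e b) = trace f e b.
Proof.
move=> [_ cf]; apply: xget_eq; first by exists e, b.
by move=> w [e' [b' [E ->]]]; exact: cf.
Qed.

Lemma vertex_value_lin z f g v : graph_connected G -> H1 f -> H1 g ->
  vertex_value (z *: f + g) v = z * vertex_value f v + vertex_value g v.
Proof.
move=> Gc Hf Hg; have [e [b <-]] := vertex_incident v Gc.
rewrite !vertex_valueE //; last exact: H1_lin.
have [/sobolev1P[f1 d1] _] := Hf; have [/sobolev1P[g1 d2] _] := Hg.
exact: trace_lin d1 d2.
Qed.

Lemma normal_derivative_lin z f g v : sobolev 2 f -> sobolev 2 g ->
  normal_derivative (z *: f + g) v = z * normal_derivative f v + normal_derivative g v.
Proof.
move=> /sobolev2_weak_derivative[d1 d2] /sobolev2_weak_derivative[d3 d4].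
rewrite /normal_derivative (weak_derivative_lin z d1 d3) big_distrr -big_split /=.
apply: eq_bigr => -[e b] _ /=; rewrite (trace_lin _ _ _ d2 d4).
by case: b => //; rewrite mulrN opprD.
Qed.

(** Each edge endpoint is located at exactly one vertex. *)
Lemma sum_vertices (a : edge G * bool -> C) (c : 'I_(nvert G) -> C) :
  \sum_v (\sum_(p | vtx p.1 p.2 == v) a p) * c v =
  \sum_e (a (e, true) * c (vtx e true) + a (e, false) * c (vtx e false)).
Proof.
transitivity (\sum_(p : edge G * bool) a p * c (vtx p.1 p.2)).
  rewrite (partition_big (fun p : edge G * bool => vtx p.1 p.2) xpredT) //=.
  by apply: eq_bigr => v _; rewrite mulr_suml; apply: eq_bigr => p /eqP ->.
transitivity (\sum_e \sum_b a (e, b) * c (vtx e b)).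
  by rewrite pair_bigA; apply: eq_bigr => -[].
by apply: eq_bigr => e _; rewrite big_bool.
Qed.
End Vertices.

(** * The inner product of L2 *)

Section InnerProduct.
Local Open Scope complex_scope.
Context {R : realType} {G : metric_graph R}.
Local Notation mu := (@lebesgue_measure R).
Local Notation C := R[i].
Local Notation Re := complex.Re.
Local Notation Im := complex.Im.
Implicit Types (e : edge G) (b : bool) (f g h : L2 G) (z : C).

Lemma citg_inner f g e : citg (len e) (fun x => L2rep f e x * conjc (L2rep g e x)).
Proof. apply: citgM; [exact: L2rep_square|exact/square_integrable_conj/L2rep_square]. Qed.

Lemma L2inner_linl z f g h : L2inner (z *: f + g) h = z * L2inner f h + L2inner g h.
Proof.
rewrite /L2inner big_distrr -big_split; apply: eq_bigr => e _ /=.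
have i1 := citg_inner f h e; have i2 := citg_inner g h e.
rewrite -CintZ // -CintD //; last exact: citgZ.
apply: Cint_aeq.
- exact/citg_cmeas/citg_inner.
- by apply/citg_cmeas/citgD => //; exact: citgZ.
- by apply: ae_sub (L2rep_lin z f g e) => x _ ->; rewrite mulrDl mulrA.
Qed.

Lemma L2innerC f g : L2inner f g = conjc (L2inner g f).
Proof.
rewrite /L2inner cJ_sum; apply: eq_bigr => e _.
rewrite -[RHS](Cint_conj (citg_inner g f e)).
by apply: eq_Cint => x _; rewrite cJM conjcK mulrC.
Qed.

Lemma L2inner0l h : L2inner 0 h = 0.
Proof.
have := L2inner_linl 1 0 0 h; rewrite scale1r addr0 mul1r => /eqP.
by rewrite -subr_eq0 opprD addNKr oppr_eq0 => /eqP.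
Qed.

Lemma L2innerDl f g h : L2inner (f + g) h = L2inner f h + L2inner g h.
Proof. by rewrite -[f in LHS]scale1r L2inner_linl mul1r. Qed.

Lemma L2innerZl z f h : L2inner (z *: f) h = z * L2inner f h.
Proof. by rewrite -[z *: f]addr0 L2inner_linl L2inner0l addr0. Qed.

Lemma mulcJ z : z * conjc z = (normsq z)%:C.
Proof. by case: z => a b; apply: complexP; rewrite ?cReM ?cImM /normsq /=; ring. Qed.

Lemma int_eq0_ae l (r : R -> R) : itg l r -> (forall x, 0 < x < l -> 0 <= r x) ->
  \int[mu]_(x in `]0, l[) r x = 0 -> ae_eq mu `]0, l[%classic r (cst 0).
Proof.
move=> ir r0 h0.
have : (\int[mu]_(x in `]0%R, l[) `|(r x)%:E|)%E = 0%E.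
  have E : (\int[mu]_(x in `]0%R, l[) (r x)%:E)%E = 0%E.
    by rewrite -[LHS]fineK ?integrable_fin_num // -/(Rintegral _ _ _) h0.
  rewrite -[RHS]E; apply: eq_integral => x; rewrite inE /= in_itv /= => xl.
  by rewrite ger0_norm // r0.
move/ae_eq_integral_abs => H; have {}H := H (measurable_itv _) (measurable_int _ ir).
by apply: ae_sub H => x _ [].
Qed.

Lemma itg_normsq f e : itg (len e) (fun x => normsq (L2rep f e x)).
Proof. by have [] := L2rep_square f e. Qed.

Lemma Cint_mulJ l (u : R -> C) :
  Cintegral l (fun x => u x * conjc (u x)) = (\int[mu]_(x in `]0, l[) normsq (u x))%:C.
Proof.
apply: complexP; rewrite /Cintegral /=; first by apply: eq_Rintegral => x _; rewrite mulcJ.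
transitivity (\int[mu]_(x in `]0, l[) (0 : R)); last by rewrite Rintegral_cst // mul0r.
by apply: eq_Rintegral => x _; rewrite mulcJ.
Qed.

Lemma L2_norm0 f : (forall e, \int[mu]_(x in `]0, len e[) normsq (L2rep f e x) = 0) -> f = 0.
Proof.
move=> f0; apply: L2_ext => e; apply: aeq_trans (aeq_sym (L2rep0 e)).
have := int_eq0_ae (itg_normsq f e) (fun x _ => normsq_ge0 _) (f0 e).
apply: ae_sub => x _ /eqP; rewrite /normsq paddr_eq0 ?sqr_ge0 // !sqrf_eq0.
by move=> /andP[/eqP h1 /eqP h2]; apply: complexP; rewrite ?h1 ?h2.
Qed.

Lemma L2inner_eq0 f : L2inner f f = 0 -> f = 0.
Proof.
rewrite /L2inner; under eq_bigr do rewrite Cint_mulJ.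
rewrite -rmorph_sum /= => /(congr1 (@complex.Re R)) /= /eqP.
rewrite psumr_eq0 => [/allP h|e _]; last by apply: Rintegral_ge0 => x _; exact: normsq_ge0.
by apply: L2_norm0 => e; apply/eqP; apply: h; exact: mem_index_enum.
Qed.
End InnerProduct.

(** * Green's identity *)

Section EdgeGreen.
Local Open Scope complex_scope.
Context {R : realType} {G : metric_graph R}.
Local Notation C := R[i].
Implicit Types (e : edge G) (f g h : L2 G) (z : C).

(** Integration by parts, after f2 and the conjugate of g1 have been recognised as the
integrands of the primitives f1 and conj g. *)
Lemma edge_green f1 f2 g g1 e : is_weak_derivative f1 f2 -> is_weak_derivative g g1 ->
  Cintegral (len e) (fun x => L2rep f2 e x * conjc (L2rep g e x)) =
  trace f1 e true * conjc (trace g e true) - trace f1 e false * conjc (trace g e false)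
  - Cintegral (len e) (fun x => L2rep f1 e x * conjc (L2rep g1 e x)).
Proof.
move=> d1 d2; have l0 := len_ge0 e.
set u := L2rep f2 e; pose w x := conjc (L2rep g1 e x).
have iu : citg (len e) u by exact: citg_rep.
have iw : citg (len e) w by exact/citg_conj/citg_rep.
have gE : aeq e (fun x => conjc (L2rep g e x)) (fun x => conjc (trace g e false) + Cintegral x w).
  apply: ae_sub (trace_primitive e d2) => x /andP[_ xl] ->; rewrite cJD; congr (_ + _).
  by rewrite -Cint_conj //; exact: citgS (ltW xl) (citg_rep _ _).
have f1E := trace_primitive e d1.
have tf1 := trace_endpoint e true d1; have tg := trace_endpoint e true d2.
have tgc : conjc (trace g e true) = conjc (trace g e false) + Cintegral (len e) w.
  by rewrite tg cJD -Cint_conj //; exact: citg_rep.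
have iuw := citg_mul_prim l0 iu iw; have iwu := citg_mul_prim l0 iw iu.
have L : Cintegral (len e) (fun x => u x * conjc (L2rep g e x)) =
    Cintegral (len e) u * conjc (trace g e false) +
    Cintegral (len e) (fun x => u x * Cintegral x w).
  rewrite mulrC -(CintZ _ iu) -(CintD (citgZ _ iu) iuw).
  apply: Cint_aeq.
  - exact/citg_cmeas/citg_inner.
  - by apply/citg_cmeas/citgD => //; exact: citgZ.
  - by apply: ae_sub gE => x _ ->; rewrite mulrDr (mulrC (u x)).
have M : Cintegral (len e) (fun x => L2rep f1 e x * conjc (L2rep g1 e x)) =
    trace f1 e false * Cintegral (len e) w + Cintegral (len e) (fun x => w x * Cintegral x u).
  rewrite -(CintZ _ iw) -(CintD (citgZ _ iw) iwu).
  apply: Cint_aeq.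
  - exact/citg_cmeas/citg_inner.
  - by apply/citg_cmeas/citgD => //; exact: citgZ.
  - by apply: ae_sub f1E => x _ ->; rewrite mulrDl (mulrC (w x)).
rewrite L M Cint_by_parts // tf1 tgc /=.
set a := Cintegral _ u; set b := Cintegral _ w; set c := Cintegral _ _.
move: (trace f1 e false) (conjc (trace g e false)) => s t; ring.
Qed.
End EdgeGreen.

Section Schroedinger.
Local Open Scope complex_scope.
Context {R : realType} {G : metric_graph R}.
Local Notation mu := (@lebesgue_measure R).
Local Notation C := R[i].
Local Notation Re := complex.Re.
Local Notation Im := complex.Im.
Implicit Types (e : edge G) (b : bool) (f g h : L2 G) (z lam : C).

(* p is a Borel version of q with values in [0, B]. *)
Variables (q p : edge G -> R -> R) (B : R).
Hypothesis Gc : graph_connected G.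
Hypothesis mp : forall e, measurable_fun setT (p e).
Hypothesis pB : forall e x, 0 <= p e x <= B.
Hypothesis qp : forall e, ae_eq mu `]0, len e[%classic (q e) (p e).

Lemma potential_mul_square f e :
  square_integrable (len e) (fun x => (p e x)%:C * L2rep f e x).
Proof.
have [r1 r2] := cmeas_rep f e.
have mpe : measurable_fun `]0, len e[ (p e) by exact: measurable_funS (mp e).
have mpf : cmeas (len e) (fun x => (p e x)%:C * L2rep f e x).
  by apply: cmeasM => //; split => //; exact: measurable_cst.
split; [exact: mpf.1|exact: mpf.2|].
apply: (le_itg (w := fun x => B ^+ 2 * normsq (L2rep f e x))).
- exact: measurable_normsq mpf.1 mpf.2.
- move=> x _; rewrite ger0_norm ?normsq_ge0 // normsqM ler_wpM2r ?normsq_ge0 //.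
  have /andP[h1 h2] := pB e x.
  by rewrite /normsq /= expr0n addr0 lerXn2r ?nnegrE // (le_trans h1).
- exact/itgZl/itg_normsq.
Qed.

(** The function p supplies the Borel representative whose existence makes the
choice in [potential_mul] meaningful. *)
Lemma potential_mulE f e :
  aeq e (L2rep (potential_mul q f) e) (fun x => (p e x)%:C * L2rep f e x).
Proof.
have [g gE] := L2_build (potential_mul_square f).
have ex : exists g, forall e, ae_eq mu `]0, len e[%classic (L2rep g e)
    (fun x => (q e x)%:C * L2rep f e x).
  by exists g => e'; apply: ae_sub2 (gE e') (qp e') => x _ -> ->.
have := xgetPex 0 ex => /(_ e); rewrite -/(potential_mul q f) => H.
by apply: ae_sub2 H (qp e) => x _ -> ->.
Qed.

Lemma potential_mul_lin z f g :
  potential_mul q (z *: f + g) = z *: potential_mul q f + potential_mul q g.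
Proof.
apply: L2_ext => e; apply: aeq_trans (potential_mulE _ _) _.
apply: aeq_trans _ (aeq_sym (L2rep_lin _ _ _ _)).
apply: ae_sub3 (L2rep_lin z f g e) (potential_mulE f e) (potential_mulE g e) => x _ -> -> ->.
by rewrite mulrDr mulrCA.
Qed.

Lemma potential_mul_conj f : potential_mul q (conjL2 f) = conjL2 (potential_mul q f).
Proof.
apply: L2_ext => e; apply: aeq_trans (potential_mulE _ _) _.
apply: aeq_trans _ (aeq_sym (conjL2P _ _)).
apply: ae_sub2 (conjL2P f e) (potential_mulE f e) => x _ -> ->.
by rewrite cJM; congr (_ * _); apply: complexP; rewrite /= ?oppr0.
Qed.

Notation T := (schroedinger q).
Notation domT := (dom (op_Sstar q)).

Lemma domT_lin z f g : domT f -> domT g -> domT (z *: f + g).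
Proof. by move=> [s1 h1] [s2 h2]; split; [exact: sobolev2_lin|exact: H1_lin]. Qed.

Lemma T_lin z f g : domT f -> domT g -> T (z *: f + g) = z *: T f + T g.
Proof.
move=> [/sobolev2_weak_derivative[d1 d2] _] [/sobolev2_weak_derivative[d3 d4] _].
rewrite /schroedinger (weak_derivative_lin z d1 d3) (weak_derivative_lin z d2 d4).
by rewrite potential_mul_lin scalerDr scalerN opprD addrACA.
Qed.

Lemma domT0 : domT 0.
Proof.
have d0 : is_weak_derivative (0 : L2 G) 0.
  apply: primitive_weak_derivative => e; exists 0.
  apply: aeq_trans (L2rep0 e) _; apply: aeq_fun => x /andP[x0 xl]; rewrite add0r.
  rewrite (Cint_aeqx (e := e) (w := fun=> 0) (ltW xl)); [| | |exact: L2rep0].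
  - by rewrite Cint_cst ?mulr0 // ltW.
  - exact: cmeas_rep.
  - exact/citg_cmeas/citg_cst.
have t0 e b : trace (0 : L2 G) e b = 0.
  have := trace_lin (-1) e b d0 d0; rewrite scaler0 addr0 mulN1r => h.
  by rewrite h addNr.
split; first by apply/sobolev2P; exists 0, 0.
by split; [apply/sobolev1P; exists 0|move=> *; rewrite !t0].
Qed.

Lemma Gamma1E f v : Gamma1 f v 0 = - normal_derivative f v.
Proof. by rewrite mxE. Qed.

Lemma Gamma0E f v : Gamma0 f v 0 = vertex_value f v.
Proof. by rewrite mxE. Qed.

Lemma colZD z (a b : 'cV[C]_(nvert G)) v : (z *: a + b) v 0 = z * a v 0 + b v 0.
Proof. by rewrite !mxE. Qed.

Lemma Gamma0_lin z f g : domT f -> domT g ->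
  Gamma0 (z *: f + g) = z *: Gamma0 f + Gamma0 g.
Proof.
move=> [_ h1] [_ h2]; apply/colP => v.
by rewrite colZD !Gamma0E (vertex_value_lin z v Gc h1 h2).
Qed.

Lemma Gamma1_lin z f g : domT f -> domT g ->
  Gamma1 (z *: f + g) = z *: Gamma1 f + Gamma1 g.
Proof.
have aux (A a b : 'cV[C]_(nvert G)) v (n n1 n2 : C) : A v 0 = - n -> a v 0 = - n1 ->
    b v 0 = - n2 -> n = z * n1 + n2 -> A v 0 = (z *: a + b) v 0.
  by rewrite colZD => -> -> -> ->; rewrite mulrN opprD.
move=> [h1 _] [h2 _]; apply/colP => v.
exact: (aux _ _ _ _ _ _ _ (Gamma1E _ v) (Gamma1E _ v) (Gamma1E _ v)
  (normal_derivative_lin z v h1 h2)).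
Qed.

Lemma domT_conj f : domT f -> domT (conjL2 f).
Proof.
move=> [/sobolev2P[f1 [f2 [d1 d2]]] [_ cf]]; split.
  by apply/sobolev2P; exists (conjL2 f1), (conjL2 f2); split; exact: conjL2_weak_derivative.
split; first by apply/sobolev1P; exists (conjL2 f1); exact: conjL2_weak_derivative.
by move=> e b e' b' E; rewrite !(conjL2_trace _ _ d1) (cf _ _ _ _ E).
Qed.

Lemma conjL2_ND f g : conjL2 (- f + g) = - conjL2 f + conjL2 g.
Proof.
have J1 : conjc (-1) = -1 :> C by apply: complexP; rewrite /= ?oppr0.
by have := conjL2_lin (-1) f g; rewrite J1 !scaleN1r.
Qed.

Lemma T_conj f : domT f -> T (conjL2 f) = conjL2 (T f).
Proof.
move=> [/sobolev2_weak_derivative[d1 d2] _].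
rewrite /schroedinger potential_mul_conj.
rewrite (weak_derivativeE (conjL2_weak_derivative d1)).
rewrite (weak_derivativeE (conjL2_weak_derivative d2)).
by rewrite conjL2_ND.
Qed.

Lemma Gamma0_conj f : domT f -> Gamma0 (conjL2 f) = map_mx conjc (Gamma0 f).
Proof.
move=> df; apply/colP => v; rewrite [RHS]mxE !Gamma0E; have [e [b <-]] := vertex_incident v Gc.
have [_ h1] := domT_conj df; have [/sobolev2P[f1 [f2 [d1 _]]] h2] := df.
by rewrite !vertex_valueE // (conjL2_trace _ _ d1).
Qed.

Definition energy f g : C := L2inner (weak_derivative f) (weak_derivative g) +
  \sum_e Cintegral (len e) (fun x => (p e x)%:C * L2rep f e x * conjc (L2rep g e x)).

Lemma citg_potential f g e :
  citg (len e) (fun x => (p e x)%:C * L2rep f e x * conjc (L2rep g e x)).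
Proof.
by apply: citgM; [exact: potential_mul_square|exact/square_integrable_conj/L2rep_square].
Qed.

Lemma energyC f g : energy f g = conjc (energy g f).
Proof.
rewrite /energy cJD L2innerC cJ_sum; congr (_ + _); apply: eq_bigr => e _.
rewrite -Cint_conj; last exact: citg_potential.
apply: eq_Cint => x _; rewrite !cJM conjcK.
rewrite (_ : conjc (p e x)%:C = (p e x)%:C); last by apply: complexP; rewrite /= ?oppr0.
by rewrite -!mulrA; congr (_ * _); rewrite mulrC.
Qed.

Lemma green_first f g : domT f -> domT g ->
  L2inner (T f) g = energy f g + cinner (Gamma1 f) (Gamma0 g).
Proof.
move=> [/sobolev2_weak_derivative[d1 d2] _] [/sobolev2_weak_derivative[d3 d4] hg].
set f1 := weak_derivative f in d1 d2 *; set f2 := weak_derivative f1 in d2 *.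
set g1 := weak_derivative g in d3 d4 *.
rewrite /schroedinger -/f1 -/f2 L2innerDl -scaleN1r L2innerZl mulN1r.
have -> : L2inner (potential_mul q f) g =
    \sum_e Cintegral (len e) (fun x => (p e x)%:C * L2rep f e x * conjc (L2rep g e x)).
  apply: eq_bigr => e _; apply: Cint_aeq.
  - exact/citg_cmeas/citg_inner.
  - exact/citg_cmeas/citg_potential.
  - by apply: ae_sub (potential_mulE f e) => x _ ->.
rewrite /energy -/f1 -/g1 [RHS]addrAC; congr (_ + _).
have -> : cinner (Gamma1 f) (Gamma0 g) = - (\sum_e (trace f1 e true * conjc (trace g e true)
    - trace f1 e false * conjc (trace g e false))).
  rewrite /cinner; under eq_bigr do rewrite Gamma1E Gamma0E mulNr.
  rewrite sumrN; congr (- _); rewrite sum_vertices /= -/f1.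
  by apply: eq_bigr => e _; rewrite !vertex_valueE // mulNr.
rewrite /L2inner -!sumrN -big_split /=; apply: eq_bigr => e _.
by rewrite (edge_green e d2 d3); rewrite opprB.
Qed.

(** Subtract the first Green identities for (f, g) and (g, f); the energy is
Hermitian. *)
Lemma green f g : domT f -> domT g ->
  L2inner (T f) g - L2inner f (T g) =
  cinner (Gamma1 f) (Gamma0 g) - cinner (Gamma0 f) (Gamma1 g).
Proof.
move=> df dg; rewrite (L2innerC f) !green_first // cJD -energyC opprD addrACA subrr add0r.
congr (_ - _); rewrite /cinner cJ_sum; apply: eq_bigr => v _.
by rewrite cJM conjcK mulrC.
Qed.

(** The energy is a sum of integrals of nonnegative functions, as p >= 0. *)
Lemma energy_eq0 f : energy f f = 0 -> weak_derivative f = 0 /\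
  forall e, ae_eq mu `]0, len e[%classic (fun x => p e x * normsq (L2rep f e x)) (cst 0).
Proof.
have E e : Cintegral (len e) (fun x => (p e x)%:C * L2rep f e x * conjc (L2rep f e x)) =
    (\int[mu]_(x in `]0, len e[) (p e x * normsq (L2rep f e x)))%:C.
  under [LHS]eq_Cint do rewrite -mulrA mulcJ mulrC.
  rewrite Cint_mul_real; apply: complexP; rewrite /=.
    by apply: eq_Rintegral => x _; rewrite mulrC.
  transitivity (\int[mu]_(x in `]0, len e[) (0 : R)); last by rewrite Rintegral_cst // mul0r.
  by apply: eq_Rintegral => x _; rewrite mul0r.
have ipn e : itg (len e) (fun x => p e x * normsq (L2rep f e x)).
  have [i1 _] := citg_potential f f e.
  move: i1; congr itg; apply/funext => x.
  by rewrite -mulrA mulcJ cReM /= mulr0 subr0.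
have pn0 e x : 0 <= p e x * normsq (L2rep f e x).
  by rewrite mulr_ge0 ?normsq_ge0 //; case/andP: (pB e x).
rewrite /energy {1}/L2inner; under eq_bigr do rewrite Cint_mulJ.
under [X in _ + X = _ -> _]eq_bigr do rewrite E.
rewrite -!rmorph_sum -rmorphD /= => /(congr1 (@complex.Re R)) /= /eqP.
have I0 (r : edge G -> R -> R) e : (forall x, 0 <= r e x) -> 0 <= \int[mu]_(x in `]0, len e[) r e x.
  by move=> r0; apply: Rintegral_ge0.
rewrite paddr_eq0; [|by apply: sumr_ge0 => e _; apply: Rintegral_ge0 => x _; exact: normsq_ge0
  |by apply: sumr_ge0 => e _; apply: Rintegral_ge0].
move=> /andP[]; rewrite !psumr_eq0; last 2 first.
- by move=> e _; apply: Rintegral_ge0.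
- by move=> e _; apply: Rintegral_ge0 => x _; exact: normsq_ge0.
move=> /allP h1 /allP h2; split.
  by apply: L2_norm0 => e; apply/eqP/h1/mem_index_enum.
by move=> e; apply: int_eq0_ae => //; apply/eqP/h2/mem_index_enum.
Qed.
End Schroedinger.

(** * Finite-dimensional linear algebra *)

Section LinearAlgebra.
Context {F : fieldType}.

Lemma injective_unitmx n (A : 'M[F]_n) : (forall u : 'cV_n, A *m u = 0 -> u = 0) -> A \in unitmx.
Proof.
move=> inj; rewrite -unitmx_tr -row_free_unit -kermx_eq0; apply/eqP/row_matrixP => i.
rewrite row0; apply: trmx_inj; rewrite trmx0; apply: inj; apply: trmx_inj.
by rewrite trmx_mul trmxK trmx0 -row_mul mulmx_ker row0.
Qed.

Lemma linear_combination (U W : lmodType F) (f : U -> W) :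
  (forall z u v, f (z *: u + v) = z *: f u + f v) ->
  forall (I : finType) (c : I -> F) (u : I -> U),
    f (\sum_i c i *: u i) = \sum_i c i *: f (u i).
Proof.
move=> fl I c u.
have f0 : f 0 = 0.
  have := fl (-1) 0 0; rewrite scaler0 addr0 scaleN1r => h.
  by rewrite h addNr.
elim: (index_enum I) => [|i s ih]; first by rewrite !big_nil.
by rewrite !big_cons fl ih.
Qed.

Lemma linear_matrix n (f : 'cV[F]_n -> 'cV[F]_n) :
  (forall z u v, f (z *: u + v) = z *: f u + f v) -> exists A : 'M[F]_n, forall u, A *m u = f u.
Proof.
move=> fl; exists (\matrix_(i, j) f (delta_mx j 0) i 0) => u.
have uE : u = \sum_j u j 0 *: delta_mx j 0.
  by rewrite [LHS]matrix_sum_delta; apply: eq_bigr => i _; rewrite big_ord1.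
rewrite [in RHS]uE (linear_combination fl); apply/colP => i; rewrite !mxE summxE.
by apply: eq_bigr => j _; rewrite !mxE mulrC.
Qed.

(** The images under f of a basis of the column space of A form the required
basis. *)
Lemma has_dim_image (H : lmodType F) n (f : 'cV[F]_n -> H) (A : 'M[F]_n) (W : set H) :
  (forall z u v, f (z *: u + v) = z *: f u + f v) -> (forall u, f u = 0 -> u = 0) ->
  (forall x, W x <-> exists u, x = f (A *m u)) -> has_dim W (\rank A).
Proof.
move=> fl inj WE; rewrite -(mxrank_tr A); set B := row_base A^T.
exists (fun i => f (row i B)^T).
have sumE (c : 'I_(\rank A^T) -> F) :
    \sum_i c i *: f (row i B)^T = f (\row_i c i *m B)^T.
  rewrite -(linear_combination fl); congr f; rewrite mulmx_sum_row linear_sum /=.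
  by apply: eq_bigr => i _; rewrite mxE linearZ.
split=> [c|].
  rewrite sumE => /inj /(congr1 trmx); rewrite trmxK trmx0 => h i.
  have : \row_i c i = 0 :> 'rV_(\rank A^T).
    by apply: (row_free_inj (row_base_free A^T)); rewrite mul0mx.
  by move=> /rowP/(_ i); rewrite !mxE.
apply/seteqP; split => x.
  move=> /WE[u ->].
  have : (u^T *m A^T <= B)%MS by rewrite eq_row_base submxMl.
  move=> /submxP[D DE]; exists (fun i => D 0 i) => //.
  rewrite sumE; congr f; apply: trmx_inj; rewrite trmxK trmx_mul DE; congr (_ *m _).
  by apply/rowP => i; rewrite mxE.
move=> [c _ <-]; apply/WE; rewrite sumE.
have : (\row_i c i *m B <= A^T)%MS by rewrite -(eq_row_base A^T) submxMl.
by move=> /submxP[D ->]; exists D^T; rewrite trmx_mul trmxK.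
Qed.
End LinearAlgebra.

(** The Riesz representation theorem on C^V. *)
Lemma cinner_representation (R : realType) (G : metric_graph R) (l : 'cV[R[i]]_(nvert G) -> R[i]) :
  (forall z u v, l (z *: u + v) = z * l u + l v) -> exists psi, forall phi, l phi = cinner phi psi.
Proof.
move=> ll; exists (\col_j conjc (l (delta_mx j 0))) => phi.
rewrite {1}(_ : phi = \sum_j phi j 0 *: delta_mx j 0); last first.
  by rewrite [LHS]matrix_sum_delta; apply: eq_bigr => i _; rewrite big_ord1.
rewrite (@linear_combination _ _ (R[i]^o) l ll).
by apply: eq_bigr => j _; rewrite mxE conjcK.
Qed.

(** * Resolvent formulas for a boundary triple *)

Section BoundaryTriple.
Local Open Scope complex_scope.
Context {R : realType} (G : metric_graph R).
Local Notation C := R[i].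
Local Notation V := (nvert G).
Local Notation cV := 'cV[C]_V.
Local Notation cinner := (@cinner R G).
Variables (H : lmodType C) (X : set H) (T : H -> H) (g0 g1 : H -> cV).
Variable inner : H -> H -> C.
Hypothesis X_lin : forall z f g, X f -> X g -> X (z *: f + g).
Hypothesis T_lin : forall z f g, X f -> X g -> T (z *: f + g) = z *: T f + T g.
Hypothesis g0_lin : forall z f g, X f -> X g -> g0 (z *: f + g) = z *: g0 f + g0 g.
Hypothesis g1_lin : forall z f g, X f -> X g -> g1 (z *: f + g) = z *: g1 f + g1 g.
Hypothesis inner_lin : forall z f g h, inner (z *: f + g) h = z * inner f h + inner g h.
Hypothesis innerC : forall f g, inner f g = conjc (inner g f).
Hypothesis inner_eq0 : forall f, inner f f = 0 -> f = 0.
Hypothesis green : forall f g, X f -> X g ->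
  inner (T f) g - inner f (T g) = cinner (g1 f) (g0 g) - cinner (g0 f) (g1 g).

Lemma cinner_inj (a b : cV) : (forall phi, cinner phi a = cinner phi b) -> a = b.
Proof.
have E (c : cV) i : cinner (delta_mx i 0) c = conjc (c i 0).
  rewrite /Defs.cinner (bigD1 i) //= big1 ?addr0 => [|j ji]; first by rewrite mxE !eqxx mul1r.
  by rewrite mxE (negbTE ji) mul0r.
move=> ab; apply/colP => i.
by have := ab (delta_mx i 0); rewrite !E => /(congr1 (@conjc R)); rewrite !conjcK.
Qed.

Lemma cinner0r phi : cinner phi 0 = 0.
Proof. by rewrite /Defs.cinner big1 // => i _; rewrite mxE conjc0 mulr0. Qed.

Variable lam : C.
Variables (gam gamc : cV -> H) (L M : 'M[C]_V) (RD : H -> H) (adj : H -> cV).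
(* gam and gamc are the gamma fields at lam and conj lam, RD the Dirichlet resolvent
   at lam, adj the adjoint of gamc. *)
Hypothesis gamX : forall phi, X (gam phi).
Hypothesis gamT : forall phi, T (gam phi) = lam *: gam phi.
Hypothesis gam0 : forall phi, g0 (gam phi) = phi.
Hypothesis gamcX : forall phi, X (gamc phi).
Hypothesis gamcT : forall phi, T (gamc phi) = conjc lam *: gamc phi.
Hypothesis gamc0 : forall phi, g0 (gamc phi) = phi.
Hypothesis uniqD : forall f, X f -> T f = lam *: f -> g0 f = 0 -> f = 0.
Hypothesis uniqDc : forall f, X f -> T f = conjc lam *: f -> g0 f = 0 -> f = 0.
Hypothesis ME : forall phi, M *m phi = g1 (gam phi).
Hypothesis RDX : forall h, X (RD h).
Hypothesis RD0 : forall h, g0 (RD h) = 0.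
Hypothesis RDT : forall h, T (RD h) = lam *: RD h + h.
Hypothesis adjE : forall h phi, inner (gamc phi) h = cinner phi (adj h).

Let lin_sub f g : X f -> X g -> X (g - f).
Proof. by move=> Xf Xg; rewrite addrC -scaleN1r; exact: X_lin. Qed.

Let T_sub f g : X f -> X g -> T (g - f) = T g - T f.
Proof. by move=> Xf Xg; rewrite addrC -scaleN1r T_lin // scaleN1r addrC. Qed.

Let g0_sub f g : X f -> X g -> g0 (g - f) = g0 g - g0 f.
Proof. by move=> Xf Xg; rewrite addrC -scaleN1r g0_lin // scaleN1r addrC. Qed.

Let g1_sub f g : X f -> X g -> g1 (g - f) = g1 g - g1 f.
Proof. by move=> Xf Xg; rewrite addrC -scaleN1r g1_lin // scaleN1r addrC. Qed.

(** An element of ker (T - lam) is determined by its vertex values. *)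
Lemma gam_eq f : X f -> T f = lam *: f -> f = gam (g0 f).
Proof.
move=> Xf Tf; apply/eqP; rewrite -subr_eq0; apply/eqP/uniqD.
- exact: lin_sub.
- by rewrite T_sub // gamT Tf scalerBr.
- by rewrite g0_sub // gam0 subrr.
Qed.

Lemma gam_lin z a b : gam (z *: a + b) = z *: gam a + gam b.
Proof.
rewrite [RHS]gam_eq; [|exact: X_lin|].
  by rewrite g0_lin // !gam0.
by rewrite T_lin // !gamT scalerDr !scalerA mulrC.
Qed.

Lemma gamc_lin z a b : gamc (z *: a + b) = z *: gamc a + gamc b.
Proof.
apply/eqP; rewrite -subr_eq0; apply/eqP/uniqDc.
- by apply: lin_sub => //; exact: X_lin.
- rewrite T_sub //; last exact: X_lin.
  by rewrite T_lin // !gamcT scalerBr scalerDr !scalerA mulrC.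
- rewrite g0_sub //; last exact: X_lin.
  by rewrite g0_lin // !gamc0 subrr.
Qed.

Lemma gam_inj a : gam a = 0 -> a = 0.
Proof.
move=> h; rewrite -[a]gam0 h.
have := g0_lin (-1) (gamX 0) (gamX 0); rewrite scaleN1r addNr => ->.
by rewrite gam0 scaler0 addr0.
Qed.

(** Green's identity for gamc phi and RD h: the eigenvalue terms cancel and the
Dirichlet condition removes one boundary term. *)
Lemma adjoint_Gamma1 h : adj h = g1 (RD h).
Proof.
apply: cinner_inj => phi; rewrite -adjE.
have := green (gamcX phi) (RDX h).
have c0 : cinner (g1 (gamc phi)) (g0 (RD h)) = 0 by rewrite RD0 cinner0r.
have i0 z f g : inner f (z *: g) = conjc z * inner f g.
  rewrite innerC -[z *: g]addr0 inner_lin [inner f g]innerC.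
  have -> : inner 0 f = 0.
    have := inner_lin (-1) 0 0 f; rewrite scaler0 addr0 mulN1r => e.
    by rewrite e addNr.
  by rewrite addr0 cJM.
have iD f g k : inner f (g + k) = inner f g + inner f k.
  rewrite (innerC f (g + k)) (innerC f g) (innerC f k) -cJD; congr conjc.
  by rewrite -[g in LHS]scale1r inner_lin mul1r.
rewrite c0 gamc0 sub0r RDT iD i0 gamcT.
have -> : inner (conjc lam *: gamc phi) (RD h) = conjc lam * inner (gamc phi) (RD h).
  by rewrite innerC i0 cJM conjcK -innerC.
by rewrite opprD addNKr => /oppr_inj.
Qed.

Lemma adj_lin z h k : adj (z *: h + k) = z *: adj h + adj k.
Proof.
rewrite !adjoint_Gamma1 -g1_lin //; congr g1; apply/eqP; rewrite -subr_eq0; apply/eqP/uniqD.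
- by apply: lin_sub => //; exact: X_lin.
- rewrite T_sub //; last exact: X_lin.
  rewrite T_lin // !RDT scalerBr !scalerDr !scalerA (mulrC lam).
  by rewrite (addrACA _ (z *: h)) opprD addrACA subrr addr0.
- rewrite g0_sub //; last exact: X_lin.
  by rewrite g0_lin // !RD0 scaler0 addr0 subrr.
Qed.

(** The map sending c to adj (gamc c) is the Gram matrix of gamc, which is invertible
because gamc is injective. *)
Lemma adj_surj psi : exists h, adj h = psi.
Proof.
have [A AE] : exists A : 'M[C]_V, forall u : cV, A *m u = adj (gamc u).
  by apply: linear_matrix => z u v; rewrite gamc_lin adj_lin.
have uA : A \in unitmx.
  apply: injective_unitmx => u; rewrite AE => Au.
  have : gamc u = 0 by apply: inner_eq0; rewrite adjE Au cinner0r.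
  move=> h; rewrite -[u]gamc0 h.
  have := g0_lin (-1) (gamcX 0) (gamcX 0); rewrite scaleN1r addNr => ->.
  by rewrite gamc0 scaler0 addr0.
by exists (gamc (invmx A *m psi)); rewrite -AE mulKVmx.
Qed.

Section Krein.
Variable RK : H -> H.
Hypothesis RKX : forall h, X (RK h).
Hypothesis RK1 : forall h, g1 (RK h) = - (L *m g0 (RK h)).
Hypothesis RKT : forall h, T (RK h) = lam *: RK h + h.
Hypothesis uniqK : forall f, X f -> T f = lam *: f -> g1 f = - (L *m g0 f) -> f = 0.

(** A vector u in the kernel makes gam u satisfy the Krein boundary condition, so
gam u is an eigenfunction of the Krein extension for lam. *)
Lemma LM_unit : L + M \in unitmx.
Proof.
apply: injective_unitmx => u; rewrite mulmxDl ME => h; apply: gam_inj; apply: uniqK => //.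
by rewrite gam0; apply/eqP; rewrite -addr_eq0 addrC h.
Qed.

(** T - lam maps both resolvents to h, so it annihilates their difference. *)
Lemma resolvent_diff_gam (R1 R2 : H -> H) h : (forall h, X (R1 h)) -> (forall h, X (R2 h)) ->
  T (R1 h) = lam *: R1 h + h -> T (R2 h) = lam *: R2 h + h ->
  R1 h - R2 h = gam (g0 (R1 h) - g0 (R2 h)).
Proof.
move=> X1 X2 T1 T2; rewrite -g0_sub //; apply: gam_eq; first exact: lin_sub.
by rewrite T_sub // T1 T2 scalerBr opprD addrACA subrr addr0.
Qed.

(** Applying g1 to RK h - RD h = gam (g0 (RK h)) gives
- L (g0 (RK h)) - adj h = M (g0 (RK h)). *)
Lemma krein_trace h : g0 (RK h) = - (invmx (L + M) *m adj h).
Proof.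
have E := resolvent_diff_gam RKX RDX (RKT h) (RDT h).
have := congr1 g1 E; rewrite g1_sub // RD0 subr0 -ME -adjoint_Gamma1 RK1 => E1.
rewrite -[LHS](mulKmx LM_unit) -mulmxN; congr (_ *m _).
by rewrite mulmxDl -E1 addrA subrr sub0r.
Qed.

Lemma krein_formula h : RK h - RD h = - gam (invmx (L + M) *m adj h).
Proof.
rewrite (resolvent_diff_gam RKX RDX (RKT h) (RDT h)) krein_trace RD0 subr0.
have := gam_lin (-1) (invmx (L + M) *m adj h) 0; rewrite !scaleN1r addr0 => ->.
suff -> : gam 0 = 0 by rewrite addr0.
by have := gam_lin (-1) 0 0; rewrite scaler0 addr0 scaleN1r addNr.
Qed.

Lemma krein_dim : has_dim (range (fun h => RK h - RD h)) V.
Proof.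
have -> : V = \rank (- invmx (L + M)).
  by apply/esym/eqP; rewrite mxrank_opp -[_ == _]/(row_free _) row_free_unit unitmx_inv LM_unit.
apply: (has_dim_image gam_lin gam_inj) => x; split => [[h _ <-]|[u ->]].
  exists (adj h); rewrite (resolvent_diff_gam RKX RDX (RKT h) (RDT h)) krein_trace RD0 subr0.
  by rewrite mulNmx.
have [h <-] := adj_surj u; exists h => //.
by rewrite (resolvent_diff_gam RKX RDX (RKT h) (RDT h)) krein_trace RD0 subr0 mulNmx.
Qed.

Lemma krein_dirichlet_difference :
  [/\ L + M \in unitmx, forall h, RK h - RD h = - gam (invmx (L + M) *m adj h) &
      has_dim (range (fun h => RK h - RD h)) V].
Proof. by split; [exact: LM_unit|exact: krein_formula|exact: krein_dim]. Qed.

Section Standard.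
Variable RS : H -> H.
Hypothesis RSX : forall h, X (RS h).
Hypothesis RS1 : forall h, g1 (RS h) = 0.
Hypothesis RST : forall h, T (RS h) = lam *: RS h + h.
Hypothesis uniqS : forall f, X f -> T f = lam *: f -> g1 f = 0 -> f = 0.

Lemma M_unit : M \in unitmx.
Proof. by apply: injective_unitmx => u; rewrite ME => h; apply: gam_inj; exact: uniqS. Qed.

(** Applying g1 to RS h - RD h = gam (g0 (RS h)) gives - adj h = M (g0 (RS h)). *)
Lemma standard_trace h : g0 (RS h) = - (invmx M *m adj h).
Proof.
have E := resolvent_diff_gam RSX RDX (RST h) (RDT h).
have := congr1 g1 E; rewrite g1_sub // RD0 subr0 -ME -adjoint_Gamma1 RS1 sub0r => E1.
by rewrite -[LHS](mulKmx M_unit) -E1 mulmxN.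
Qed.

Lemma standard_formula h :
  RK h - RS h = gam (invmx (L + M) *m L *m invmx M *m adj h).
Proof.
rewrite (resolvent_diff_gam RKX RSX (RKT h) (RST h)) krein_trace standard_trace; congr gam.
rewrite opprK addrC -mulmxBl; congr (_ *m _).
have E : L *m invmx M = (L + M) *m invmx M - 1%:M by rewrite mulmxDl mulmxV ?M_unit // addrK.
by rewrite -mulmxA E mulmxBr mulmx1 mulKmx ?LM_unit.
Qed.

Lemma standard_dim : has_dim (range (fun h => RK h - RS h)) (\rank L).
Proof.
have -> : \rank L = \rank (invmx (L + M) *m L *m invmx M).
  rewrite mxrankMfree; last by rewrite row_free_unit unitmx_inv M_unit.
  by rewrite eqmxMfull // row_full_unit unitmx_inv LM_unit.
apply: (has_dim_image gam_lin gam_inj) => x; split => [[h _ <-]|[u ->]].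
  by exists (adj h); rewrite standard_formula.
by have [h <-] := adj_surj u; exists h => //; rewrite standard_formula.
Qed.
Lemma krein_standard_difference :
  [/\ L + M \in unitmx, M \in unitmx,
      forall h, RK h - RS h = gam (invmx (L + M) *m L *m invmx M *m adj h) &
      has_dim (range (fun h => RK h - RS h)) (\rank L)].
Proof.
by split; [exact: LM_unit|exact: M_unit|exact: standard_formula|exact: standard_dim].
Qed.
End Standard.
End Krein.
End BoundaryTriple.

(** * The kernel of the maximal operator *)

Lemma sub_eq_add (W : zmodType) (a b c : W) : a - b = c <-> a = b + c.
Proof. by split => [<-|->]; [rewrite addrC subrK|rewrite addrC addKr]. Qed.

Section GraphSchroedinger.
Local Open Scope complex_scope.
Context {R : realType} {G : metric_graph R}.
Local Notation mu := (@lebesgue_measure R).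
Local Notation C := R[i].
Local Notation V := (nvert G).
Local Notation cV := 'cV[C]_V.
Local Notation Re := complex.Re.
Local Notation Im := complex.Im.
Implicit Types (e : edge G) (b : bool) (f g h : L2 G) (z lam : C).

Variables (q p : edge G -> R -> R) (B : R).
Hypothesis Gc : graph_connected G.
Hypothesis mp : forall e, measurable_fun setT (p e).
Hypothesis pB : forall e x, 0 <= p e x <= B.
Hypothesis qp : forall e, ae_eq mu `]0, len e[%classic (q e) (p e).

Notation T := (schroedinger q).
Notation domT := (dom (op_Sstar q)).

Lemma realcM (x y : R) : (x * y)%:C = x%:C * y%:C :> C.
Proof. exact: rmorphM. Qed.

Lemma realcD (x y : R) : (x + y)%:C = x%:C + y%:C :> C.
Proof. exact: rmorphD. Qed.

Lemma Cint_real x (r : R -> R) : Cintegral x (fun t => (r t)%:C) = (prim r x)%:C.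
Proof.
apply: complexP => //=.
by rewrite Rintegral_cst // mul0r.
Qed.

Lemma citg_real l (r : R -> R) : itg l r -> citg l (fun t => (r t)%:C).
Proof. by move=> ir; split => //=; exact: itg_cst. Qed.

Lemma square_integrable_real (l : R) (r : R -> R) (K : R) : measurable_fun `]0, l[ r ->
  (forall x, 0 < x < l -> `|r x| <= K) -> square_integrable l (fun t => (r t)%:C).
Proof.
move=> mr rK; apply: (@square_integrable_bounded _ _ _ (K ^+ 2)).
  by split => //=; exact: measurable_cst.
move=> x /rK rx; rewrite /normsq /= expr0n addr0 -[leLHS]real_normK ?num_real //.
by rewrite lerXn2r ?nnegrE // (le_trans _ rx).
Qed.

(** The solution is a Phi + s Psi, where Phi and Psi solve the equation with initial
value and slope (1, 0) and (0, 1).  Since Psi (len e) >= len e > 0, the slope s can be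
chosen so that the value at the other endpoint is b. *)
Lemma edge_solution e (a b : C) : exists s (w : R -> C),
  [/\ square_integrable (len e) w,
      a + Cintegral (len e) (fun t => s + Cintegral t w) = b &
      forall x, 0 < x < len e ->
        w x = (p e x)%:C * (a + Cintegral x (fun t => s + Cintegral t w))].
Proof.
have l0 := len_ge0 e; have lgt := len_gt0 e.
have [Phi [mPhi [K1 bPhi] gePhi ePhi]] :=
  @picard_solution _ (len e) (p e) (cst 1) B 1 l0 (mp e) (pB e)
  (measurable_cst _) (fun x _ => introT andP (conj ler01 (lexx 1))).
have mid : measurable_fun `]0, len e[ (fun x : R => x) by exact: measurable_id.
have [Psi [mPsi [K2 bPsi] gePsi ePsi]] := @picard_solution _ (len e) (p e) (fun x => x) B (len e) l0
  (mp e) (pB e) mid (fun _ xl => xl).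
have oc x : 0 < x < len e -> 0 <= x <= len e by move=> /andP[h1 h2]; rewrite !ltW.
have mpe : measurable_fun `]0, len e[ (p e) by exact: measurable_funS (mp e).
have bp u K : (forall x, 0 <= x <= len e -> `|u x| <= K) ->
    forall x, 0 < x < len e -> `|p e x * u x| <= B * K.
  move=> uK x xl; have /andP[h1 h2] := pB e x; rewrite normrM ger0_norm //.
  exact: ler_pM (uK _ (oc _ xl)).
pose r1 t := p e t * Phi t; pose r2 t := p e t * Psi t.
have m1 : measurable_fun `]0, len e[ r1 by exact: measurable_funM.
have m2 : measurable_fun `]0, len e[ r2 by exact: measurable_funM.
have i1 : itg (len e) r1 by exact: itg_bounded (bp _ _ bPhi).
have i2 : itg (len e) r2 by exact: itg_bounded (bp _ _ bPsi).
have Psil : (Psi (len e))%:C != 0 :> C.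
  rewrite eq_complex /= eqxx andbT gt_eqF //; apply: lt_le_trans lgt _.
  by apply: gePsi; rewrite l0 lexx.
(* The slope for which a Phi + s Psi takes the value b at len e. *)
pose s := (b - a * (Phi (len e))%:C) / (Psi (len e))%:C.
pose w t := a * (r1 t)%:C + s * (r2 t)%:C.
have ic1 := citg_real i1; have ic2 := citg_real i2.
have Uw x : 0 <= x <= len e ->
    a + Cintegral x (fun t => s + Cintegral t w) = a * (Phi x)%:C + s * (Psi x)%:C.
  move=> /[dup] x0l /andP[x0 xl].
  have Cw t : 0 < t < x -> s + Cintegral t w =
      s + (a * (prim r1 t)%:C + s * (prim r2 t)%:C).
    move=> /andP[t0 tx]; congr (_ + _).
    have tl := ltW (lt_le_trans tx xl).
    have j1 := citgS tl ic1; have j2 := citgS tl ic2.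
    by rewrite (CintD (citgZ a j1) (citgZ s j2)) !CintZ // !Cint_real.
  rewrite (eq_Cint Cw).
  have k1 := citg_real (itgS xl (itg_prim l0 i1)).
  have k2 := citg_real (itgS xl (itg_prim l0 i2)).
  rewrite (CintD (citg_cst x s) (citgD (citgZ a k1) (citgZ s k2))).
  rewrite (CintD (citgZ a k1) (citgZ s k2)) (CintZ a k1) (CintZ s k2).
  rewrite (Cint_real x (prim r1)) (Cint_real x (prim r2)) (Cint_cst s x0).
  rewrite (ePhi _ x0l) (ePsi _ x0l) -/r1 -/r2 (realcD (cst 1 x)) (realcD x).
  move: (prim (prim r1) x)%:C (prim (prim r2) x)%:C x%:C => y1 y2 y3.
  by rewrite (_ : (cst 1 x)%:C = 1) //; ring.
exists s, w; split.
- apply: (@square_integrableD _ _ (fun t => a * (r1 t)%:C) (fun t => s * (r2 t)%:C)).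
    exact: square_integrableZ (square_integrable_real m1 (bp _ _ bPhi)).
  exact: square_integrableZ (square_integrable_real m2 (bp _ _ bPsi)).
- rewrite Uw ?l0 ?lexx // /s mulfVK //.
  by rewrite addrC subrK.
- move=> x xl; rewrite Uw ?oc // /w /r1 /r2 (realcM _ (Phi x)) (realcM _ (Psi x)).
  by move: (p e x)%:C (Phi x)%:C (Psi x)%:C => y1 y2 y3; ring.
Qed.

Lemma endpoint_trace (phi : cV) f : sobolev 2 f ->
  (forall e b, trace f e b = phi (vtx e b) 0) -> domT f /\ Gamma0 f = phi.
Proof.
move=> sf tf; have hf : H1 f.
  split; last by move=> e b e' b' E; rewrite !tf E.
  by have /sobolev2P[g [_ [d _]]] := sf; apply/sobolev1P; exists g.
split => //; apply/colP => v; rewrite Gamma0E.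
by have [e [b <-]] := vertex_incident v Gc; rewrite vertex_valueE.
Qed.

Lemma kernel_solution (phi : cV) : exists f, [/\ domT f, T f = 0 & Gamma0 f = phi].
Proof.
have ES e := edge_solution e (phi (vtx e false) 0) (phi (vtx e true) 0).
have [sw SW] := @choice _ _ (fun e (sw : C * (R -> C)) =>
  [/\ square_integrable (len e) sw.2,
      phi (vtx e false) 0 + Cintegral (len e) (fun t => sw.1 + Cintegral t sw.2) =
        phi (vtx e true) 0 &
      forall x, 0 < x < len e -> sw.2 x = (p e x)%:C *
        (phi (vtx e false) 0 + Cintegral x (fun t => sw.1 + Cintegral t sw.2))])
  (fun e => let: ex_intro s (ex_intro w h) := ES e in ex_intro _ (s, w) h).
have si e : square_integrable (len e) (sw e).2 by case: (SW e).
have [f [g [h [d1 d2 hE fE tE]]]] := @sobolev2_build R G (fun e => phi (vtx e false) 0) 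
  (fun e => (sw e).1) (fun e => (sw e).2) si.
have sf : sobolev 2 f by apply/sobolev2P; exists g, h.
have [df g0f] : domT f /\ Gamma0 f = phi.
  apply: endpoint_trace => // e b; have [-> _] := tE e b.
  by case: b; [case: (SW e)|rewrite Cint0 ?addr0].
exists f; split => //.
rewrite /schroedinger (weak_derivativeE d1) (weak_derivativeE d2).
suff <- : h = potential_mul q f by rewrite addNr.
apply: L2_ext => e; apply: aeq_trans (hE e) _.
apply: aeq_trans _ (aeq_sym (potential_mulE mp pB qp f e)).
by apply: ae_sub (fE e) => x xl ->; case: (SW e) => _ _; exact.
Qed.

(** A Sobolev function is its initial trace plus the primitive of f', here of zero. *)
Lemma flat_edge f e : domT f -> weak_derivative f = 0 ->
  aeq e (L2rep f e) (fun=> trace f e false) /\ trace f e true = trace f e false.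
Proof.
move=> [/sobolev2_weak_derivative[d1 _] _] f0; rewrite f0 in d1.
have C0 x : 0 <= x <= len e -> Cintegral x (L2rep (0 : L2 G) e) = 0.
  move=> /andP[x0 xl]; rewrite (Cint_aeqx (e := e) (w := fun=> 0) xl).
  - by rewrite Cint_cst // mulr0.
  - exact: cmeas_rep.
  - exact/citg_cmeas/citg_cst.
  - exact: L2rep0.
split; last by rewrite (trace_endpoint e true d1) C0 ?addr0 // len_ge0 lexx.
by apply: ae_sub (trace_primitive e d1) => x /andP[x0 xl] ->; rewrite C0 ?addr0 // !ltW.
Qed.

Lemma kernel_energy f : domT f -> T f = 0 -> cinner (Gamma1 f) (Gamma0 f) = 0 ->
  weak_derivative f = 0 /\
  forall e, ae_eq mu `]0, len e[%classic (fun x => p e x * normsq (L2rep f e x)) (cst 0).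
Proof.
move=> df Tf b0; apply: (energy_eq0 mp pB).
by have := green_first mp pB qp df df; rewrite Tf L2inner0l b0 addr0 => <-.
Qed.

(** With zero vertex values the energy vanishes, so f is constant on each edge, and
the constant is its value at a vertex. *)
Lemma kernel_uniq f : domT f -> T f = 0 -> Gamma0 f = 0 -> f = 0.
Proof.
move=> df Tf g0f; have [f0 _] : weak_derivative f = 0 /\ forall e,
    ae_eq mu `]0, len e[%classic (fun x => p e x * normsq (L2rep f e x)) (cst 0).
  by apply: kernel_energy => //; rewrite g0f cinner0r.
apply: L2_ext => e; apply: aeq_trans (aeq_sym (L2rep0 e)).
have [fE _] := flat_edge e df f0.
have [_ hf] := df.
by apply: ae_sub fE => x _ ->; rewrite -vertex_valueE // -Gamma0E g0f mxE.
Qed.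

(** With zero normal derivatives the energy vanishes.  Then f' = 0, so f is constant on
each edge and, the graph being connected, on the whole graph; and p |f|^2 = 0, so a
nonzero constant forces p = 0. *)
Lemma kernel_neumann f : domT f -> T f = 0 -> Gamma1 f = 0 ->
  (forall u v, Gamma0 f u 0 = Gamma0 f v 0) /\
  (forall v, Gamma0 f v 0 != 0 -> potential_eq0 q).
Proof.
move=> df Tf g1f; have [f0 pf0] : weak_derivative f = 0 /\ forall e,
    ae_eq mu `]0, len e[%classic (fun x => p e x * normsq (L2rep f e x)) (cst 0).
  by apply: kernel_energy => //; rewrite g1f /cinner big1 // => i _; rewrite mxE mul0r.
have [_ hf] := df.
have tb e b b' : trace f e b = trace f e b'.
  by have [_ E] := flat_edge e df f0; case: b; case: b'; rewrite // E.
have cst_vertex u v : Gamma0 f u 0 = Gamma0 f v 0.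
  have /connectP[s + ->] := Gc u v.
  elim: s u => [//|w s ih] u /= /andP[/existsP[e /existsP[b /andP[/eqP uE /eqP wE]]] ps].
  by rewrite -(ih w ps) !Gamma0E -uE -wE !vertex_valueE.
split => // v vn0 e.
have fE := (flat_edge e df f0).1.
have : ae_eq mu `]0, len e[%classic (q e) (cst 0).
  apply: ae_sub3 fE (pf0 e) (qp e) => x _ -> /eqP + ->.
  rewrite mulf_eq0 => /orP[/eqP //|/eqP n0].
  move: vn0; rewrite (cst_vertex v (vtx e false)) Gamma0E vertex_valueE //.
  suff -> : trace f e false = 0 by rewrite eqxx.
  move/eqP: n0; rewrite /normsq paddr_eq0 ?sqr_ge0 // !sqrf_eq0 => /andP[/eqP h1 /eqP h2].
  exact: complexP.
by apply: filterS => x h xl; apply: h; rewrite /= in_itv.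
Qed.

Lemma constant_kernel (c : C) : potential_eq0 q -> exists f,
  [/\ domT f, T f = 0, Gamma0 f = const_mx c & Gamma1 f = 0].
Proof.
move=> q0.
have si e : square_integrable (len e) (fun=> 0 : C) by exact: square_integrable0.
have [f [g [h [d1 d2 hE fE tE]]]] := @sobolev2_build R G (fun=> c) (fun=> 0) (fun=> fun=> 0) si.
have C00 x : Cintegral x (fun=> 0 : C) = 0.
  have [x0|x0] := leP 0 x; first by rewrite Cint_cst // mulr0.
  by rewrite Cint0 // ltW.
have C000 x : Cintegral x (fun t : R => 0 + Cintegral t (fun=> 0 : C)) = 0.
  by rewrite -[RHS](C00 x); apply: eq_Cint => t _; rewrite C00 addr0.
have sf : sobolev 2 f by apply/sobolev2P; exists g, h.
have [df g0f] : domT f /\ Gamma0 f = const_mx c.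
  by apply: endpoint_trace => // e b; have [-> _] := tE e b; rewrite C000 addr0 mxE.
exists f; split => //.
  rewrite /schroedinger (weak_derivativeE d1) (weak_derivativeE d2).
  suff <- : h = potential_mul q f by rewrite addNr.
  apply: L2_ext => e; apply: aeq_trans (hE e) _.
  apply: aeq_trans _ (aeq_sym (potential_mulE mp pB qp f e)).
  have q0e : ae_eq mu `]0, len e[%classic (q e) (cst 0).
    move: (q0 e); apply: filterS; first exact: (ae_filter_ringOfSetsType mu).
    by move=> x hx; rewrite /= in_itv; exact: hx.
  by apply: ae_sub2 q0e (qp e) => x _ -> <-; rewrite mul0r.
apply/colP => v; rewrite Gamma1E [RHS]mxE /normal_derivative (weak_derivativeE d1).
rewrite big1 ?oppr0 // => -[e b] _ /=; have [_ ->] := tE e b.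
by rewrite C00 addr0 oppr0; case: b.
Qed.
End GraphSchroedinger.

(** * The Krein, Dirichlet and standard extensions of S *)

Section Extensions.
Local Open Scope complex_scope.
Context {R : realType} {G : metric_graph R}.
Local Notation mu := (@lebesgue_measure R).
Local Notation C := R[i].
Local Notation V := (nvert G).
Local Notation cV := 'cV[C]_V.
Implicit Types (e : edge G) (b : bool) (f g h : L2 G) (z lam : C).

Variables (q p : edge G -> R -> R) (B : R).
Hypothesis Gc : graph_connected G.
Hypothesis mp : forall e, measurable_fun setT (p e).
Hypothesis pB : forall e x, 0 <= p e x <= B.
Hypothesis qp : forall e, ae_eq mu `]0, len e[%classic (q e) (p e).

Notation T := (schroedinger q).
Notation domT := (dom (op_Sstar q)).

Lemma schroedinger0 : T 0 = 0.
Proof.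
have := T_lin mp pB qp (-1) (domT0 q) (domT0 q).
by rewrite scaler0 addr0 scaleN1r addNr.
Qed.

Lemma resolvent_inj (A : @operator R G) lam f : act A = T -> dom A 0 ->
  resolvent_set A lam -> dom A f -> T f = lam *: f -> f = 0.
Proof.
move=> aA d0 [/(_ 0)[g [_ uniq]] _] df Tf.
have Pf : dom A f /\ act A f - lam *: f = 0 by rewrite aA Tf subrr.
have P0 : dom A 0 /\ act A 0 - lam *: 0 = 0.
  by rewrite aA; split; [exact: d0|rewrite schroedinger0 scaler0 subr0].
exact: (etrans (esym (uniq f Pf)) (uniq 0 P0)).
Qed.

Lemma resolventP (A : @operator R G) lam h : act A = T -> resolvent_set A lam ->
  dom A (resolvent A lam h) /\ T (resolvent A lam h) = lam *: resolvent A lam h + h.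
Proof.
move=> aA [/(_ h)[g [gP _]] _].
have : [set f | dom A f /\ act A f - lam *: f = h] (resolvent A lam h).
  by apply: xgetPex; exists g.
by rewrite /= aA => -[d /sub_eq_add].
Qed.

Definition dirichlet_solvable lam :=
  (forall phi : cV, exists f, [/\ domT f, T f = lam *: f & Gamma0 f = phi]) /\
  (forall f, domT f -> T f = lam *: f -> Gamma0 f = 0 -> f = 0).

Lemma dirichlet_solvable0 : dirichlet_solvable 0.
Proof.
split=> [phi|f df]; last by rewrite scale0r; exact: (kernel_uniq mp pB qp df).
have [f [df Tf gf]] := kernel_solution Gc mp pB qp phi.
by exists f; rewrite scale0r.
Qed.

Lemma Gamma0_domT0 : Gamma0 (0 : L2 G) = 0.
Proof.
have := Gamma0_lin Gc (-1) (domT0 q) (domT0 q).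
by rewrite scaler0 addr0 scaleN1r addNr.
Qed.

Lemma Gamma1_domT0 : Gamma1 (0 : L2 G) = 0.
Proof.
have := Gamma1_lin (-1) (domT0 q) (domT0 q).
by rewrite scaler0 addr0 scaleN1r addNr.
Qed.

Lemma dom_dirichletP f : dom (dirichlet_laplacian q) f <-> domT f /\ Gamma0 f = 0.
Proof.
split=> [[sf hf f0]|[[sf hf] g0]].
  by split => //; apply/colP => v; rewrite Gamma0E f0 mxE.
by split => // v; rewrite -Gamma0E g0 mxE.
Qed.

Lemma dom_standardP f : dom (standard_laplacian q) f <-> domT f /\ Gamma1 f = 0.
Proof.
split=> [[sf hf f0]|[[sf hf] g1]].
  by split => //; apply/colP => v; rewrite Gamma1E f0 mxE oppr0.
by split => // v; apply: oppr_inj; rewrite -Gamma1E g1 mxE oppr0.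
Qed.

Lemma dom_SP f : dom (op_S q) f <-> [/\ domT f, Gamma0 f = 0 & Gamma1 f = 0].
Proof.
split=> [[sf hf f0]|[[sf hf] g0 g1]].
  split => //; apply/colP => v; have [h0 h1] := f0 v.
    by rewrite Gamma0E h0 mxE.
  by rewrite Gamma1E h1 mxE oppr0.
split => // v; split; first by rewrite -Gamma0E g0 mxE.
by apply: oppr_inj; rewrite -Gamma1E g1 mxE oppr0.
Qed.

(** If f0 solves T f0 = 0 with the given vertex values, adding the
Dirichlet function (D - lam)^-1 (lam f0) produces a solution of T f = lam f without
changing the vertex values. *)
Lemma dirichlet_solvable_resolvent lam : resolvent_set (dirichlet_laplacian q) lam ->
  dirichlet_solvable lam.
Proof.
move=> rho; split=> [phi|f df Tf g0f]; last first.
  apply: (resolvent_inj (A := dirichlet_laplacian q) _ _ rho) => //; apply/dom_dirichletP => //.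
  by split; [exact: domT0|exact: Gamma0_domT0].
have [f0 [df0 Tf0 gf0]] := kernel_solution Gc mp pB qp phi.
have [/dom_dirichletP[dr gr] Tr] :=
  resolventP (A := dirichlet_laplacian q) (lam *: f0) (erefl T) rho.
set r := resolvent _ _ _ in dr gr Tr.
exists (1 *: r + f0); split.
- exact: domT_lin.
- by rewrite (T_lin mp pB qp) // Tf0 addr0 Tr !scale1r -scalerDr.
- by rewrite (Gamma0_lin Gc 1 dr df0) gr scaler0 add0r.
Qed.

(** The potential is real, so conjugation maps ker (T - lam) onto
ker (T - conj lam). *)
Lemma dirichlet_solvable_conj lam : dirichlet_solvable lam -> dirichlet_solvable (conjc lam).
Proof.
have conjZ z f : conjL2 (z *: f) = conjc z *: conjL2 f.
  have conj0 : conjL2 (0 : L2 G) = 0.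
    have := conjL2_lin (-1) (0 : L2 G) 0; rewrite scaler0 addr0 => ->.
    have J1 : conjc (-1) = -1 :> C by apply: complexP; rewrite /= ?oppr0.
    by rewrite J1 scaleN1r addNr.
  by have := conjL2_lin z f 0; rewrite conj0 !addr0.
have conj0 : conjL2 (0 : L2 G) = 0 by have := conjZ 0 0; rewrite scale0r conjc0 scale0r.
move=> [ex uniq]; split=> [phi|f df Tf g0f].
  have [f [df Tf gf]] := ex (map_mx conjc phi); exists (conjL2 f); split.
  - exact: domT_conj.
  - by rewrite (T_conj mp pB qp) // Tf conjZ.
  - rewrite (Gamma0_conj Gc df) gf; apply/colP => v; rewrite 2!mxE; exact: conjcK.
have cf : conjL2 f = 0.
  apply: uniq; first exact: domT_conj.
  - by rewrite (T_conj mp pB qp) // Tf conjZ conjcK.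
  - rewrite (Gamma0_conj Gc df) g0f; apply/colP => v; rewrite 2!mxE; exact: conjc0.
by rewrite -(conjL2K f) cf conj0.
Qed.

Lemma gamma_fieldP lam phi : dirichlet_solvable lam ->
  [/\ domT (gamma_field q lam phi), T (gamma_field q lam phi) = lam *: gamma_field q lam phi &
      Gamma0 (gamma_field q lam phi) = phi].
Proof.
move=> [/(_ phi)[f [df Tf gf]] _].
have : [set f | eigenker (op_Sstar q) lam f /\ Gamma0 f = phi] (gamma_field q lam phi).
  by apply: xgetPex; exists f; split => //; split => //=; rewrite Tf subrr.
by move=> [[d /sub_eq_add]]; rewrite addr0.
Qed.

Lemma gamma_field_lin lam z (a b : cV) : dirichlet_solvable lam ->
  gamma_field q lam (z *: a + b) = z *: gamma_field q lam a + gamma_field q lam b.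
Proof.
move=> S; apply: (gam_lin (@domT_lin R G q) (T_lin mp pB qp) (@Gamma0_lin R G q Gc)
  (fun phi => let: And3 d _ _ := gamma_fieldP phi S in d)
  (fun phi => let: And3 _ d _ := gamma_fieldP phi S in d)
  (fun phi => let: And3 _ _ d := gamma_fieldP phi S in d) S.2).
Qed.

Lemma weylP lam phi : dirichlet_solvable lam ->
  weyl q lam *m phi = Gamma1 (gamma_field q lam phi).
Proof.
move=> S; have [M ME] : exists M : 'M[C]_V, forall u : cV, M *m u = Gamma1 (gamma_field q lam u).
  apply: linear_matrix => z u v; rewrite (gamma_field_lin z u v S).
  by have [d1 _ _] := gamma_fieldP u S; have [d2 _ _] := gamma_fieldP v S;
    exact: (Gamma1_lin z d1 d2).
have : [set M : 'M[C]_V | forall phi, M *m phi = Gamma1 (gamma_field q lam phi)] (weyl q lam).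
  by apply: xgetPex; exists M.
exact.
Qed.

Lemma dirichlet_to_neumannP f : domT f -> T f = 0 ->
  Gamma1 f = - (dirichlet_to_neumann q *m Gamma0 f).
Proof.
have S := dirichlet_solvable0.
have EN h : (\col_v normal_derivative h v) = - Gamma1 h.
  by apply/colP => v; rewrite [RHS]mxE Gamma1E opprK mxE.
have : [set L : 'M[C]_V | forall f, eigenker (op_Sstar q) 0 f ->
    (\col_v normal_derivative f v) = L *m (\col_v vertex_value f v)] (dirichlet_to_neumann q).
  apply: xgetPex; exists (- weyl q 0) => g [dg /sub_eq_add]; rewrite addr0 => Tg.
  have gE : g = gamma_field q 0 (Gamma0 g).
    apply: (gam_eq (@domT_lin R G q) (T_lin mp pB qp) (@Gamma0_lin R G q Gc)
      (fun phi => let: And3 d _ _ := gamma_fieldP phi S in d)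
      (fun phi => let: And3 _ d _ := gamma_fieldP phi S in d)
      (fun phi => let: And3 _ _ d := gamma_fieldP phi S in d) S.2 dg Tg).
  by rewrite (EN g) mulNmx (weylP (Gamma0 g) S) -gE.
move=> /= H df Tf.
have Kf : eigenker (op_Sstar q) 0 f by split => //=; rewrite Tf scale0r subr0.
have := H f Kf; rewrite (EN f) => E.
by rewrite -[LHS]opprK E.
Qed.

(** Subtract from f the element g of ker T with the same vertex values: f - g lies in
the domain of S exactly when f and g have the same normal derivatives, and those of g are
given by Lambda. *)
Lemma dom_kreinP f : dom (krein_laplacian q) f <->
  domT f /\ Gamma1 f = - (dirichlet_to_neumann q *m Gamma0 f).
Proof.
split=> [[s /dom_SP[ds s0 s1] [g [dg /sub_eq_add]]]|[df f1]].
  rewrite scale0r addr0 => Tg <-.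
  have E : s + g = 1 *: s + g by rewrite scale1r.
  rewrite E; split; first exact: domT_lin.
  rewrite (Gamma1_lin 1 ds dg) (Gamma0_lin Gc 1 ds dg) s0 s1 !scaler0 !add0r.
  exact: dirichlet_to_neumannP.
have [g [dg Tg g0]] := kernel_solution Gc mp pB qp (Gamma0 f).
have g1 := dirichlet_to_neumannP dg Tg.
(* f - g, written as a linear combination so that the linearity lemmas apply. *)
exists (-1 *: g + f); last first.
  exists g; first by split => //=; rewrite Tg scale0r subr0.
  by rewrite scaleN1r addrAC addNr add0r.
apply/dom_SP; split; first exact: domT_lin.
  by rewrite (Gamma0_lin Gc (-1) dg df) g0 scaleN1r addNr.
by rewrite (Gamma1_lin (-1) dg df) g1 f1 g0 scaleN1r addNr.
Qed.

Lemma adjointP lam phi h : dirichlet_solvable lam ->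
  L2inner (gamma_field q lam phi) h = cinner phi (adjoint (gamma_field q lam) h).
Proof.
move=> S.
have [psi psiE] : exists psi, forall phi : cV, L2inner (gamma_field q lam phi) h = cinner phi psi.
  by apply: cinner_representation => z u v; rewrite (gamma_field_lin z u v S) L2inner_linl.
have : [set psi | forall phi, L2inner (gamma_field q lam phi) h = cinner phi psi]
    (adjoint (gamma_field q lam) h).
  by apply: xgetPex; exists psi.
exact.
Qed.

Lemma krein_dirichlet lam : resolvent_set (krein_laplacian q) lam ->
  resolvent_set (dirichlet_laplacian q) lam ->
  [/\ dirichlet_to_neumann q + weyl q lam \in unitmx,
      forall h : L2 G,
        resolvent (krein_laplacian q) lam h - resolvent (dirichlet_laplacian q) lam h =
        - gamma_field q lam (invmx (dirichlet_to_neumann q + weyl q lam) *m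
            adjoint (gamma_field q (conjc lam)) h)
    & has_dim (range (fun h : L2 G => resolvent (krein_laplacian q) lam h -
         resolvent (dirichlet_laplacian q) lam h)) (nvert G)].
Proof.
move=> rK rD; have S := dirichlet_solvable_resolvent rD; have Sc := dirichlet_solvable_conj S.
have DP h := resolventP (A := dirichlet_laplacian q) h (erefl T) rD.
have KP h := resolventP (A := krein_laplacian q) h (erefl T) rK.
have k0 : dom (krein_laplacian q) 0.
  apply/dom_kreinP; split; first exact: domT0.
  by rewrite Gamma1_domT0 Gamma0_domT0 mulmx0 oppr0.
apply: (krein_dirichlet_difference (@domT_lin R G q) (T_lin mp pB qp) (@Gamma0_lin R G q Gc)
  (@Gamma1_lin R G q) (@L2inner_linl R G) (@L2innerC R G) (@L2inner_eq0 R G) (green mp pB qp)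
  (fun phi => let: And3 d _ _ := gamma_fieldP phi S in d)
  (fun phi => let: And3 _ d _ := gamma_fieldP phi S in d)
  (fun phi => let: And3 _ _ d := gamma_fieldP phi S in d)
  (fun phi => let: And3 d _ _ := gamma_fieldP phi Sc in d)
  (fun phi => let: And3 _ d _ := gamma_fieldP phi Sc in d)
  (fun phi => let: And3 _ _ d := gamma_fieldP phi Sc in d) S.2 Sc.2
  (fun phi => weylP phi S)
  (fun h => (((dom_dirichletP _).1 (DP h).1)).1)
  (fun h => (((dom_dirichletP _).1 (DP h).1)).2)
  (fun h => (DP h).2) (fun h phi => adjointP phi h Sc)
  (fun h => (((dom_kreinP _).1 (KP h).1)).1)
  (fun h => (((dom_kreinP _).1 (KP h).1)).2)
  (fun h => (KP h).2)
  (fun f df Tf bf => resolvent_inj (A := krein_laplacian q) (erefl T) k0 rK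
    ((dom_kreinP f).2 (conj df bf)) Tf)).
Qed.

Lemma krein_standard lam : resolvent_set (krein_laplacian q) lam ->
  resolvent_set (standard_laplacian q) lam -> resolvent_set (dirichlet_laplacian q) lam ->
  [/\ dirichlet_to_neumann q + weyl q lam \in unitmx, weyl q lam \in unitmx,
      forall h : L2 G,
        resolvent (krein_laplacian q) lam h - resolvent (standard_laplacian q) lam h =
        gamma_field q lam (invmx (dirichlet_to_neumann q + weyl q lam) *m
            dirichlet_to_neumann q *m invmx (weyl q lam) *m
            adjoint (gamma_field q (conjc lam)) h)
    & has_dim (range (fun h : L2 G => resolvent (krein_laplacian q) lam h -
         resolvent (standard_laplacian q) lam h)) (\rank (dirichlet_to_neumann q))].
Proof.
move=> rK rS rD; have S := dirichlet_solvable_resolvent rD; have Sc := dirichlet_solvable_conj S.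
have DP h := resolventP (A := dirichlet_laplacian q) h (erefl T) rD.
have KP h := resolventP (A := krein_laplacian q) h (erefl T) rK.
have SP h := resolventP (A := standard_laplacian q) h (erefl T) rS.
have k0 : dom (krein_laplacian q) 0.
  apply/dom_kreinP; split; first exact: domT0.
  by rewrite Gamma1_domT0 Gamma0_domT0 mulmx0 oppr0.
have s0 : dom (standard_laplacian q) 0.
  by apply/dom_standardP; split; [exact: domT0|exact: Gamma1_domT0].
apply: (krein_standard_difference (@domT_lin R G q) (T_lin mp pB qp) (@Gamma0_lin R G q Gc)
  (@Gamma1_lin R G q) (@L2inner_linl R G) (@L2innerC R G) (@L2inner_eq0 R G) (green mp pB qp)
  (fun phi => let: And3 d _ _ := gamma_fieldP phi S in d)
  (fun phi => let: And3 _ d _ := gamma_fieldP phi S in d)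
  (fun phi => let: And3 _ _ d := gamma_fieldP phi S in d)
  (fun phi => let: And3 d _ _ := gamma_fieldP phi Sc in d)
  (fun phi => let: And3 _ d _ := gamma_fieldP phi Sc in d)
  (fun phi => let: And3 _ _ d := gamma_fieldP phi Sc in d) S.2 Sc.2
  (fun phi => weylP phi S)
  (fun h => (((dom_dirichletP _).1 (DP h).1)).1)
  (fun h => (((dom_dirichletP _).1 (DP h).1)).2)
  (fun h => (DP h).2) (fun h phi => adjointP phi h Sc)
  (fun h => (((dom_kreinP _).1 (KP h).1)).1)
  (fun h => (((dom_kreinP _).1 (KP h).1)).2)
  (fun h => (KP h).2)
  (fun f df Tf bf => resolvent_inj (A := krein_laplacian q) (erefl T) k0 rK
    ((dom_kreinP f).2 (conj df bf)) Tf)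
  (fun h => (((dom_standardP _).1 (SP h).1)).1)
  (fun h => (((dom_standardP _).1 (SP h).1)).2)
  (fun h => (SP h).2)
  (fun f df Tf bf => resolvent_inj (A := standard_laplacian q) (erefl T) s0 rS
    ((dom_standardP f).2 (conj df bf)) Tf)).
Qed.

Lemma dirichlet_to_neumann_kernel (u : cV) : dirichlet_to_neumann q *m u = 0 ->
  (forall v w, u v 0 = u w 0) /\ (forall v, u v 0 != 0 -> potential_eq0 q).
Proof.
move=> Lu; have [f [df Tf gf]] := kernel_solution Gc mp pB qp u.
have f1 : Gamma1 f = 0 by rewrite (dirichlet_to_neumannP df Tf) gf Lu oppr0.
by have := kernel_neumann Gc mp pB qp df Tf f1; rewrite gf.
Qed.

Lemma dirichlet_to_neumann_const (c : C) : potential_eq0 q ->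
  dirichlet_to_neumann q *m (const_mx c : cV) = 0.
Proof.
move=> q0; have [f [df Tf gf f1]] := constant_kernel Gc mp pB qp c q0.
have := dirichlet_to_neumannP df Tf; rewrite f1 gf => /esym/eqP.
by rewrite oppr_eq0 => /eqP.
Qed.

(** The kernel of Lambda is trivial or consists of the constant vectors. *)
Lemma rank_dirichlet_to_neumann :
  (potential_eq0 q -> \rank (dirichlet_to_neumann q) = V.-1) /\
  (~ potential_eq0 q -> \rank (dirichlet_to_neumann q) = V).
Proof.
set L := dirichlet_to_neumann q.
have [v0] : exists v0 : 'I_V, True.
  by have /card_gt0P[e0 _] : (0 < #|edge G|)%N := edge_gt0 G; exists (vtx e0 false).
move=> _; have V0 : (0 < V)%N by apply: leq_ltn_trans (ltn_ord v0).
split=> q0; last first.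
  apply/eqP; rewrite -[_ == _]/(row_free L) row_free_unit; apply: injective_unitmx => u Lu.
  have [_ h] := dirichlet_to_neumann_kernel Lu; apply/colP => v; rewrite mxE; apply/eqP.
  by apply/negPn/negP => /h.
have rk : \rank (kermx L^T) = 1%N.
  pose o : 'rV[C]_V := const_mx 1.
  have -> : \rank (kermx L^T) = \rank o.
    apply: eqmx_rank; apply/andP; split; last first.
      apply/sub_kermxP; apply: trmx_inj; rewrite trmx_mul trmxK trmx0 trmx_const.
      exact: dirichlet_to_neumann_const.
    apply/row_subP => i; set r := row i _.
    have Lr : L *m r^T = 0.
      by apply: trmx_inj; rewrite trmx_mul trmxK trmx0 -row_mul mulmx_ker row0.
    have [h _] := dirichlet_to_neumann_kernel Lr.
    have -> : r = r 0 v0 *: o.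
      by apply/rowP => j; rewrite !mxE mulr1; have := h j v0; rewrite !mxE.
    exact: scalemx_sub.
  rewrite rank_rV; case: eqP => // /rowP/(_ v0); rewrite !mxE => /eqP.
  by rewrite oner_eq0.
have := mxrank_ker L^T; rewrite rk mxrank_tr => h.
have := rank_leq_row L; lia.
Qed.
End Extensions.

Theorem theorem3p8 (R : realType) (G : metric_graph R) (q : edge G -> R -> R)
    (G_connected : graph_connected G)
    (q_measurable : potential_measurable q)
    (q_bounded : potential_bounded q)
    (q_ge0 : potential_ge0 q) :
  (forall lam : R[i],
     resolvent_set (krein_laplacian q) lam ->
     resolvent_set (dirichlet_laplacian q) lam ->
     [/\ dirichlet_to_neumann q + weyl q lam \in unitmx,
         forall h : L2 G,
           resolvent (krein_laplacian q) lam h -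
             resolvent (dirichlet_laplacian q) lam h =
           - gamma_field q lam
               (invmx (dirichlet_to_neumann q + weyl q lam) *m
                adjoint (gamma_field q (conjc lam)) h)
       & has_dim
           (range (fun h : L2 G =>
              resolvent (krein_laplacian q) lam h -
              resolvent (dirichlet_laplacian q) lam h))
           (nvert G)]) /\
  (forall lam : R[i],
     resolvent_set (krein_laplacian q) lam ->
     resolvent_set (standard_laplacian q) lam ->
     resolvent_set (dirichlet_laplacian q) lam ->
     [/\ dirichlet_to_neumann q + weyl q lam \in unitmx,
         weyl q lam \in unitmx,
         forall h : L2 G,
           resolvent (krein_laplacian q) lam h -
             resolvent (standard_laplacian q) lam h =
           gamma_field q lam
             (invmx (dirichlet_to_neumann q + weyl q lam) *m
              dirichlet_to_neumann q *m invmx (weyl q lam) *m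
              adjoint (gamma_field q (conjc lam)) h),
         has_dim
           (range (fun h : L2 G =>
              resolvent (krein_laplacian q) lam h -
              resolvent (standard_laplacian q) lam h))
           (\rank (dirichlet_to_neumann q))
       & (potential_eq0 q -> \rank (dirichlet_to_neumann q) = (nvert G).-1) /\
         (~ potential_eq0 q -> \rank (dirichlet_to_neumann q) = nvert G)]).
Proof.
have [B qB] := q_bounded.
have [p pP] := @choice _ _ (fun e (p : R -> R) => [/\ measurable_fun setT p,
    forall x, 0 <= p x <= B & ae_eq lebesgue_measure `]0, len e[%classic (q e) p])
  (fun e => borel_potential (len_gt0 e) (q_measurable e) (qB e) (q_ge0 e)).
have mp e : measurable_fun setT (p e) by case: (pP e).
have pB e x : 0 <= p e x <= B by case: (pP e).
have qp e : ae_eq lebesgue_measure `]0, len e[%classic (q e) (p e) by case: (pP e).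
split=> [lam rK rD|lam rK rS rD].
  exact: (krein_dirichlet G_connected mp pB qp rK rD).
have [H1 H2 H3 H4] := krein_standard G_connected mp pB qp rK rS rD.
by split => //; exact: (rank_dirichlet_to_neumann G_connected mp pB qp).
Qed.
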